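(* The set $\mathcal{S}_1(4) \cap (1/4,1/2]$ has finite symmetric difference with the set $\{1/4+1/p : p \in \mathrm{Prog}(8,12)\}=\{1/4+1/(4p) : p \in \mathrm{Prog}(2,3)\}$.
   Context: For $x=(x_1,\ldots,x_n) \in (\mathbb{R}/\mathbb{Z})^n$ let $D(x):=\max_k \|x_k-1/2\|$, where $\|\cdot\|$ denotes distance to the nearest integer; for a closed subset $S$ let $D(S):=\min_{x \in S} D(x)$. A subtorus of $(\mathbb{R}/\mathbb{Z})^n$ is a closed connected subgroup; it is proper if it is not contained in the union of the coordinate hyperplanes $\{x_i=0\}$. $\mathcal{S}_1(n)$ is the set of values $D(T)$ as $T$ ranges over the $1$-dimensional proper subtori of $(\mathbb{R}/\mathbb{Z})^n$. $\mathrm{Prog}(\alpha,\beta):=\{\alpha s+\beta : s \in \mathbb{Z}_{\geq 0}\}$. *)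

(* Defs.v *)
From HB Require Import structures.
From mathcomp Require Import all_boot all_order all_algebra.
From mathcomp Require Import generic_quotient ring_quotient.
From mathcomp Require Import all_classical all_reals all_analysis.

Set Implicit Arguments.
Unset Strict Implicit.
Unset Printing Implicit Defensive.

Import Order.TTheory GRing.Theory Num.Theory.
Import numFieldNormedType.Exports.

Local Open Scope classical_set_scope.
Local Open Scope quotient_scope.
Local Open Scope ring_scope.

(* [Num.int], packaged as a subgroup of R. *)
Definition integers (R : realType) : zmodClosed R :=
  GRing.ZmodClosed.clone R (@Num.int_num_subdef R) _.

(* R/Z with its quotient group structure and its quotient topology. *)
Definition circle (R : realType) : Type :=
  quotient_topology (Quotient.quot (integers R)).
HB.instance Definition _ (R : realType) := PointedTopological.on (circle R).
HB.instance Definition _ (R : realType) := Quotient.on (circle R).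
HB.instance Definition _ (R : realType) :=
  GRing.Zmodule.copy (circle R) (Quotient.quot (integers R)).

Definition toRZ (R : realType) (r : R) : circle R := \pi_(circle R) r.

Lemma toRZ_eq (R : realType) (r s : R) :
  toRZ r = toRZ s <-> r - s \is a Num.int.
Proof.
have E : (r == s %[mod Quotient.quot (integers R)]) = (r - s \is a Num.int).
  by rewrite -Quotient.idealrBE.
by rewrite -E; split=> [h|/eqP //]; apply/eqP.
Qed.

Lemma toRZD (R : realType) : {morph @toRZ R : r s / r + s}.
Proof. exact: (raddfD (\pi_(Quotient.quot (integers R)))). Qed.

Lemma toRZN (R : realType) : {morph @toRZ R : r / - r}.
Proof. exact: (raddfN (\pi_(Quotient.quot (integers R)))). Qed.

Lemma toRZB (R : realType) : {morph @toRZ R : r s / r - s}.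
Proof. by move=> r s; rewrite toRZD toRZN. Qed.

Lemma toRZ_continuous (R : realType) : continuous (@toRZ R).
Proof. exact: pi_continuous. Qed.

Lemma toRZK (R : realType) (x : circle R) : toRZ (repr x) = x.
Proof. exact: reprK. Qed.

(* The distance from r to the nearest integer. *)
Definition dist_int (R : realType) (r : R) : R :=
  inf [set `|r - m%:~R| | m in [set: int]].

Definition circle_norm (R : realType) (x : circle R) : R := dist_int (repr x).

Lemma dist_int_le (R : realType) (r : R) (m : int) :
  dist_int r <= `|r - m%:~R|.
Proof. by apply: ge_inf; [exists 0 => _ [k _ <-] | exists m]. Qed.

Lemma le_dist_int (R : realType) (r c : R) :
  (forall m : int, c <= `|r - m%:~R|) -> c <= dist_int r.
Proof.
move=> h; apply: lb_le_inf; first by exists `|r - 0%:~R|, 0.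
by move=> _ [m _ <-].
Qed.

Lemma dist_int_lip (R : realType) (r s : R) :
  dist_int r <= dist_int s + `|r - s|.
Proof.
rewrite -lerBlDr; apply: le_dist_int => m; rewrite lerBlDr.
by rewrite (le_trans (dist_int_le r m))// [leRHS]addrC ler_distD.
Qed.

Lemma dist_int_continuous (R : realType) : continuous (@dist_int R).
Proof.
move=> r; apply/cvgrPdist_lt => e e0; near=> s.
have rs : `|r - s| < e by near: s; exact: cvgr_dist_lt.
apply: le_lt_trans rs; rewrite ler_norml lerNl opprB !lerBlDl.
by rewrite dist_int_lip andbT distrC dist_int_lip.
Unshelve. all: by end_near. Qed.

Lemma dist_int_period (R : realType) (r s : R) :
  r - s \is a Num.int -> dist_int r = dist_int s.
Proof.
have le (u v : R) : u - v \is a Num.int -> dist_int u <= dist_int v.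
  move=> /intrP[k uv]; apply: le_dist_int => m.
  apply: le_trans (dist_int_le u (m + k)) _.
  by rewrite intrD -uv opprD opprB addrCA [u + _]addrC subrK addrC.
by move=> rs; apply/eqP; rewrite eq_le !le // -rpredN opprB.
Qed.

Lemma circle_norm_toRZ (R : realType) (r : R) :
  circle_norm (toRZ r) = dist_int r.
Proof. by apply: dist_int_period; apply/toRZ_eq; exact: toRZK. Qed.

Lemma circle_norm_ge0 (R : realType) (x : circle R) : 0 <= circle_norm x.
Proof. by apply: le_dist_int => m. Qed.

(* The torus (R/Z)^n is ['rV[circle R]_n], with the coordinatewise group
   structure and the product topology. *)

Definition toTorus (R : realType) (n : nat) (v : 'rV[R]_n) : 'rV[circle R]_n :=
  map_mx (@toRZ R) v.

(* Since the norms are nonnegative, 0 is a neutral default for the maximum. *)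
Definition Dpt (R : realType) (n : nat) (x : 'rV[circle R]_n) : R :=
  \big[Num.max/0]_(k < n) circle_norm (x ord0 k - toRZ 2^-1).

(* For S closed and nonempty the infimum is a minimum: see [Dset_min]. *)
Definition Dset (R : realType) (n : nat) (S : set 'rV[circle R]_n) : R :=
  inf [set Dpt x | x in S].

Lemma circle_compact (R : realType) : compact [set: circle R].
Proof.
have -> : [set: circle R] = @toRZ R @` `[0, 1].
  rewrite eqEsubset; split=> // x _.
  exists (repr x - (Num.floor (repr x))%:~R).
    rewrite /= in_itv /= subr_ge0 Num.Theory.floor_le lerBlDr addrC.
    by rewrite -[X in _ + X]/(1%:~R) -intrD ltW // Num.Theory.floorD1_gt.
  rewrite -[RHS]toRZK; apply/toRZ_eq.
  by rewrite addrAC subrr add0r rpredN intr_int.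
apply: continuous_compact; last exact: segment_compact.
exact/continuous_subspaceT/toRZ_continuous.
Qed.

Lemma torus_compact (R : realType) (n : nat) : compact [set: 'rV[circle R]_n].
Proof.
have := @rV_compact (circle R) n (fun=> setT) (fun=> @circle_compact R).
by congr compact; rewrite eqEsubset.
Qed.

Lemma Dpt_continuous (R : realType) (n : nat) : continuous (@Dpt R n).
Proof.
have coord (k : 'I_n) :
    continuous (fun x : 'rV[circle R]_n => circle_norm (x ord0 k - toRZ 2^-1)).
  move=> x; apply: (@continuous_comp _ _ _ (fun x : 'rV[circle R]_n => x ord0 k)
    (fun y : circle R => circle_norm (y - toRZ 2^-1))).
    move=> U nU; exists (fun i j => if j == k then U else setT).
      by move=> i j; case: eqP => [->|_]; rewrite ?(ord1 i)//; exact: filterT.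
    by move=> y /(_ ord0 k); rewrite eqxx.
  apply: (proj2 (@quotient_continuous R (Quotient.quot (integers R)) _ _)).
  rewrite (_ : _ \o _ = fun r : R => dist_int (r - 2^-1)); last first.
    by apply/funext => r; rewrite /= -[\pi_ _ r]/(toRZ r) -toRZB
      circle_norm_toRZ.
  move=> r; apply: (@continuous_comp _ _ _ (fun r : R => r - 2^-1)
    (@dist_int R)); last exact: dist_int_continuous.
  by apply: cvgB; [exact: cvg_id|exact: cvg_cst].
rewrite /Dpt; elim: (index_enum _) => [|k s IH] x.
  under eq_fun do rewrite big_nil.
  exact: cst_continuous.
under eq_fun do rewrite big_cons.
exact: (@continuous_max R 'rV[circle R]_n
  (fun y => circle_norm (y ord0 k - toRZ 2^-1)) _ x (coord k x) (IH x)).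
Qed.

Lemma Dset_min (R : realType) (n : nat) (S : set 'rV[circle R]_n) :
  closed S -> S !=set0 ->
  exists2 x, S x & Dpt x = Dset S /\ forall y, S y -> Dpt x <= Dpt y.
Proof.
move=> cS S0.
have cpS : compact S by apply: subclosed_compact cS (@torus_compact R n) _.
have [x /set_mem Sx xmin] :=
  compact_EVT_min S0 cpS (continuous_subspaceT (@Dpt_continuous R n)).
have {}xmin y : S y -> Dpt x <= Dpt y by move=> Sy; apply/xmin/mem_set.
exists x => //; split=> //; apply/eqP; rewrite eq_le; apply/andP; split.
  by apply: lb_le_inf => [|_ [y Sy <-]]; [exists (Dpt x), x|exact: xmin].
by apply: ge_inf; [exists (Dpt x) => _ [y Sy <-]; exact: xmin|exists x].
Qed.

Definition subtorus (R : realType) (n : nat) (T : set 'rV[circle R]_n) : Prop :=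
  [/\ closed T, connected T & zmod_closed (mem T)].

(* The dimension of a closed subgroup T as a Lie group: the dimension of its
   Lie algebra, the linear subspace of the v in R^n whose one-parameter
   subgroup lies in T. *)
Definition lie (R : realType) (n : nat) (T : set 'rV[circle R]_n) :
    set 'rV[R]_n :=
  [set v | forall t : R, T (toTorus (t *: v))].

Definition has_dim (R : realType) (n : nat) (T : set 'rV[circle R]_n)
    (d : nat) : Prop :=
  exists2 V : {vspace 'rV[R]_n}, lie T = [set` V] & \dim V = d.

Definition proper_torus (R : realType) (n : nat) (T : set 'rV[circle R]_n) :
    Prop :=
  ~ (T `<=` \bigcup_(i : 'I_n) [set x | x ord0 i = 0]).

Definition spectrum (R : realType) (d n : nat) : set R :=
  [set Dset T | T in [set T : set 'rV[circle R]_n |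
                        [/\ subtorus T, has_dim T d & proper_torus T]]].
Arguments spectrum : clear implicits.

Definition Prog (R : realType) (a b : R) : set R :=
  [set a * s%:R + b | s in [set: nat]].

(* Main.v *)
Require Import Defs.
From mathcomp Require Import all_boot all_order all_algebra.
From mathcomp Require Import all_classical all_reals all_analysis.
From mathcomp Require Import complex.
From mathcomp Require Import ring lra zify.

(* A one-dimensional subtorus is the image of a line R v with v an integer
   vector, so with M(v) the maximum over t of min_k ||t v_k|| the spectrum
   consists of the numbers 1/2 - M(v), and only the v with M(v) < 1/4 matter.
   By a quantitative Kronecker theorem such a v satisfies a bounded relation
   obstructing each target point of the torus that is far from all the
   hyperplanes x_i = 0. The target (1/2, ..., 1/2) yields a relation with odd
   coefficient sum; next to the shortest such relation m, a target on the
   hyperplane m.x = 0 yields a second, independent one. In the lattice spanned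
   by the two, either there is a third target, hence a third independent
   relation, which leaves finitely many lines; or linear programming duality
   along the slice m.z = 1/2 of the cube |z_i| <= 1/4 shows that m has l^1-norm
   3, and then v is, up to order and signs, of the form (a, 2a, 3a, c) or
   (p, u, u - p, u + p). For these M(v) is computed exactly: it is 1/4 - 1/(4 L)
   with L odd. Conversely (1, 2, 3, 4k) has L = 4k + 1, and (8, u, u - 8, u + 8)
   with u = 4k + 3 > 8 has L = u + 4. *)

Set Implicit Arguments.
Unset Strict Implicit.
Unset Printing Implicit Defensive.

Import Order.TTheory GRing.Theory Num.Theory.
Import numFieldNormedType.Exports.

Local Open Scope classical_set_scope.
Local Open Scope quotient_scope.
Local Open Scope ring_scope.

(** * Distance to the nearest integer *)

(** Parity drives the argument. At the target with coordinates 1/2 + x_i / 4, a relation f with odd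
    coefficient sum takes an integer value exactly when f.x is 2 modulo 4. So the centre x = 0 is
    obstructed only by odd relations, and a target in a given plane of relations is a point of the
    open cube |x_i| < 1 at which two odd generators both take a value that is 2 modulo 4. A shortest
    odd relation generates all relations parallel to it, so a relation that fails at a point of its
    hyperplane is independent of it. Its l^1-norm is at least 3, since norm 1 would make an entry of
    v vanish; this puts the slice m.x = 2 inside the open cube. The obstacle is uniformity. The
    bound in Kronecker's theorem depends on the distance of the target from the boundary of the
    cube, and for the third target no such margin is known in advance. The second target has the
    fixed margin 1/12, so only finitely many pairs of relations occur; each pair then has its own
    third target and its own margin. *)

Lemma dist_intP (R : realType) (r : R) :
  exists m : int, `|r - m%:~R| <= 1 / 2 /\ dist_int r = `|r - m%:~R|.
Proof.
pose m := Num.floor (r + 1 / 2).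
have := Num.Theory.floor_le (r + 1 / 2).
have := Num.Theory.floorD1_gt (r + 1 / 2).
rewrite intrD -/m => h1 h2; exists m.
have hm : `|r - m%:~R| <= 1 / 2 by rewrite ler_norml; lra.
split=> //; apply/eqP; rewrite eq_le dist_int_le /=; apply: le_dist_int => k.
have [->//|/eqP km] := eqVneq k m.
have : 1 <= `|(k - m)%:~R : R| by rewrite -intr_norm ler1z; lia.
rewrite intrB => km1.
have := ler_normB (r - m%:~R) (r - k%:~R).
have -> : r - m%:~R - (r - k%:~R) = k%:~R - m%:~R by ring.
lra.
Qed.

Lemma dist_int_le_half (R : realType) (r : R) : dist_int r <= 1 / 2.
Proof. by have [m [h ->]] := dist_intP r. Qed.

Lemma dist_intD_int (R : realType) (r : R) (k : int) :
  dist_int (r + k%:~R) = dist_int r.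
Proof. by apply: dist_int_period; rewrite addrAC subrr add0r intr_int. Qed.

Lemma dist_intN (R : realType) (r : R) : dist_int (- r) = dist_int r.
Proof.
have le (s : R) : dist_int (- s) <= dist_int s.
  apply: le_dist_int => m; rewrite -normrN.
  by apply: le_trans (dist_int_le _ (- m)) _; rewrite intrN opprK opprB addrC -opprB normrN.
by apply/eqP; rewrite eq_le le -{1}[r]opprK le.
Qed.

Lemma dist_int_subhalf (R : realType) (r : R) :
  dist_int (r - 2^-1) = 1 / 2 - dist_int r.
Proof.
have le (s : R) : dist_int (s - 2^-1) <= 1 / 2 - dist_int s.
  have [m [h ->]] := dist_intP s; case: (ger0P (s - m%:~R)) h => h h'.
    apply: le_trans (dist_int_le _ m) _.
    by rewrite ler_norml; lra.
  apply: le_trans (dist_int_le _ (m - 1)) _.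
  by rewrite intrB ler_norml; lra.
apply/eqP; rewrite eq_le le /=.
have [m [_ ->]] := dist_intP r; have [k [_ ->]] := dist_intP (r - 2^-1).
have [km|km] := lerP m k.
  have : (m%:~R : R) <= k%:~R by rewrite ler_int.
  by have := ler_norm (r - m%:~R); have := ler_norm (- (r - 2^-1 - k%:~R)); rewrite normrN; lra.
have : (k + 1)%:~R <= (m%:~R : R) by rewrite ler_int; lia.
by rewrite intrD; have := ler_norm (- (r - m%:~R)); have := ler_norm (r - 2^-1 - k%:~R); rewrite normrN; lra.
Qed.

Lemma le_dist_int_between (R : realType) (k : int) (c r : R) :
  k%:~R + c <= r -> r <= k%:~R + 1 - c -> c <= dist_int r.
Proof.
move=> h1 h2; apply: le_dist_int => m.
have [mk|mk] := lerP m k.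
  have : (m%:~R : R) <= k%:~R by rewrite ler_int.
  by move=> ?; apply: le_trans (ler_norm _); lra.
have : (k + 1)%:~R <= (m%:~R : R) by rewrite ler_int; lia.
by rewrite intrD distrC => ?; apply: le_trans (ler_norm _); lra.
Qed.

(** * One-dimensional subtori *)

Lemma toTorusB (R : realType) (n : nat) : {morph @toTorus R n : u w / u - w}.
Proof. by move=> u w; apply/rowP => k; rewrite !mxE toRZB. Qed.

Lemma toTorusD (R : realType) (n : nat) : {morph @toTorus R n : u w / u + w}.
Proof. by move=> u w; apply/rowP => k; rewrite !mxE toRZD. Qed.

Lemma toTorus0 (R : realType) (n : nat) : toTorus (0 : 'rV[R]_n) = 0.
Proof. by rewrite -(subrr 0) toTorusB subrr. Qed.

Lemma toTorusN (R : realType) (n : nat) : {morph @toTorus R n : u / - u}.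
Proof. by move=> u; rewrite -sub0r toTorusB toTorus0 sub0r. Qed.

Lemma toTorus_surj (R : realType) (n : nat) (x : 'rV[circle R]_n) :
  exists u, x = toTorus u.
Proof.
exists (\row_k repr (x ord0 k)); apply/rowP => k; rewrite !mxE.
by rewrite -[LHS]toRZK.
Qed.

Lemma toRZ_eq0 (R : realType) (r : R) : toRZ r = 0 <-> r \is a Num.int.
Proof.
have -> : 0 = toRZ (0 : R) by rewrite -(subrr (0 : R)) toRZB subrr.
by rewrite toRZ_eq subr0.
Qed.

Lemma toTorus_int (R : realType) (n : nat) (z : 'I_n -> int) :
  toTorus (\row_k (z k)%:~R : 'rV[R]_n) = 0.
Proof. by apply/rowP => k; rewrite !mxE; apply/toRZ_eq0/intr_int. Qed.

Lemma toTorus_continuous (R : realType) (n : nat) : continuous (@toTorus R n).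
Proof.
move=> w U [P nP PU]; exists (fun i j => @toRZ R @^-1` P i j).
  by move=> i j; apply: toRZ_continuous; have := nP i j; rewrite mxE.
by move=> u hu; apply: PU => i j; rewrite mxE; exact: hu.
Qed.

Lemma circle_norm_sub_continuous (R : realType) (c : circle R) :
  continuous (fun z : circle R => circle_norm (z - c)).
Proof.
apply: (proj2 (@quotient_continuous R (Quotient.quot (integers R)) _ _)).
rewrite (_ : _ \o _ = fun r : R => dist_int (r - repr c)); last first.
  apply/funext => r; rewrite /= -[\pi_ _ r]/(toRZ r) -[in LHS](toRZK c).
  by rewrite -toRZB circle_norm_toRZ.
move=> r; apply: (@continuous_comp _ _ _ (fun r : R => r - repr c)
  (@dist_int R)); last exact: dist_int_continuous.
by apply: cvgB; [exact: cvg_id|exact: cvg_cst].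
Qed.

Lemma torus_ball_open (R : realType) (n : nat) (x : 'rV[circle R]_n) (e : R) :
  open [set y : 'rV[circle R]_n | forall k, circle_norm ((y - x) ord0 k) < e].
Proof.
rewrite openE => y hy.
exists (fun i j => [set z : circle R | circle_norm (z - x ord0 j) < e]); last first.
  by move=> z hz k; rewrite !mxE; have := hz ord0 k; rewrite /= ?mxE.
move=> i j; rewrite ord1.
have nU : nbhs (circle_norm (y ord0 j - x ord0 j)) [set r : R | r < e].
  by apply: open_nbhs_nbhs; split; [exact: open_lt|have := hy j; rewrite !mxE].
exact: (@circle_norm_sub_continuous R (x ord0 j) (y ord0 j) _ nU).
Qed.

Lemma coord_norm_le (R : realType) (n : nat) (u : 'rV[R]_n) k :
  `|u ord0 k| <= `|u|.
Proof. by rewrite -[leRHS]/(mx_norm u) mx_normrE; exact: (le_bigmax _ _ (ord0, k)). Qed.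

Lemma norm_lt_coord (R : realType) (n : nat) (u : 'rV[R]_n) (e : R) :
  0 < e -> (forall k, `|u ord0 k| < e) -> `|u| < e.
Proof.
move=> e0 h; rewrite -[ltLHS]/(mx_norm u) mx_normrE; apply: bigmax_lt => //= -[i k] _.
by rewrite ord1; exact: h.
Qed.

(** This is the argument behind the closed subgroup theorem. If arbitrarily short vectors off the
    line of [v] map into [T], subtracting multiples of [v] makes their coordinate [i] zero, where
    [v] has a nonzero one. Their directions accumulate at a unit vector [u] with coordinate [i]
    zero, and integer multiples of the short vectors approximate every [t *: u]. Closedness puts the
    whole line of [u] into [T], so [u] is a multiple of [v], hence 0. *)
Lemma lie_line_isolated (R : realType) (n : nat) (T : set 'rV[circle R]_n)
    (v : 'rV[R]_n) :
  closed T -> zmod_closed (mem T) -> v != 0 ->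
  (forall t, T (toTorus (t *: v))) ->
  (forall u, (forall t, T (toTorus (t *: u))) -> exists a, u = a *: v) ->
  exists2 e : R, 0 < e &
    forall w, T (toTorus w) -> `|w| < e -> exists a, w = a *: v.
Proof.
move=> cT [_ TB] v0 Tv Tline; apply: contrapT => hno.
have {}TB x y : T x -> T y -> T (x - y).
  by move=> /mem_set Tx /mem_set Ty; apply/set_mem/TB.
have T0 : T 0 by have := Tv 0; rewrite scale0r toTorus0.
have TN x : T x -> T (- x) by move=> Tx; rewrite -sub0r; exact: TB.
have TD x y : T x -> T y -> T (x + y).
  by move=> Tx Ty; rewrite -[y]opprK; apply: TB => //; exact: TN.
pose H := [set w : 'rV[R]_n | T (toTorus w)].
have HD u w : H u -> H w -> H (u + w).
  by rewrite /H /= toTorusD; exact: TD.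
have HN u : H u -> H (- u).
  by rewrite /H /= toTorusN; exact: TN.
have HZ u (k : int) : H u -> H (k%:~R *: u).
  move=> Hu; have nat_case m : H (m%:R *: u).
    elim: m => [|m IH]; first by rewrite scale0r /H /= toTorus0.
    by rewrite -natr1 scalerDl scale1r; exact: HD.
  by case: k => m; rewrite ?NegzE ?mulrNz ?scaleNr; [|apply: HN]; exact: nat_case.
have cH : closed H by apply: closed_comp => // x _; exact: toTorus_continuous.
have [i vi] : exists i, v ord0 i != 0.
  apply: contrapT => hv; move/eqP: v0; apply; apply/rowP => k; rewrite mxE.
  by apply/eqP; apply: contrapT => /negP vk; apply: hv; exists k.
have small (e : R) : 0 < e ->
    exists w, [/\ H w, w ord0 i = 0 & 0 < `|w| < e].
  (* [C] bounds the factor by which clearing coordinate [i] along [v] can lengthen a vector. *)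
  move=> e0; pose C := 1 + `|v| / `|v ord0 i|.
  have C0 : 0 < C by rewrite ltr_pwDl.
  apply: contrapT => hw; apply: hno; exists (e / C); first exact: divr_gt0.
  move=> w Hw we; exists (w ord0 i / v ord0 i); apply/eqP; rewrite -subr_eq0.
  apply: contrapT => /negP w0; apply: hw.
  exists (w - (w ord0 i / v ord0 i) *: v); split.
  - by rewrite -scaleNr; apply: HD => //; exact: Tv.
  - by rewrite !mxE divfK // subrr.
  - rewrite normr_gt0 w0 /=; apply: le_lt_trans (ler_normB _ _) _.
    rewrite normrZ normrM normfV; have := coord_norm_le w i => wi.
    apply: le_lt_trans (_ : `|w| * C < _); last by rewrite -ltr_pdivlMr.
    by rewrite /C mulrDr mulr1 lerD2l [leLHS]mulrAC -[leLHS]mulrA ler_wpM2r //.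
have small_inv m : exists w, [/\ H w, w ord0 i = 0 & 0 < `|w| < m.+1%:R^-1].
  by apply: small; rewrite invr_gt0.
have [w hw] := choice small_inv.
pose f m := `|w m|^-1 *: w m.
have f1 m : `|f m| = 1.
  have [_ _ /andP[h _]] := hw m.
  by rewrite normrZ normfV normr_id mulVf // gt_eqF.
have cB : compact [set u : 'rV[R]_n | forall k, `[-1, 1]%classic (u ord0 k)].
  exact: (@rV_compact R n (fun=> `[-1, 1]%classic)
            (fun=> @segment_compact R (-1) 1)).
have [|u [_ cu]] := cB (f @ \oo) _.
  exists 0%N => // m _ k /=; rewrite in_itv /= -ler_norml -(f1 m).
  exact: coord_norm_le.
have {}cu (e : R) (N : nat) : 0 < e -> exists2 m, (N <= m)%N & `|u - f m| < e.
  move=> e0; have [|_ [[m Nm <-] /= h]] :=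
    cu (f @` [set m | (N <= m)%N]) (ball u e) _ (nbhsx_ballx _ _ e0).
    by exists N => // m Nm; exists m.
  by exists m => //; move: h; rewrite -ball_normE.
have u1 : `|u| = 1.
  apply/eqP; rewrite -subr_eq0 -normr_eq0; apply/negP => /negP h.
  have h0 : 0 < `| `|u| - 1| by rewrite lt_def h normr_ge0.
  have [m _] := cu _ 0%N h0; rewrite -(f1 m) => /(le_lt_trans (ler_dist_dist _ _)).
  by rewrite ltxx.
have ui : u ord0 i = 0.
  apply/eqP; rewrite -normr_eq0; apply/negP => /negP h.
  have h0 : 0 < `|u ord0 i| by rewrite lt_def h normr_ge0.
  have [m _] := cu _ 0%N h0; have := coord_norm_le (u - f m) i.
  have [_ wi _] := hw m.
  by rewrite !mxE wi mulr0 subr0 => /le_lt_trans h1 /h1; rewrite ltxx.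
have [t|a ua] := Tline u.
  apply: cH => B /nbhs_ballP[d d0 dB].
  pose N := Num.truncn ((d / 2)^-1); have d2 : 0 < d / 2 by rewrite divr_gt0.
  have e0 : 0 < d / 2 / (`|t| + 1) by rewrite divr_gt0 // ltr_wpDl.
  have [m Nm hm] := cu _ N e0; have [Hw _ /andP[w0 wm]] := hw m.
  have wd : `|w m| < d / 2.
    apply: lt_trans wm _; rewrite -[d / 2]invrK ltf_pV2 ?posrE ?invr_gt0 //.
    apply: lt_le_trans (truncnS_gt _) _; rewrite ler_nat; exact: leq_ltn_trans Nm _.
  pose k := Num.floor (t / `|w m|).
  exists (k%:~R *: w m); split; first exact: HZ.
  apply: dB; rewrite -ball_normE /=.
  have -> : t *: u - k%:~R *: w m = t *: (u - f m) + (t / `|w m| - k%:~R) *: w m.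
    by rewrite scalerBr scalerBl scalerA addrA subrK.
  apply: le_lt_trans (ler_normD _ _) _; rewrite !normrZ.
  have h1 : `|t| * `|u - f m| <= d / 2.
    apply: le_trans (_ : (`|t| + 1) * `|u - f m| <= _).
      by rewrite ler_wpM2r // lerDl.
    by rewrite mulrC -ler_pdivlMr ?ltr_wpDl // ltW.
  have h2 : `|t / `|w m| - k%:~R| * `|w m| <= `|w m|.
    rewrite ler_piMl // ger0_norm ?subr_ge0 ?floor_le //.
    by have := floorD1_gt (t / `|w m|); rewrite -/k intrD; lra.
  lra.
move: u1; rewrite ua normrZ; move: ui; rewrite ua mxE => /eqP.
rewrite mulf_eq0 (negbTE vi) orbF => /eqP ->; rewrite normr0 mul0r.
by move/eqP; rewrite eq_sym oner_eq0.
Qed.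

(* Pigeonhole on the fractional parts of the multiples of v. *)
Lemma almost_period (R : realType) (n : nat) (v : 'rV[R]_n) (e : R) :
  0 < e -> v != 0 ->
  exists (c : R) (z : 'I_n -> int),
    (exists i, z i != 0) /\ `|c *: v - \row_k (z k)%:~R| < e.
Proof.
move=> e0 v0; have [i vi] : exists i, v ord0 i != 0.
  apply: contrapT => hv; move/eqP: v0; apply; apply/rowP => k; rewrite mxE.
  by apply/eqP; apply: contrapT => /negP vk; apply: hv; exists k.
(* With this scaling coordinate [i] of [k c v] is the integer [k], which keeps the integer vector
   found below from being zero. *)
pose c := (v ord0 i)^-1; pose M := (Num.truncn e^-1).+1.
have Me : M%:R^-1 < e.
  rewrite -[e]invrK ltf_pV2 ?posrE ?invr_gt0 ?ltr0n //; exact: truncnS_gt.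
have M0 : 0 < M%:R :> R by rewrite ltr0n.
pose x (k : nat) j : R := k%:R * c * v ord0 j.
pose fr k j : R := x k j - (Num.floor (x k j))%:~R.
have fr01 k j : 0 <= fr k j < 1.
  rewrite /fr subr_ge0 floor_le /=.
  by have := floorD1_gt (x k j); rewrite intrD; lra.
pose K := #|{: {ffun 'I_n -> 'I_M}}|.
pose F (k : 'I_K.+1) : {ffun 'I_n -> 'I_M} :=
  [ffun j => inord `|Num.floor (M%:R * fr k j)|%N].
have /injectivePn[k [l kl Fkl]] : ~~ injectiveb F.
  by apply/negP => /injectiveP /leq_card; rewrite card_ord ltnn.
wlog lk : k l kl Fkl / (l < k)%N.
  move=> wl; have [|] := ltnP l k; first exact: wl.
  rewrite leq_eqVlt => /orP[/eqP/val_inj h|]; first by rewrite h eqxx in kl.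
  by apply: wl; rewrite // eq_sym.
have close j : `|fr k j - fr l j| < M%:R^-1.
  have : F k j = F l j :> nat by rewrite Fkl.
  rewrite !ffunE.
  have b m : (`|Num.floor (M%:R * fr m j)|%N < M)%N /\
      (Num.floor (M%:R * fr m j) = `|Num.floor (M%:R * fr m j)|%N :> int).
    have /andP[f0 f1] := fr01 m j.
    have h0 : 0 <= Num.floor (M%:R * fr m j) by rewrite floor_ge0 mulr_ge0.
    have : Num.floor (M%:R * fr m j) < M by rewrite floor_lt_int -[ltRHS]mulr1 ltr_pM2l.
    by rewrite gez0_abs //; split=> //; lia.
  have [b1 e1] := b k; have [b2 e2] := b l.
  rewrite !inordK // => h; have {h} : Num.floor (M%:R * fr k j) = Num.floor (M%:R * fr l j).
    by rewrite e1 e2 h.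
  have := floor_le (M%:R * fr k j); have := floorD1_gt (M%:R * fr k j).
  have := floor_le (M%:R * fr l j); have := floorD1_gt (M%:R * fr l j).
  move=> h1 h2 h3 h4 h; move: h1 h2 h3 h4; rewrite h intrD => *.
  rewrite -(ltr_pM2l M0) divff ?gt_eqF // -[X in X * _](gtr0_norm M0) -normrM.
  by rewrite ltr_norml; lra.
pose z j := Num.floor (x k j) - Num.floor (x l j).
have diff j : (k - l)%:R * c * v ord0 j - (z j)%:~R = fr k j - fr l j.
  by rewrite /fr /z /x intrB natrB ?(ltnW lk) //; ring.
exists ((k - l)%:R * c), z; split; last first.
  apply: norm_lt_coord => // j; rewrite !mxE diff.
  exact: lt_trans (close j) Me.
exists i; apply/eqP => zi; have := close i; rewrite -diff zi subr0.
rewrite /c mulfVK // ger0_norm // ltNge => /negP; apply.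
apply: le_trans (_ : 1 <= _); last by rewrite ler1n subn_gt0.
by rewrite invf_le1 // ler1n.
Qed.

Definition line (R : realType) (n : nat) (v : 'rV[R]_n) : set 'rV[circle R]_n :=
  [set toTorus (t *: v) | t in [set: R]].

(** Two points of [T] within [e] of each other differ by a point of the line. So the line is both
    open and closed in [T], and connectedness leaves nothing else. *)
Lemma connected_subgroup_line (R : realType) (n : nat)
    (T : set 'rV[circle R]_n) (v : 'rV[R]_n) (e : R) :
  connected T -> zmod_closed (mem T) -> 0 < e ->
  (forall t, T (toTorus (t *: v))) ->
  (forall w, T (toTorus w) -> `|w| < e -> exists a, w = a *: v) ->
  T = line v.
Proof.
move=> conT [_ TB] e0 Tv Te.
have {}TB x y : T x -> T y -> T (x - y).
  by move=> /mem_set Tx /mem_set Ty; apply/set_mem/TB.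
pose B (x : 'rV[circle R]_n) :=
  [set y : 'rV[circle R]_n | forall k, circle_norm ((y - x) ord0 k) < e].
have Bx x : B x x.
  move=> k; rewrite !mxE subrr; apply: le_lt_trans e0.
  have -> : (0 : circle R) = toRZ 0 by rewrite -(subrr (0 : R)) toRZB subrr.
  rewrite circle_norm_toRZ; apply: le_trans (dist_int_le _ 0) _.
  by rewrite subrr normr0.
have near_line x y : T x -> T y -> B x y -> exists a, y - x = toTorus (a *: v).
  move=> Tx Ty Bxy; have [u xyu] := toTorus_surj (y - x).
  have hu k : exists m : int, `|u ord0 k - m%:~R| < e.
    have := Bxy k; rewrite xyu mxE circle_norm_toRZ.
    by have [m [_ ->]] := dist_intP (u ord0 k) => h; exists m.
  have [m hm] := choice hu.
  pose w := u - \row_k (m k)%:~R.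
  have wxy : toTorus w = y - x by rewrite toTorusB toTorus_int subr0.
  have [||a wa] := Te w; first by rewrite wxy; exact: TB.
    by apply: norm_lt_coord => // k; rewrite !mxE; exact: hm.
  by exists a; rewrite -wxy wa.
have lineT : line v `<=` T by move=> _ [t _ <-]; exact: Tv.
have lineB x y : line v x -> line v y -> line v (x + y).
  by move=> [t _ <-] [s _ <-]; exists (t + s) => //; rewrite scalerDl toTorusD.
have lineN x : line v x -> line v (- x).
  by move=> [t _ <-]; exists (- t) => //; rewrite scaleNr toTorusN.
have cover_open (A : set 'rV[circle R]_n) : open (\bigcup_(x in A) B x).
  by apply: bigcup_open => x _; exact: torus_ball_open.
apply/esym/conT.
- by exists (toTorus (0 *: v)), 0.
- exists (\bigcup_(x in line v) B x); first exact: cover_open.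
  rewrite eqEsubset; split=> [x lx|y [Ty [x lx Bxy]]].
    by split; [exact: lineT|exists x].
  have [a ya] := near_line x y (lineT _ lx) Ty Bxy.
  by rewrite -(subrK x y) ya; apply: lineB => //; exists a.
- exists (~` \bigcup_(x in T `\` line v) B x).
    by rewrite closedC; exact: cover_open.
  rewrite eqEsubset; split=> [y ly|x [Tx hx]].
    split; first exact: lineT.
    move=> [x [Tx nlx] Bxy]; apply: nlx.
    have [a ya] := near_line x y Tx (lineT _ ly) Bxy.
    rewrite -[x](subKr y) ya; apply: lineB => //; apply: lineN.
    by exists a.
  by apply: contrapT => nlx; apply: hx; exists x.
Qed.

(** That the maximum M(v) equals [x] is expressed throughout by [lonely v c <-> c <= x] for all [c];
    the case [c = x] says that it is attained. *)
Definition lonely (R : realType) (n : nat) (v : 'I_n -> int) (c : R) : Prop :=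
  exists t : R, forall k, c <= dist_int (t * (v k)%:~R).

Definition int_row (R : realType) (n : nat) (v : 'I_n -> int) : 'rV[R]_n :=
  \row_k (v k)%:~R.

Lemma DptE (R : realType) (n : nat) (u : 'rV[R]_n) :
  Dpt (toTorus u) = \big[Num.max/0]_(k < n) (1 / 2 - dist_int (u ord0 k)).
Proof.
apply: eq_bigr => k _.
by rewrite mxE -toRZB circle_norm_toRZ dist_int_subhalf.
Qed.

Lemma Dpt_le (R : realType) (n : nat) (u : 'rV[R]_n) (c : R) : c <= 1 / 2 ->
  Dpt (toTorus u) <= 1 / 2 - c <-> forall k, c <= dist_int (u ord0 k).
Proof.
move=> c2; rewrite DptE; split=> [h k|h].
  have := le_trans (le_bigmax _ (fun k => 1 / 2 - dist_int (u ord0 k)) k) h.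
  lra.
apply: bigmax_le => [|k _]; first lra.
by have := h k; lra.
Qed.

Lemma line_zmod (R : realType) (n : nat) (v : 'rV[R]_n) :
  zmod_closed (mem (line v)).
Proof.
split; first by apply/mem_set; exists 0; rewrite // scale0r toTorus0.
move=> x y /set_mem[t _ <-] /set_mem[s _ <-]; apply/mem_set.
by exists (t - s) => //; rewrite scalerBl toTorusB.
Qed.

Lemma scale_continuous (R : realType) (n : nat) (v w : 'rV[R]_n) :
  continuous (fun t : R => t *: v + w).
Proof.
by move=> t; apply: cvgD; [apply: cvgZr_tmp; exact: cvg_id|exact: cvg_cst].
Qed.

Lemma line_connected (R : realType) (n : nat) (v : 'rV[R]_n) :
  connected (line v).
Proof.
have -> : line v = (fun t : R => toTorus (t *: v + 0)) @` setT.
  by rewrite eqEsubset; split=> _ [t _ <-]; exists t; rewrite // addr0.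
apply: connected_continuous_connected.
  by apply/connected_intervalP.
apply: continuous_subspaceT => t.
apply: (@continuous_comp _ _ _ (fun t : R => t *: v + 0) (@toTorus R n)).
  exact: scale_continuous.
exact: toTorus_continuous.
Qed.

(** For integral [v] the distance from [t v] to a lift [w] of a limit point has period 1 in [t], so
    it attains its minimum on [[0, 1]]. A positive minimum gives a neighbourhood of the limit point
    that misses the line; minimum zero puts the point on the line. *)
Lemma line_closed (R : realType) (n : nat) (v : 'I_n -> int) :
  closed (line (int_row R v)).
Proof.
move=> x clx; have [w xw] := toTorus_surj x.
(* [Dpt] measures the distance to the point with all coordinates 1/2; the shift by [h - w] turns it
   into the distance to [w], with continuity for free. *)
pose h : 'rV[R]_n := const_mx 2^-1.
pose f (t : R) := Dpt (toTorus (t *: int_row R v + (h - w))).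
have fE t : f t = \big[Num.max/0]_(k < n) dist_int (t * (v k)%:~R - w ord0 k).
  rewrite /f DptE; apply: eq_bigr => k _; rewrite !mxE addrCA addrC addrAC.
  have := dist_int_subhalf (t * (v k)%:~R - w ord0 k + 2^-1).
  by rewrite addrK => ->; rewrite addrAC.
have f_cont : {within `[0, 1], continuous f}.
  apply: continuous_subspaceT => t.
  apply: (@continuous_comp R 'rV[circle R]_n R
           (fun t => toTorus (t *: int_row R v + (h - w)))
           (@Dpt R n)); last exact: Dpt_continuous.
  apply: (@continuous_comp R 'rV[R]_n 'rV[circle R]_n
           (fun t => t *: int_row R v + (h - w))
           (@toTorus R n)); last exact: toTorus_continuous.
  exact: scale_continuous.
have [t0 _ ht0] := EVT_min ler01 f_cont.
have min_f t : f t0 <= f t.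
  have -> : f t = f (t - (Num.floor t)%:~R).
    rewrite !fE; apply: eq_bigr => k _.
    rewrite -[RHS](dist_intD_int _ (Num.floor t * v k)) intrM; congr dist_int.
    by ring.
  apply: ht0; rewrite in_itv /= subr_ge0 floor_le.
  by have := floorD1_gt t; rewrite intrD; lra.
have [f0|f0] := lerP (f t0) 0.
  exists t0 => //; rewrite xw; apply/rowP => k; rewrite !mxE; apply/toRZ_eq.
  have : dist_int (t0 * (v k)%:~R - w ord0 k) <= 0.
    apply: le_trans f0; rewrite fE.
    exact: (le_bigmax _ (fun k => dist_int (t0 * (v k)%:~R - w ord0 k)) k).
  have [m [_ ->]] := dist_intP (t0 * (v k)%:~R - w ord0 k).
  by rewrite normr_le0 subr_eq0 => /eqP ->; exact: intr_int.
have nB : nbhs x [set y : 'rV[circle R]_n |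
    forall k, circle_norm ((y - x) ord0 k) < f t0].
  apply: open_nbhs_nbhs; split; first exact: torus_ball_open.
  move=> k; rewrite !mxE subrr; apply: le_lt_trans f0.
  have -> : (0 : circle R) = toRZ 0 by rewrite -(subrr (0 : R)) toRZB subrr.
  rewrite circle_norm_toRZ; apply: le_trans (dist_int_le _ 0) _.
  by rewrite subrr normr0.
have [_ [[t _ <-] /= hy]] := clx _ nB.
have := min_f t; rewrite leNgt => /negP; case; rewrite {1}fE.
apply: bigmax_lt => // k _; have := hy k.
by rewrite xw !mxE -toRZB circle_norm_toRZ.
Qed.

Lemma scale_int_eq0 (R : realType) (x : R) :
  (forall t : R, t * x \is a Num.int) -> x = 0.
Proof.
move=> h; apply/eqP; apply: contrapT => /negP x0.
have /intrP[m] := h (2^-1 / x); rewrite divfK // => hm.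
have : (1 : int)%:~R = (2 * m)%:~R :> R by rewrite intrM -hm; lra.
by move/intr_inj; lia.
Qed.

(** Eliminating the parameter of the line shows that [t (u_j v_i - u_i v_j)] is an integer for every
    real [t], so the minor vanishes. *)
Lemma line_lie (R : realType) (n : nat) (v : 'I_n -> int) (i : 'I_n)
    (u : 'rV[R]_n) :
  v i != 0 -> lie (line (int_row R v)) u -> exists a, u = a *: int_row R v.
Proof.
move=> vi hu; exists (u ord0 i / (v i)%:~R); apply/rowP => j; rewrite !mxE.
have vi0 : (v i)%:~R != 0 :> R by rewrite intr_eq0.
apply/(mulIf vi0)/eqP; rewrite mulrAC divfK // -subr_eq0; apply/eqP.
apply: scale_int_eq0 => t; have [a _ /rowP e] := hu t.
have := e j; have := e i; rewrite !mxE => /toRZ_eq /intrP[p hp] /toRZ_eq /intrP[q hq].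
have -> : t * (u ord0 j * (v i)%:~R - u ord0 i * (v j)%:~R) =
    (p * v j - q * v i)%:~R.
  by rewrite intrB !intrM -hp -hq; ring.
exact: intr_int.
Qed.

Lemma line_has_dim (R : realType) (n : nat) (v : 'I_n -> int) (i : 'I_n) :
  v i != 0 -> has_dim (line (int_row R v)) 1.
Proof.
move=> vi; exists (<[int_row R v]>)%VS.
  rewrite eqEsubset; split=> [u /(line_lie vi)[a ->]|u /vlineP[a ->] t].
    by rewrite /= memvZ // memv_line.
  by exists (t * a) => //; rewrite scalerA.
rewrite dim_vline; case: eqP => // /rowP /(_ i); rewrite !mxE => /eqP.
by rewrite intr_eq0 (negbTE vi).
Qed.

(** One point has to avoid all the hyperplanes at once: with [S] larger than every [|v k|], the
    coordinates of [v / S] are nonzero and strictly between -1 and 1. *)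
Lemma line_proper (R : realType) (n : nat) (v : 'I_n -> int) :
  proper_torus (line (int_row R v)) <-> forall k, v k != 0.
Proof.
split=> [hp k|v0 hp].
  apply/eqP => vk; apply: hp => _ [t _ <-]; exists k => //=.
  by rewrite !mxE vk mulr0; apply/toRZ_eq0; rewrite rpred0.
pose S : R := 1 + \sum_k `|(v k)%:~R|.
have S0 : 0 < S by rewrite ltr_pwDl // sumr_ge0.
have [|k _ /=] := hp (toTorus (S^-1 *: int_row R v)); first by exists S^-1.
rewrite !mxE => /toRZ_eq0/intrP[m hm].
have vk : 0 < `|(v k)%:~R : R| by rewrite normr_gt0 intr_eq0.
have vS : `|(v k)%:~R : R| < S.
  rewrite /S (bigD1 k) //=; have : 0 <= \sum_(j | j != k) `|(v j)%:~R : R|.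
    exact: sumr_ge0.
  lra.
have : `|m%:~R : R| = `|(v k)%:~R| / S.
  by rewrite -hm normrM normfV (gtr0_norm S0) mulrC.
have : 0 < `|(v k)%:~R : R| / S < 1.
  by rewrite divr_gt0 //= ltr_pdivrMr // mul1r.
move=> h e; move: h; rewrite -e -intr_norm ltr0z ltrz1; lia.
Qed.

Lemma Dset_line (R : realType) (n : nat) (v : 'I_n -> int) (c : R) :
  (0 < n)%N -> lonely v c <-> c <= 1 / 2 - Dset (line (int_row R v)).
Proof.
case: n v => // n v _; set T := line _.
have T0 : T !=set0 by exists (toTorus (0 *: int_row R v)), 0.
have [_ [t0 _ <-] [t0D t0min]] := Dset_min (@line_closed R _ v) T0.
have lt0 d : (forall k, d <= dist_int (t0 * (v k)%:~R)) <->
    d <= 1 / 2 - Dset T.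
  rewrite -t0D; split=> h.
    have d2 : d <= 1 / 2 := le_trans (h ord0) (dist_int_le_half _).
    suff : Dpt (toTorus (t0 *: int_row R v)) <= 1 / 2 - d by lra.
    by apply/Dpt_le => // k; rewrite !mxE.
  move=> k; have D0 : 0 <= Dpt (toTorus (t0 *: int_row R v)).
    by rewrite DptE; exact: bigmax_ge_id.
  have d2 : d <= 1 / 2 by lra.
  have hd : Dpt (toTorus (t0 *: int_row R v)) <= 1 / 2 - d by lra.
  by have := (Dpt_le _ d2).1 hd k; rewrite !mxE.
split=> [[t ht]|/lt0 h]; last by exists t0.
have c2 : c <= 1 / 2 := le_trans (ht ord0) (dist_int_le_half _).
have : Dpt (toTorus (t *: int_row R v)) <= 1 / 2 - c.
  by apply/Dpt_le => // k; rewrite !mxE.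
have : Dpt (toTorus (t0 *: int_row R v)) <= Dpt (toTorus (t *: int_row R v)).
  by apply: t0min; exists t.
rewrite t0D; lra.
Qed.

(** Once [T] is known to be a line, the rationality of its direction remains. An integer vector [z]
    lies close to some [c v]; the short vector [c v - z] maps into [T], so it is a multiple of [v],
    and so is [z]. *)
Lemma spectrum1P (R : realType) (n : nat) (D : R) : (0 < n)%N ->
  spectrum R 1 n D <->
  exists v : 'I_n -> int, (forall k, v k != 0) /\
    forall c, lonely v c <-> c <= 1 / 2 - D.
Proof.
move=> n0; split=> [[T [[cT conT zT] [V lieT dimV] pT] <-]|[v [v0 hv]]].
  pose v := vpick V.
  have v0 : v != 0.
    by rewrite vpick0 -dimv_eq0 dimV.
  have Tv t : T (toTorus (t *: v)).
    have : lie T v by rewrite lieT /= memv_pick.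
    exact.
  have Vv : V = <[v]>%VS.
    by apply/esym/eqP; rewrite eqEdim -memvE memv_pick dimV dim_vline v0.
  have Tline u : (forall t, T (toTorus (t *: u))) -> exists a, u = a *: v.
    move=> hu; have : lie T u by [].
    by rewrite lieT Vv /= => /vlineP.
  have [e e0 he] := lie_line_isolated cT zT v0 Tv Tline.
  have Tl := connected_subgroup_line conT zT e0 Tv he.
  have [c [z [[i zi] cz]]] := almost_period e0 v0.
  have [b zb] : exists b, int_row R z = b *: v.
    have [|a ha] := he (c *: v - int_row R z) _ cz.
      by rewrite toTorusB toTorus_int subr0.
    by exists (c - a); rewrite scalerBl -ha subKr.
  have b0 : b != 0.
    apply/eqP => b0; move/rowP: zb => /(_ i); rewrite b0 scale0r !mxE => /eqP.
    by rewrite intr_eq0 (negbTE zi).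
  have Tz : T = line (int_row R z).
    rewrite Tl zb eqEsubset; split=> _ [t _ <-].
      by exists (t / b) => //; rewrite scalerA divfK.
    by exists (t * b) => //; rewrite scalerA.
  exists z; split; first by apply/(line_proper R); rewrite -Tz.
  by move=> d; rewrite Tz; exact: Dset_line.
exists (line (int_row R v)); last first.
  have h c : c <= 1 / 2 - D <-> c <= 1 / 2 - Dset (line (int_row R v)).
    by rewrite -hv; exact: Dset_line.
  have := (h (1 / 2 - D)).1 (lexx _).
  have := (h (1 / 2 - Dset (line (int_row R v)))).2 (lexx _).
  lra.
split; [split| |].
- exact: line_closed.
- exact: line_connected.
- exact: line_zmod.
- by case: n n0 v v0 {hv} => // n _ v v0; exact: (@line_has_dim _ _ _ ord0).
- exact/line_proper.
Qed.

(** * A quantitative Kronecker theorem *)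

Definition cis (R : realType) (x : R) : R[i] := Complex (cos x) (sin x).

Lemma cisD (R : realType) (x y : R) : cis (x + y) = cis x * cis y.
Proof.
apply/eqP; rewrite eq_complex /= cosD sinD eqxx /=.
by rewrite [cos x * sin y + _]addrC.
Qed.

Lemma cis0 (R : realType) : cis (0 : R) = 1.
Proof. by rewrite /cis cos0 sin0. Qed.

Lemma cis_sum (R : realType) (I : finType) (x : I -> R) :
  cis (\sum_i x i) = \prod_i cis (x i).
Proof. exact: (big_morph (@cis R) (@cisD R) (@cis0 R)). Qed.

Lemma cisMn (R : realType) (x : R) (n : nat) : cis (x *+ n) = cis x ^+ n.
Proof.
by elim: n => [|n IH]; rewrite ?mulr0n ?cis0 ?expr0 // mulrS cisD IH exprS.
Qed.

Lemma cis_2pi_int (R : realType) (k : int) : cis (pi *+ 2 * k%:~R : R) = 1.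
Proof.
have nat_case n : cis (pi *+ 2 * n%:R : R) = 1.
  by rewrite mulr_natr cisMn /cis cos2pi sin2pi expr1n.
case: k => n; first exact: nat_case.
rewrite NegzE intrN mulrN -[LHS]mulr1 -(nat_case n.+1) -cisD.
by rewrite addNr cis0.
Qed.

Lemma cis_neq1 (R : realType) (x : R) : 0 < `|x| < pi *+ 2 -> cis x != 1.
Proof.
move=> /andP[x0 x2]; apply/eqP => -[cx _].
have : 0 < sin (`|x| / 2).
  by apply: sin_gt0_pi; rewrite divr_gt0 //= ltr_pdivrMr // mulr_natr.
have : cos (`|x| / 2 *+ 2) = 1 by rewrite -mulr_natr divfK // cos_norm.
rewrite cos_mulr2n cos2sin2; nra.
Qed.

(** Orthogonality of characters: the ratio [z] is an [L]-th root of unity, and [0 < |c| < L] keeps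
    it different from 1. *)
Lemma cis_geometric_sum (R : realType) (L : nat) (c : int) (y : R) :
  c != 0 -> (`|c| < L)%N ->
  \sum_(j < L) cis (pi *+ 2 * (j%:R * c%:~R / L%:R - y)) = 0.
Proof.
move=> c0 cL; have L0 : 0 < L%:R :> R by rewrite ltr0n; lia.
pose z := cis (pi *+ 2 * (c%:~R / L%:R) : R).
have z1 : z != 1.
  apply: cis_neq1; have p0 := @pi_gt0 R.
  have a0 : 0 < `|c%:~R / L%:R : R|.
    by rewrite normr_gt0 mulf_neq0 ?invr_eq0 ?intr_eq0 // gt_eqF.
  have a1 : `|c%:~R / L%:R : R| < 1.
    rewrite normrM normfV (gtr0_norm L0) ltr_pdivrMr // mul1r -intr_norm.
    by rewrite -[L%:R]/(L%:Z%:~R) ltr_int; lia.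
  have tp0 : 0 < pi *+ 2 :> R by rewrite pmulrn_lgt0.
  by rewrite normrM gtr0_norm //; apply/andP; split; [apply: mulr_gt0|rewrite gtr_pMr].
have -> : \sum_(j < L) cis (pi *+ 2 * (j%:R * c%:~R / L%:R - y)) =
    \sum_(j < L) z ^+ j * cis (pi *+ 2 * - y).
  apply: eq_bigr => j _; rewrite /z -cisMn -cisD; congr cis.
  by rewrite -mulr_natr; ring.
rewrite -mulr_suml; have := subrX1 z L.
have -> : z ^+ L = 1.
  rewrite /z -cisMn -(cis_2pi_int R c); congr (cis _).
  by rewrite -[LHS]mulr_natr -mulrA divfK ?gt_eqF.
rewrite subrr; move/esym/eqP; rewrite mulf_eq0 subr_eq0 (negbTE z1) /= => /eqP ->.
by rewrite mul0r.
Qed.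

Definition multibinom (n p : nat) (f : {ffun 'I_n -> 'I_p.+1}) : nat :=
  \prod_i 'C(p, f i).

Lemma prod_cis_expansion (R : realType) (n p : nat) (x : 'I_n -> R) :
  \prod_i (cis (x i) + 1) ^+ p =
  \sum_(f : {ffun 'I_n -> 'I_p.+1})
     (multibinom f)%:R * cis (\sum_i (f i)%:R * x i).
Proof.
under eq_bigr => i _ do rewrite exprD1n.
rewrite bigA_distr_bigA; apply: eq_bigr => f _.
rewrite cis_sum /multibinom natr_prod -big_split /=; apply: eq_bigr => i _.
by rewrite -cisMn -mulr_natl -[x i *+ _]mulr_natl.
Qed.

Lemma sum_multibinom (n p : nat) :
  (\sum_(f : {ffun 'I_n -> 'I_p.+1}) multibinom f = 2 ^ (p * n))%N.
Proof.
rewrite /multibinom -(bigA_distr_bigA (fun (_ : 'I_n) (j : 'I_p.+1) => 'C(p, j))) /=.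
under eq_bigr => i _.
  have -> : (\sum_(j < p.+1) 'C(p, j) = 2 ^ p)%N.
    rewrite (expnDn 1 1); apply: eq_bigr => j _.
    by rewrite !exp1n !muln1.
  over.
by rewrite prod_nat_const card_ord expnM.
Qed.

Lemma real_complex_fejer (R : realType) (x : R) :
  ((2 + 2 * cos x)%:C)%C = (cis x + 1) * (cis (- x) + 1).
Proof.
rewrite /cis cosN sinN; apply/eqP; rewrite eq_complex /=.
apply/andP; split; apply/eqP; last by ring.
by have := cos2Dsin2 x; rewrite !expr2 => h; rewrite -[2 in LHS]/(1 + 1) -{1}h; ring.
Qed.

(** Each factor is |1 + cis x|^2, so the product is the squared modulus of a polynomial with
    nonnegative coefficients. Hence the frequencies are differences [f - g] and all weights are
    nonnegative. *)
Lemma fejer_expansion (R : realType) (n p : nat) (x : 'I_n -> R) :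
  ((\prod_i (2 + 2 * cos (x i)) ^+ p)%:C)%C =
  \sum_(f : {ffun 'I_n -> 'I_p.+1}) \sum_(g : {ffun 'I_n -> 'I_p.+1})
     (multibinom f * multibinom g)%:R *
     cis (\sum_i ((f i)%:Z - (g i)%:Z)%:~R * x i).
Proof.
rewrite rmorph_prod /=.
under eq_bigr => i _ do rewrite rmorphXn /= real_complex_fejer exprMn.
rewrite big_split /= !prod_cis_expansion big_distrl /=.
apply: eq_bigr => f _; rewrite big_distrr /=; apply: eq_bigr => g _.
rewrite mulrACA -natrM -cisD; congr (_ * cis _); rewrite -big_split /=.
by apply: eq_bigr => i _; rewrite intrB; ring.
Qed.

Definition dot (n : nat) (m v : 'I_n -> int) : int := \sum_i m i * v i.

(** Summing over [t = j / L] kills every frequency that is not a relation of [v]; the relations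
    contribute their weight, because the hypothesis on [y] makes their phase trivial. The terms
    [f = g] already give the bound: by Cauchy-Schwarz the sum of the squared weights is at least the
    square [4 ^ (p n)] of their sum divided by their number [(p + 1) ^ n]. *)
Lemma fejer_average (R : realType) (n p L : nat) (v : 'I_n -> int)
    (y : 'I_n -> R) :
  (forall m, (forall i, (`|m i| <= p)%N) -> (`|dot m v| < L)%N) ->
  (forall m, (forall i, (`|m i| <= p)%N) -> dot m v = 0 ->
     \sum_i (m i)%:~R * y i \is a Num.int) ->
  L%:R * 4 ^+ (p * n) / (p.+1 ^ n)%:R <=
  \sum_(j < L) \prod_i
     (2 + 2 * cos (pi *+ 2 * (j%:R * (v i)%:~R / L%:R - y i))) ^+ p.
Proof.
move=> hL hy; pose T : finType := {ffun 'I_n -> 'I_p.+1}.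
pose d (f g : T) i := (f i)%:Z - (g i)%:Z.
have dp f g i : (`|d f g i| <= p)%N.
  by have := ltn_ord (f i); have := ltn_ord (g i); rewrite /d; lia.
have -> : \sum_(j < L) \prod_i
     (2 + 2 * cos (pi *+ 2 * (j%:R * (v i)%:~R / L%:R - y i))) ^+ p =
   \sum_(f : T) \sum_(g : T) (multibinom f * multibinom g)%:R *
      (if dot (d f g) v == 0 then L%:R else 0) :> R.
  apply: (@complexI R); rewrite rmorph_sum /=.
  under eq_bigr => j _ do rewrite fejer_expansion.
  rewrite exchange_big rmorph_sum /=; apply: eq_bigr => f _.
  rewrite exchange_big rmorph_sum /=; apply: eq_bigr => g _.
  rewrite -mulr_sumr [RHS]rmorphM /= rmorph_nat; congr (_ * _).
  have dotE j : \sum_i (d f g i)%:~R *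
      (pi *+ 2 * (j%:R * (v i)%:~R / L%:R - y i)) =
      pi *+ 2 * (j%:R * (dot (d f g) v)%:~R / L%:R
                 - \sum_i (d f g i)%:~R * y i).
    rewrite /dot rmorph_sum /= mulr_sumr mulr_suml -sumrB mulr_sumr.
    by apply: eq_bigr => i _; rewrite intrM; ring.
  under eq_bigr => j _ do rewrite dotE.
  have [e0|e0] := eqVneq (dot (d f g) v) 0; last first.
    by rewrite cis_geometric_sum // hL.
  have /intrP[k ->] := hy _ (dp f g) e0.
  rewrite e0; under eq_bigr => j _ do
    rewrite mulr0 mul0r sub0r -intrN cis_2pi_int.
  by rewrite sumr_const card_ord rmorph_nat.
pose W : R := \sum_(f : T) (multibinom f)%:R.
have WE : W = 2 ^+ (p * n) by rewrite /W -natr_sum sum_multibinom natrX.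
have cardT : #|T| = (p.+1 ^ n)%N by rewrite card_ffun !card_ord.
apply: le_trans (_ : L%:R * \sum_(f : T) (multibinom f)%:R ^+ 2 <= _).
  rewrite -mulrA ler_wpM2l //.
  have -> : 4 ^+ (p * n) = W ^+ 2 :> R.
    have -> : 4 = 2 ^+ 2 :> R by ring.
    by rewrite WE -!exprM mulnC.
  rewrite ler_pdivrMr ?ltr0n ?expn_gt0 // -cardT.
  set N : R := #|T|%:R; have N0 : 0 < N by rewrite ltr0n cardT expn_gt0.
  have : 0 <= \sum_(f : T) (N * (multibinom f)%:R - W) ^+ 2.
    by apply: sumr_ge0 => f _; exact: sqr_ge0.
  under eq_bigr => f _.
    have -> : (N * (multibinom f)%:R - W) ^+ 2 =
      N ^+ 2 * (multibinom f)%:R ^+ 2 - (2 * N * W) * (multibinom f)%:R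
      + W ^+ 2 by ring.
    over.
  rewrite big_split /= sumrB -!mulr_sumr sumr_const -/W -[_ *+ #|_|]mulr_natl -/N.
  set S : R := \sum_f _ => h; rewrite -(ler_pM2l N0); lra.
rewrite mulr_sumr; apply: ler_sum => f _.
rewrite (bigD1 f) //= ifT; last first.
  by apply/eqP/big1 => i _; rewrite /d subrr mul0r.
rewrite mulrC natrM -expr2 lerDl; apply: sumr_ge0 => g _.
by rewrite mulr_ge0 //; case: ifP.
Qed.

Lemma bernoulli (R : realType) (h : R) (n : nat) :
  0 <= h -> 1 + n%:R * h <= (1 + h) ^+ n.
Proof.
move=> h0; elim: n => [|n IH]; first by rewrite mul0r addr0 expr0.
rewrite exprS -natr1; have n0 : 0 <= n%:R :> R by [].
have : 0 <= (1 + h) * ((1 + h) ^+ n - (1 + n%:R * h)).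
  by apply: mulr_ge0; lra.
have : 0 <= n%:R * (h * h) by rewrite !mulr_ge0.
lra.
Qed.

(** Writing [q] as [(1 + h)^-2], Bernoulli's bound [(1 + p h)^2] exceeds [p + 1] as soon as
    [p h^2 > 1]. *)
Lemma succ_mul_exprn_lt1 (R : realType) (q : R) :
  0 <= q < 1 -> exists P, forall p, (P <= p)%N -> p.+1%:R * q ^+ p < 1.
Proof.
move=> /andP[q0 q1]; have [->|qn0] := eqVneq q 0.
  by exists 1%N => -[|p] // _; rewrite expr0n mulr0.
have {q0}qgt0 : 0 < q by rewrite lt_def qn0.
pose r := Num.sqrt q; have r0 : 0 < r by rewrite sqrtr_gt0.
have rq : r ^+ 2 = q by rewrite sqr_sqrtr // ltW.
have r1 : r < 1 by rewrite expr2 in rq; nra.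
pose h := r^-1 - 1.
have h0 : 0 < h by rewrite subr_gt0 invf_gt1.
exists (Num.truncn (h ^- 2)).+1 => p hp.
have ph : h ^- 2 < p%:R.
  apply: lt_le_trans (_ : (Num.truncn (h ^- 2)).+1%:R <= _); last by rewrite ler_nat.
  by rewrite truncnS_gt.
have p0 : 0 < p%:R :> R by apply: le_lt_trans ph; rewrite invr_ge0 exprn_ge0 // ltW.
have ph2 : 1 < p%:R * h ^+ 2.
  by rewrite -(ltr_pdivrMr _ _ (exprn_gt0 2 h0)) mul1r.
have b := bernoulli p (ltW h0).
have -> : q ^+ p = (1 + h) ^- p ^+ 2.
  have -> : 1 + h = r^-1 by rewrite /h addrC subrK.
  by rewrite -exprVn invrK -rq -!exprM mulnC.
have b1 : 0 < 1 + p%:R * h by have := mulr_gt0 p0 h0; lra.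
have B0 := lt_le_trans b1 b.
rewrite exprVn ltr_pdivrMr ?mul1r; last by rewrite exprn_gt0.
apply: lt_le_trans (_ : (1 + p%:R * h) ^+ 2 <= _); last first.
  by rewrite lerXn2r // nnegrE ltW.
rewrite -natr1; have := mulr_gt0 p0 h0.
have : 0 < p%:R * (p%:R * h ^+ 2 - 1) by rewrite mulr_gt0 // subr_gt0.
by rewrite expr2 sqrrD; lra.
Qed.

(** A square root of [q] pays for each further factor [p + 1]. *)
Lemma poly_mul_exprn_lt1 (R : realType) (n : nat) (q : R) :
  0 <= q < 1 -> exists P, forall p, (P <= p)%N -> (p.+1 ^ n)%:R * q ^+ p < 1.
Proof.
elim: n q => [|n IH] q /andP[q0 q1].
  exists 1%N => p hp; rewrite expn0 mul1r exprn_ilt1 //; lia.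
pose r := Num.sqrt q; have r0 : 0 <= r by rewrite sqrtr_ge0.
have rq : r ^+ 2 = q by rewrite sqr_sqrtr.
have r1 : r < 1 by rewrite expr2 in rq; nra.
have r01 : 0 <= r < 1 by rewrite r0.
have [P1 h1] := IH _ r01; have [P2 h2] := succ_mul_exprn_lt1 r01.
exists (maxn P1 P2) => p; rewrite geq_max => /andP[/h1 {}h1 /h2 {}h2].
have -> : q ^+ p = r ^+ p * r ^+ p by rewrite -rq -exprM -exprD addnn -mul2n.
rewrite expnSr natrM mulrACA.
by apply: mulr_ilt1 => //; rewrite mulr_ge0 // exprn_ge0.
Qed.

Lemma cos_2pi_le (R : realType) (e x : R) :
  0 < e <= 1 / 2 -> e <= dist_int x -> cos (pi *+ 2 * x) <= cos (pi *+ 2 * e).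
Proof.
move=> /andP[e0 e2]; have [m [h ->]] := dist_intP x => ex.
have -> : cos (pi *+ 2 * x) = cos (pi *+ 2 * `|x - m%:~R|).
  have -> : pi *+ 2 * `|x - m%:~R| = `|pi *+ 2 * (x - m%:~R)|.
    by rewrite normrM (ger0_norm (mulrn_wge0 _ (pi_ge0 _))).
  rewrite cos_norm; have : cis (pi *+ 2 * x) = cis (pi *+ 2 * (x - m%:~R)).
    rewrite -[LHS]mulr1 -(cis_2pi_int R (- m)) -cisD intrN; congr cis; ring.
  by case.
have p0 := @pi_gt0 R; move: ex; rewrite le_eqVlt => /orP[/eqP->//|ex].
apply/ltW; rewrite ltr_cos ?in_itv /=.
- by rewrite ltr_pM2l // pmulrn_lgt0.
- by apply/andP; split; nra.
- by apply/andP; split; nra.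
Qed.

(* Fejer-type kernel: were the target never approached, the average over one
   period of the product of the (2 + 2 cos)^p would be exponentially smaller
   than its maximum, while its constant Fourier coefficient is only
   polynomially smaller and all its other coefficients contribute nonnegative
   terms. *)
Lemma kronecker (R : realType) (n : nat) (e : R) : 0 < e ->
  exists N : nat, forall (v : 'I_n -> int) (y : 'I_n -> R),
  (forall m, (forall i, (`|m i| <= N)%N) -> dot m v = 0 ->
     \sum_i (m i)%:~R * y i \is a Num.int) ->
  exists t : R, forall i, dist_int (t * (v i)%:~R - y i) < e.
Proof.
wlog e2 : e / (e <= 1 / 2)%R => [wl e0|e0].
  have [N hN] : exists N : nat, forall (v : 'I_n -> int) (y : 'I_n -> R),
      (forall m, (forall i, (`|m i| <= N)%N) -> dot m v = 0 ->
        \sum_i (m i)%:~R * y i \is a Num.int) ->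
      exists t : R, forall i, dist_int (t * (v i)%:~R - y i) < Num.min e (1 / 2).
    by apply: wl; rewrite ?ge_min ?lexx ?orbT // lt_min e0; lra.
  exists N => v y /hN[t ht]; exists t => i.
  by apply: lt_le_trans (ht i) _; rewrite ge_min lexx.
(* A coordinate at distance at least [e] from its target contributes a factor [2 + 2 cos] of at most
   [4 q]; any other contributes at most 4. *)
pose c := cos (pi *+ 2 * e); pose q := (1 + c) / 2.
have c1 : c < 1.
  rewrite -(@cos0 R) ltr_cos ?in_itv /=; have p0 := @pi_gt0 R.
  - by rewrite mulr_gt0 // pmulrn_lgt0.
  - by apply/andP; split; nra.
  - by apply/andP; split; nra.
have cN1 : -1 <= c := cos_geN1 _.
have [p hp] := @poly_mul_exprn_lt1 R n q ltac:(rewrite /q; lra).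
(* The frequencies have coefficients at most [p], so the exponent itself bounds the relations. It
   depends on [n] and [e] only; just the number [L] of sample points depends on [v]. *)
exists p => v y hy; apply: contrapT => hno.
pose L := (\sum_i p * `|v i|).+1%N.
have hL m : (forall i, (`|m i| <= p)%N) -> (`|dot m v| < L)%N.
  move=> hm; rewrite ltnS.
  apply: (@leq_trans (\sum_i `|(m i * v i)%R|)%N).
    rewrite /dot; elim/big_ind2: _ => // a b a' b' h h'; lia.
  by apply: leq_sum => i _; rewrite abszM leq_mul2r hm orbT.
have := fejer_average hL hy.
apply/negP; rewrite -ltNge.
have -> : L%:R * 4 ^+ (p * n) / (p.+1 ^ n)%:R =
    \sum_(j < L) (4 ^+ (p * n) / (p.+1 ^ n)%:R : R).
  by rewrite sumr_const card_ord -mulrA mulr_natl.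
apply: ltr_sum => [|j _]; first by apply/hasP; exists ord0; rewrite ?mem_index_enum.
have [i hi] : exists i, e <= dist_int (j%:R * (v i)%:~R / L%:R - y i).
  apply: contrapT => hj; apply: hno; exists (j%:R / L%:R) => i.
  rewrite ltNge; apply/negP => h; apply: hj; exists i.
  by rewrite mulrAC.
apply: le_lt_trans (_ : 4 ^+ (p * n) * q ^+ p < _); last first.
  rewrite ltr_pM2l ?exprn_gt0 // -[ltRHS]mul1r ltr_pdivlMr ?ltr0n ?expn_gt0 //.
  by rewrite mulrC hp.
have cos_bound (k : 'I_n) : 0 <= 2 + 2 * cos (pi *+ 2 * (j%:R * (v k)%:~R / L%:R - y k)) <= 4.
  move: (pi *+ 2 * _) => z; have := cos_geN1 z; have := cos_le1 z; lra.
rewrite (bigD1 i) //=.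
have -> : 4 ^+ (p * n) * q ^+ p = (4 * q) ^+ p * \prod_(k < n | k != i) 4 ^+ p.
  rewrite [(4 * q) ^+ p]exprMn mulrAC; congr (_ * _).
  rewrite prodr_const -!exprM -exprD; congr (_ ^+ _).
  rewrite -mulnS; congr (_ * _)%N.
  have -> : #|(fun k => k != i)| = #|predC1 i| by exact: eq_card.
  by rewrite cardC1 card_ord prednK // (leq_ltn_trans _ (ltn_ord i)).
apply: ler_pM.
- by rewrite exprn_ge0 //; case/andP: (cos_bound i).
- by apply: prodr_ge0 => k _; rewrite exprn_ge0 //; case/andP: (cos_bound k).
- apply: lerXn2r; rewrite ?nnegrE; first by case/andP: (cos_bound i).
    by rewrite /q; lra.
  have := @cos_2pi_le R e _ _ hi; rewrite e0 e2 => /(_ isT); rewrite -/c /q.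
  by move=> ?; lra.
- apply: ler_prod => k _; have /andP[k0 k4] := cos_bound k.
  by rewrite exprn_ge0 //= lerXn2r // nnegrE.
Qed.

(** * Duality *)

(** The function is at least [|l| (A - c) - B], which exceeds its value [B] at 0 outside
    [[- K, K]]. *)
Lemma sum_norm_affine_min (R : realType) (n : nat) (a b : 'I_n -> R) (c : R) :
  0 <= c < \sum_i `|a i| ->
  exists l0, forall l, \sum_i `|b i - l0 * a i| + c * l0 <=
                       \sum_i `|b i - l * a i| + c * l.
Proof.
set A := \sum_i `|a i| => /andP[c0 cA].
pose g l := \sum_i `|b i - l * a i| + c * l.
pose B := \sum_i `|b i|; pose K := 2 * B / (A - c).
have B0 : 0 <= B by apply: sumr_ge0.
have K0 : 0 <= K by rewrite /K divr_ge0 //; lra.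
have g_cont : {within `[- K, K], continuous g}.
  apply: continuous_subspaceT => l; apply: cvgD; last first.
    by apply: cvgM; [exact: cvg_cst|exact: cvg_id].
  apply: cvg_big => [|i _]; first exact: add_continuous.
  apply: cvg_norm.
  apply: cvgB; first exact: cvg_cst.
  by apply: cvgM; [exact: cvg_id|exact: cvg_cst].
have [l0 _ hl0] := EVT_min (ge0_cp K0).2 g_cont.
exists l0 => l; rewrite -/(g l0) -/(g l).
have [lK|lK] := boolP (l \in `[- K, K]); first exact: hl0.
have : g l0 <= g 0 by apply: hl0; rewrite in_itv /= oppr_le0 K0.
have g0 : g 0 = B.
  by rewrite /g mulr0 addr0; apply: eq_bigr => i _; rewrite mul0r subr0.
have : `|l| * A - B <= \sum_i `|b i - l * a i|.
  rewrite /A /B mulr_sumr -sumrB; apply: ler_sum => i _.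
  by rewrite -normrM distrC lerB_dist.
have lK' : K < `|l| by move: lK; rewrite in_itv /= -ler_norml -ltNge.
have : 2 * B < `|l| * (A - c) by rewrite -ltr_pdivrMr // subr_gt0.
have : - `|l| * c <= c * l by rewrite mulrC ler_wpM2l // lerNl -normrN ler_norm.
rewrite g0 /g; lra.
Qed.

(** Strong duality for maximising [x.b] over the part [x.a = c] of the cube. The one-sided
    derivatives at a minimum [l0] of the dual function yield a primal optimum: the sign of the
    residual [r i] where it is nonzero, and a common multiple [s] of the sign of [a i] where it
    vanishes. *)
Lemma weighted_sum_duality (R : realType) (n : nat) (a b : 'I_n -> R) (c c' : R) :
  0 <= c < \sum_i `|a i| ->
  (forall x : 'I_n -> R, (forall i, `|x i| <= 1) ->
     \sum_i x i * a i = c -> \sum_i x i * b i <= c') ->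
  exists l, \sum_i `|b i - l * a i| <= c' - c * l.
Proof.
move=> ca hx; have [l0 hl0] := sum_norm_affine_min b ca; exists l0.
pose r i := b i - l0 * a i.
(* Within distance [h] of [l0] no nonzero residual changes sign, so the dual function is linear on
   either side. The default 1 serves when all residuals vanish. *)
pose h := \big[Num.min/1]_(i | r i != 0) (`|r i| / (1 + `|a i|)).
have h0 : 0 < h.
  apply/bigmin_gtP; split=> // i ri.
  by rewrite divr_gt0 ?normr_gt0 // ltr_pwDl.
have hr i : r i != 0 -> `|h * a i| <= `|r i|.
  move=> ri; have : h <= `|r i| / (1 + `|a i|) by exact: bigmin_le_cond.
  rewrite ler_pdivlMr ?ltr_pwDl // normrM (gtr0_norm h0); lra.
pose S := \sum_i Num.sg (r i) * a i.
pose A := \sum_(i | r i == 0) `|a i|.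
have step (s : R) : `|s| = h ->
    \sum_i `|b i - (l0 + s) * a i| = \sum_i `|r i| - s * S + h * A.
  move=> sh; rewrite /A [X in _ + _ * X]big_mkcond /S !mulr_sumr -sumrB -big_split /=.
  apply: eq_bigr => i _; have -> : b i - (l0 + s) * a i = r i - s * a i.
    by rewrite /r; ring.
  case: ifPn => [/eqP ->|ri].
    by rewrite sgr0 normr0 sub0r normrN normrM sh; ring.
  have := hr _ ri; rewrite normrM (gtr0_norm h0) -sh -normrM.
  rewrite ler_norml mulr0 addr0 => /andP[].
  have [r0|r0|r0] := ltrgt0P (r i); last by rewrite r0 eqxx in ri.
    by rewrite gtr0_sg // => ? ?; rewrite ger0_norm; lra.
  by rewrite ltr0_sg // => ? ?; rewrite ler0_norm; lra.
have SA : `|c - S| <= A.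
  have nh : `|- h| = h by rewrite normrN gtr0_norm.
  have := hl0 (l0 + h); rewrite (step h (gtr0_norm h0)) -/(r _).
  have := hl0 (l0 - h); rewrite (step (- h) nh) -/(r _).
  rewrite (_ : \sum_i `|b i - l0 * a i| = \sum_i `|r i|) //.
  clear -h0; move: S A (\sum_i _) => S A T h1 h2.
  by rewrite ler_norml; apply/andP; split; rewrite -(ler_pM2l h0); lra.
(* For [A = 0] this is 0 by the convention on division, which agrees with [c = S]. *)
pose s := (c - S) / A.
have sA : s * A = c - S.
  rewrite /s; have [A0|A0] := eqVneq A 0; last by rewrite divfK.
  by move: SA; rewrite A0 normr_le0 mulr0 => /eqP.
have A_ge0 : 0 <= A by apply: sumr_ge0.
have s1 : `|s| <= 1.
  have [A0|A0] := eqVneq A 0; first by rewrite /s A0 invr0 mulr0 normr0.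
  by rewrite normrM normfV (ger0_norm A_ge0) ler_pdivrMr ?mul1r // lt_def A0.
pose x i := if r i == 0 then s * Num.sg (a i) else Num.sg (r i).
have x1 i : `|x i| <= 1.
  have sg1 (z : R) : `|Num.sg z| <= 1.
    by rewrite normr_sg; case: (z != 0); rewrite ?lexx ?ler01.
  by rewrite /x; case: ifP => _ //; rewrite (normrM s) mulr_ile1.
have xa : \sum_i x i * a i = c.
  have -> : c = S + s * A by rewrite sA; ring.
  rewrite /S /A [X in _ + _ * X]big_mkcond mulr_sumr -big_split; apply: eq_bigr => i _ /=.
  rewrite /x; case: ifP => [/eqP ->|]; last by rewrite mulr0 addr0.
  by rewrite sgr0 normrEsg; ring.
have := hx _ x1 xa.
have -> : \sum_i x i * b i = \sum_i `|r i| + l0 * c.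
  rewrite -xa mulr_sumr -big_split; apply: eq_bigr => i _ /=.
  have -> : `|r i| = x i * r i; last by rewrite /r; ring.
  by rewrite /x; case: ifP => [/eqP ->|_]; rewrite ?normr0 ?mulr0 // normrEsg.
by rewrite -/r -/(\sum_i `|r i|); rewrite /r; lra.
Qed.

(** * Relations of a vector of small loneliness *)

Definition nrm (n : nat) (m : 'I_n -> int) : nat := \sum_i `|m i|.

Lemma nrmE (R : realType) (n : nat) (m : 'I_n -> int) :
  (nrm m)%:R = \sum_i `|(m i)%:~R| :> R.
Proof. by rewrite /nrm natr_sum; apply: eq_bigr => i _; rewrite natr_absz intr_norm. Qed.

(** The norm has the parity of the coefficient sum, so [odd (nrm m)] can stand for an odd
    coefficient sum. *)
Lemma sum_nrm (n : nat) (m : 'I_n -> int) :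
  exists k : int, \sum_i m i = (nrm m)%:Z + 2 * k.
Proof.
rewrite /nrm; elim/big_ind2: _ => [|a b c d [k ->] [l ->]|i _].
- by exists 0.
- by exists (k + l); rewrite PoszD; ring.
- by case: (m i) => p; [exists 0|exists (- p.+1%:Z)]; lia.
Qed.

Lemma nrm_sub_mul_odd (n : nat) (f g : 'I_n -> int) (k : int) :
  odd (nrm (fun i => f i - 2 * k * g i)) = odd (nrm f).
Proof.
have [a ha] := sum_nrm (fun i => f i - 2 * k * g i); have [b hb] := sum_nrm f.
have : \sum_i (f i - 2 * k * g i) = \sum_i f i - 2 * (k * \sum_i g i).
  by rewrite sumrB mulrA mulr_sumr.
rewrite ha hb; lia.
Qed.

Lemma nrm_add_odd (n : nat) (f g : 'I_n -> int) :
  odd (nrm (fun i => f i + g i)) = odd (nrm f) (+) odd (nrm g).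
Proof.
have [a ha] := sum_nrm (fun i => f i + g i).
have [b hb] := sum_nrm f; have [c hc] := sum_nrm g.
have : \sum_i (f i + g i) = \sum_i f i + \sum_i g i by rewrite big_split.
rewrite ha hb hc; lia.
Qed.

Lemma nrm_coord (n : nat) (m : 'I_n -> int) i : (`|m i| <= nrm m)%N.
Proof. by rewrite /nrm (bigD1 i) //= leq_addr. Qed.

Lemma dist_int_half_add (R : realType) (z c : R) :
  `|z| <= 1 / 2 - c -> c <= dist_int (1 / 2 + z).
Proof.
move=> hz; apply: (@le_dist_int_between _ 0); move: hz; rewrite ler_norml; lra.
Qed.

(** A time at which [t v] is within [e] of [y] would keep all coordinates at least 1/4 away from the
    integers. So the approximation fails, and some bounded relation of [v] is not satisfied by [y]
    modulo 1. *)
Lemma relation_of_target (R : realType) (n : nat) (e : R) : 0 < e ->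
  exists N : nat, forall (v : 'I_n -> int) (y : 'I_n -> R),
  ~ lonely v (1 / 4 : R) -> (forall i, 1 / 4 + e <= dist_int (y i)) ->
  exists m, [/\ forall i, (`|m i| <= N)%N, dot m v = 0 &
    ~ \sum_i (m i)%:~R * y i \is a Num.int].
Proof.
move=> e0; have [N hN] := @kronecker R n _ e0; exists N => v y nl hy.
apply: contrapT => hno; apply: nl.
have [m hm mv|t ht] := hN v y.
  by apply: contrapT => h; apply: hno; exists m.
exists t => i; have := hy i; have := ht i.
have [k [_ ->]] := dist_intP (t * (v i)%:~R - y i).
rewrite distrC => h1; rewrite -(dist_intD_int _ k) => h2.
have := dist_int_lip (y i + k%:~R) (t * (v i)%:~R).
have -> : y i + k%:~R - t * (v i)%:~R = k%:~R - (t * (v i)%:~R - y i) by ring.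
lra.
Qed.

Lemma half_sum_odd (R : realType) (n : nat) (m : 'I_n -> int) :
  odd (nrm m) -> exists k : int, \sum_i (m i)%:~R * (1 / 2) = k%:~R + 1 / 2 :> R.
Proof.
move=> om; have [k hk] := sum_nrm m.
exists ((nrm m)./2%:Z + k); rewrite -mulr_suml -rmorph_sum /= hk.
have -> : (nrm m)%:Z + 2 * k = 2 * ((nrm m)./2%:Z + k) + 1 by lia.
  by rewrite !intrD intrM !intrD; lra.
Qed.

Lemma half_sum_even (R : realType) (n : nat) (m : 'I_n -> int) :
  ~~ odd (nrm m) -> \sum_i (m i)%:~R * (1 / 2) \is a @Num.int R.
Proof.
move=> om; have [k hk] := sum_nrm m.
rewrite -mulr_suml -rmorph_sum /= hk.
have -> : (nrm m)%:Z + 2 * k = 2 * ((nrm m)./2%:Z + k) by lia.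
by rewrite intrM mulrAC mul1r divff ?mul1r ?intr_int // lt0r_neq0.
Qed.

Lemma odd_relation (R : realType) (n : nat) :
  exists N : nat, forall v : 'I_n -> int, ~ lonely v (1 / 4 : R) ->
  exists m, [/\ forall i, (`|m i| <= N)%N, dot m v = 0 & odd (nrm m)].
Proof.
have [|N hN] := @relation_of_target R n (1 / 4) _; first lra.
exists N => v nl; have [|m [mN mv hm]] := hN v (fun=> 1 / 2) nl.
  move=> _; rewrite -[1 / 2]addr0; apply: dist_int_half_add; rewrite normr0; lra.
exists m; split=> //; apply: contrapT => /negP om; apply: hm.
exact: half_sum_even.
Qed.

Lemma min_nat_exists (T : Type) (P : T -> Prop) (f : T -> nat) :
  (exists x, P x) -> exists2 x, P x & forall y, P y -> (f x <= f y)%N.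
Proof.
move=> [x0 Px0]; apply: contrapT => hno.
suff : forall k x, P x -> (k <= f x)%N by move=> /(_ (f x0).+1 x0 Px0); rewrite ltnn.
elim=> // k IH x Px; have := IH x Px; rewrite leq_eqVlt => /orP[/eqP kx|//].
by case: hno; exists x => // y Py; rewrite -kx; exact: IH.
Qed.

Definition shortest_odd (n : nat) (P : ('I_n -> int) -> Prop)
    (m : 'I_n -> int) : Prop :=
  [/\ P m, odd (nrm m) & forall f, P f -> odd (nrm f) -> (nrm m <= nrm f)%N].

Lemma shortest_odd_exists (n : nat) (P : ('I_n -> int) -> Prop) m0 :
  P m0 -> odd (nrm m0) -> exists2 m, shortest_odd P m & (nrm m <= nrm m0)%N.
Proof.
move=> P0 o0.
have [|m [Pm om] hm] := @min_nat_exists _ (fun m => P m /\ odd (nrm m)) (@nrm n).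
  by exists m0.
by exists m; [split=> // f Pf fo; exact: hm|exact: hm].
Qed.

(** Division of [a] by [c] replaces [f] by [h = (r / c) m] with [0 <= r < c]. If [r] is not 0, both
    [h] and [m - h] are shorter than [m], and their norms add up to the odd norm of [m]; one of them
    is odd, against minimality. *)
Lemma shortest_odd_generates (n : nat) (P : ('I_n -> int) -> Prop)
    (m f : 'I_n -> int) (c a : int) :
  (forall f g k, P f -> P g -> P (fun i => f i - k * g i)) ->
  shortest_odd P m -> P f -> c != 0 -> (forall i, c * f i = a * m i) ->
  exists q, forall i, f i = q * m i.
Proof.
move=> Psub [Pm om hm] Pf; wlog c0 : c a / 0 < c => [wl|_ hfm].
  rewrite neq_lt => /orP[cn|cp]; last by apply: wl => //; lia.
  move=> h; apply: (wl (- c) (- a)); rewrite ?oppr_eq0; try lia.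
  by move=> i; rewrite !mulNr h.
pose q := (a %/ c)%Z; pose r := (a %% c)%Z.
have aE : a = q * c + r by exact: divz_eq.
have r0 : 0 <= r by apply: modz_ge0; lia.
have rc : r < c by exact: ltz_pmod.
pose h i := f i - q * m i.
have Ph : P h by exact: Psub.
have hE i : c * h i = r * m i by rewrite /h mulrBr hfm aE; ring.
have nrm_scale (g : 'I_n -> int) (s : int) : 0 <= s ->
    (forall i, c * g i = s * m i) -> (`|c| * nrm g = `|s| * nrm m)%N.
  move=> s0 hg; rewrite /nrm !big_distrr /=; apply: eq_bigr => i _.
  by rewrite -!abszM hg.
have [r00|rn0] := eqVneq r 0.
  exists q => i; apply/eqP; rewrite -subr_eq0 -/(h i).
  by have := hE i; rewrite r00 mul0r => /eqP; rewrite mulf_eq0 (gt_eqF c0).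
have m0 : (0 < nrm m)%N by case: (nrm m) om.
have hl := nrm_scale h r r0 hE.
pose h' i := m i - 1 * h i.
have hl' : (`|c| * nrm h' = `|c - r| * nrm m)%N.
  by apply: nrm_scale => [|i]; [lia|rewrite /h' mul1r mulrBr hE; ring].
have smaller (g : 'I_n -> int) (s : nat) :
    (s < `|c|)%N -> (`|c| * nrm g = s * nrm m)%N -> (nrm g < nrm m)%N.
  move=> sc e; rewrite -(@ltn_pmul2l `|c|) ?e ?ltn_pmul2r //.
  by apply: leq_ltn_trans sc.
have [oh|eh] := boolP (odd (nrm h)).
  have := hm _ Ph oh; rewrite leqNgt => /negP; case.
  by apply: smaller hl; lia.
have sumh : (nrm h + nrm h' = nrm m)%N.
  have : (`|c| * (nrm h + nrm h') = `|c| * nrm m)%N by rewrite mulnDr hl hl' -mulnDl; congr (_ * _)%N; lia.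
  by move/eqP; rewrite eqn_pmul2l; [move/eqP|lia].
have oh' : odd (nrm h') by move: om; rewrite -sumh oddD (negbTE eh).
have := hm _ (Psub _ _ 1 Pm Ph) oh'; rewrite leqNgt => /negP; case.
by apply: smaller hl'; lia.
Qed.

Lemma dot_sub (n : nat) (f g v : 'I_n -> int) (k : int) :
  dot (fun i => f i - k * g i) v = dot f v - k * dot g v.
Proof.
by rewrite /dot mulr_sumr -sumrB; apply: eq_bigr => i _; ring.
Qed.

Lemma nrm1_dot (n : nat) (f v : 'I_n -> int) :
  nrm f = 1%N -> dot f v = 0 -> exists i, v i = 0.
Proof.
move=> f1 fv; have [i fi] : exists i, f i != 0.
  apply: contrapT => h; have : nrm f = 0%N; last by rewrite f1.
  rewrite /nrm big1 // => i _; apply/eqP; rewrite absz_eq0.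
  by apply: contrapT => /negP fi; apply: h; exists i.
exists i; move: f1; rewrite /nrm (bigD1 i) //= => f1.
have rest j : j != i -> f j = 0.
  move=> ji; move: f1; rewrite (bigD1 j) //=; lia.
move: fv; rewrite /dot (bigD1 i) //= big1 ?addr0 => [|j ji].
  by move/eqP; rewrite mulf_eq0 (negbTE fi) => /eqP.
by rewrite rest // mul0r.
Qed.

Lemma shortest_odd_ge3 (n : nat) (P : ('I_n -> int) -> Prop) m :
  shortest_odd P m -> (forall f, P f -> nrm f != 1%N) -> (3 <= nrm m)%N.
Proof. by move=> [Pm om _] /(_ _ Pm); lia. Qed.

Lemma sgn_dot (R : realType) (n : nat) (m : 'I_n -> int) :
  \sum_i Num.sg ((m i)%:~R) * (m i)%:~R = (nrm m)%:R :> R.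
Proof. by rewrite nrmE; apply: eq_bigr => i _; rewrite -normrEsg. Qed.

Lemma independent_relation (R : realType) (n : nat) :
  exists N : nat, forall v : 'I_n -> int, (forall k, v k != 0) ->
  ~ lonely v (1 / 4 : R) ->
  exists m b, [/\ forall i, (`|m i| <= N)%N, forall i, (`|b i| <= N)%N,
    dot m v = 0, dot b v = 0 &
    odd (nrm m) /\ exists i j, m i * b j != m j * b i].
Proof.
have [N0 hN0] := @odd_relation R n.
(* The target below is within 1/6 of the centre, as the norm of [m] is at least 3, and 1/2 - 1/6 =
   1/4 + 1/12. *)
have e0 : 0 < 1 / 12 :> R by lra.
have [N1 hN1] := @relation_of_target R n _ e0.
exists (maxn (n * N0) N1) => v v0 nl.
have [m0 [m0N m0v om0]] := hN0 v nl.
pose P f := dot f v = 0.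
have [m sm mm0] := @shortest_odd_exists n P m0 m0v om0.
have [Pm om hm] := sm.
have M3 : (3 <= nrm m)%N.
  apply: shortest_odd_ge3 sm _ => f Pf; apply/eqP => f1.
  by have [i vi] := nrm1_dot f1 Pf; have := v0 i; rewrite vi.
have M0 : 0 < (nrm m)%:R :> R by rewrite ltr0n; lia.
(* The shift adds 1/2 to the value of [m], which is a half-integer at the centre. So [m] and its
   integer multiples take integer values at [y], and the relation that fails there is not parallel
   to [m]. *)
pose y i : R := 1 / 2 + Num.sg (m i)%:~R / (2 * (nrm m)%:R).
have hy i : 1 / 4 + 1 / 12 <= dist_int (y i).
  apply: dist_int_half_add; rewrite normrM normr_sg normfV ger0_norm; last lra.
  have M3R : 3 <= (nrm m)%:R :> R by rewrite ler_nat.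
  rewrite ler_pdivrMr; last lra.
  by case: (_ != 0) => /=; lra.
have [b [bN bv hb]] := hN1 v y nl hy.
exists m, b; split=> //.
- move=> i; apply: leq_trans (leq_maxl _ _); apply: leq_trans (nrm_coord _ _) _.
  apply: leq_trans mm0 _; rewrite /nrm.
  apply: leq_trans (_ : \sum_(i < n) N0 <= _)%N; first by apply: leq_sum => j _.
  by rewrite sum_nat_const card_ord.
- by move=> i; apply: leq_trans (bN i) (leq_maxr _ _).
- split=> //; apply: contrapT => hpar; apply: hb.
  have [i mi] : exists i, m i != 0.
    apply: contrapT => h; have : nrm m = 0%N; last by lia.
    rewrite /nrm big1 // => i _; apply/eqP; rewrite absz_eq0.
    by apply: contrapT => /negP fi; apply: h; exists i.
  have [f g k Pf Pg|j|q hq] := @shortest_odd_generates n P m b (m i) (b i) _ sm bv mi.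
  - rewrite /P dot_sub Pf Pg; ring.
  - rewrite [RHS]mulrC; apply/eqP; apply: contrapT => /negP h; apply: hpar.
    by exists i, j.
  have -> : \sum_i (b i)%:~R * y i =
      q%:~R * (\sum_i (m i)%:~R * (1 / 2) +
        (\sum_i Num.sg ((m i)%:~R) * (m i)%:~R) / (2 * (nrm m)%:R)).
    rewrite mulr_suml -big_split mulr_sumr; apply: eq_bigr => k _ /=.
    by rewrite hq intrM /y; ring.
  have [k ->] := @half_sum_odd R n m om.
  rewrite sgn_dot; have -> : (nrm m)%:R / (2 * (nrm m)%:R) = 1 / 2 :> R.
    by field; rewrite gt_eqF.
  have -> : k%:~R + 1 / 2 + 1 / 2 = (k + 1)%:~R :> R by rewrite intrD; lra.
  by rewrite -intrM intr_int.
Qed.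

(** * The lattice of two relations and the slice of the cube *)

(** The factor [c] makes this the saturated lattice, all integer points of the rational plane, so
    that a relation outside it is linearly independent of [m0] and [b0]. *)
Definition span2 (n : nat) (m0 b0 f : 'I_n -> int) : Prop :=
  exists c i j : int, c != 0 /\ forall k, c * f k = i * m0 k + j * b0 k.

Lemma span2_sub (n : nat) (m0 b0 f g : 'I_n -> int) (k : int) :
  span2 m0 b0 f -> span2 m0 b0 g -> span2 m0 b0 (fun i => f i - k * g i).
Proof.
move=> [c [i [j [c0 hf]]]] [d [p [q [d0 hg]]]].
exists (c * d), (d * i - k * c * p), (d * j - k * c * q); split.
  by rewrite mulf_neq0.
move=> l.
have -> : c * d * (f l - k * g l) = d * (c * f l) - k * c * (d * g l) by ring.
by rewrite hf hg; ring.
Qed.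

Lemma span2_dot (n : nat) (m0 b0 f v : 'I_n -> int) :
  dot m0 v = 0 -> dot b0 v = 0 -> span2 m0 b0 f -> dot f v = 0.
Proof.
move=> m0v b0v [c [i [j [c0 h]]]]; apply: (mulfI c0).
have -> : c * dot f v = i * dot m0 v + j * dot b0 v.
  rewrite /dot !mulr_sumr -big_split; apply: eq_bigr => k _ /=.
  by rewrite mulrA h; ring.
by rewrite m0v b0v !mulr0.
Qed.

(* The coefficients are read off one 2x2 minor, chosen nonzero of least
   absolute value. *)
Lemma span2_basis (n : nat) (m0 b0 m : 'I_n -> int) :
  shortest_odd (span2 m0 b0) m -> (exists i j, m0 i * b0 j != m0 j * b0 i) ->
  exists b, [/\ span2 m0 b0 b, exists i j, m i * b j != m j * b i &
    forall f, span2 m0 b0 f -> exists q r, forall k, f k = q * m k + r * b k].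
Proof.
move=> sm [i0 [j0 indep]]; have [Pm om hm] := sm.
have [k0 mk0] : exists k, m k != 0.
  apply: contrapT => h; have : nrm m = 0%N; last by move=> e; rewrite e in om.
  rewrite /nrm big1 // => i _; apply/eqP; rewrite absz_eq0.
  by apply: contrapT => /negP fi; apply: h; exists i.
have span_m0 : span2 m0 b0 m0 by exists 1, 1, 0; split=> // k; ring.
have span_b0 : span2 m0 b0 b0 by exists 1, 0, 1; split=> // k; ring.
have [i [j [g0 [Pg0 hg0]]]] : exists i j g,
    span2 m0 b0 g /\ m i * g j - m j * g i != 0.
  apply: contrapT => h.
  have par g : span2 m0 b0 g -> forall i j, m i * g j = m j * g i.
    move=> Pg i j; apply/eqP; rewrite -subr_eq0; apply: contrapT => /negP e.
    by apply: h; exists i, j, g.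
  move/eqP: indep; apply; apply: (mulfI (mulf_neq0 mk0 mk0)).
  have -> : m k0 * m k0 * (m0 i0 * b0 j0) = (m k0 * m0 i0) * (m k0 * b0 j0) by ring.
  rewrite (par _ span_m0 k0 i0) (par _ span_b0 k0 j0).
  have -> : m k0 * m k0 * (m0 j0 * b0 i0) = (m k0 * m0 j0) * (m k0 * b0 i0) by ring.
  by rewrite (par _ span_m0 k0 j0) (par _ span_b0 k0 i0); ring.
pose D g := m i * g j - m j * g i.
have [|b [Pb Db] hb] := @min_nat_exists _
    (fun g => span2 m0 b0 g /\ D g != 0) (fun g => `|D g|%N).
  by exists g0.
exists b; split=> //; first by exists i, j; rewrite -subr_eq0.
move=> f Pf; pose r := (D f %/ D b)%Z; pose h k := f k - r * b k.
have Ph : span2 m0 b0 h by exact: span2_sub.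
have Dh : D h = (D f %% D b)%Z.
  by rewrite /D /h {1}/modz /r /D; ring.
have {}Dh : D h = 0.
  apply/eqP; apply: contrapT => /negP Dh0.
  have := hb h (conj Ph Dh0); rewrite leqNgt => /negP; apply.
  by have := ltz_mod (D f) Db; have := modz_ge0 (D f) Db; rewrite Dh; lia.
suff [c [a [c0 hc]]] : exists c a : int, c != 0 /\ forall k, c * h k = a * m k.
  have [f' g k|q hq] := @shortest_odd_generates n _ m h c a _ sm Ph c0 hc.
    exact: span2_sub.
  by exists q, r => k; rewrite -hq /h subrK.
have [c [i1 [j1 [c0 hc]]]] := Ph; have [d [i2 [j2 [d0 hd]]]] := Pm.
pose A := D m0; pose B := D b0.
have lin (g : 'I_n -> int) c' p q : (forall k, c' * g k = p * m0 k + q * b0 k) ->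
    c' * D g = p * A + q * B.
  move=> hg; have -> : c' * D g = m i * (c' * g j) - m j * (c' * g i) by rewrite /D; ring.
  by rewrite !hg /A /B /D; ring.
have e1 := lin _ _ _ _ hc; have e2 := lin _ _ _ _ hd.
rewrite Dh mulr0 in e1; have Dm : D m = 0 by rewrite /D; ring.
rewrite Dm mulr0 in e2.
have [e [p [q [e0 hq]]]] := Pb; have e3 := lin _ _ _ _ hq.
(* The coefficient pairs of [h] and of [m] are both orthogonal to [(A, B)], which is nonzero because
   [D b] is; so they are proportional. *)
have cross : i1 * j2 = i2 * j1.
  have eb0 : e * D b != 0 by rewrite mulf_neq0.
  have [A0|A0] := eqVneq A 0; last first.
    apply: (mulfI A0); have -> : A * (i1 * j2) = (i1 * A) * j2 by ring.
    have -> : A * (i2 * j1) = (i2 * A) * j1 by ring.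
    have -> : i1 * A = - (j1 * B) by lia.
    have -> : i2 * A = - (j2 * B) by lia.
    ring.
  have B0 : B != 0.
    by apply: contraNneq eb0 => B0; rewrite e3 A0 B0 !mulr0.
  apply: (mulfI B0); have -> : B * (i1 * j2) = i1 * (j2 * B) by ring.
  have -> : B * (i2 * j1) = i2 * (j1 * B) by ring.
  have -> : j1 * B = - (i1 * A) by lia.
  have -> : j2 * B = - (i2 * A) by lia.
  ring.
have [i20|i20] := eqVneq i2 0; last first.
  exists (i2 * c), (i1 * d); split; first by rewrite mulf_neq0.
  move=> k; rewrite -mulrA hc -[RHS]mulrA hd.
  have -> : i2 * (i1 * m0 k + j1 * b0 k) = i1 * i2 * m0 k + i2 * j1 * b0 k by ring.
  by rewrite -cross; ring.
have [j20|j20] := eqVneq j2 0.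
  have := hd k0; rewrite i20 j20 !mul0r => /eqP.
  by rewrite mulf_eq0 (negbTE d0) (negbTE mk0).
exists (j2 * c), (j1 * d); split; first by rewrite mulf_neq0.
move=> k; rewrite -mulrA hc -[RHS]mulrA hd.
have -> : j2 * (i1 * m0 k + j1 * b0 k) = i1 * j2 * m0 k + j1 * j2 * b0 k by ring.
by rewrite cross; ring.
Qed.

(** The slice in the coordinates [x = 4 z]. The bounds -2 and 2 are neighbouring numbers that are 2
    modulo 4, the values at which a target could lie. *)
Definition slice_le2 (R : realType) (n : nat) (m b : 'I_n -> int) : Prop :=
  forall x : 'I_n -> R, (forall i, `|x i| <= 1) ->
    \sum_i x i * (m i)%:~R = 2 -> `|\sum_i x i * (b i)%:~R| <= 2.

(** If [x.b] never is 2 modulo 4 in the open part of the slice, convexity confines it between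
    [4 k - 2] and [4 k + 2] for a single [k]. Since [x.m = 2] there, subtracting [2 k m] from [b]
    centres this interval at 0, and the even factor preserves the parity of [b]. *)
Lemma slice_dichotomy (R : realType) (n : nat) (m b : 'I_n -> int) :
  (3 <= nrm m)%N ->
  (exists (x : 'I_n -> R) (k : int), [/\ forall i, `|x i| < 1,
     \sum_i x i * (m i)%:~R = 2 & \sum_i x i * (b i)%:~R = 2 + 4 * k%:~R]) \/
  exists k : int, slice_le2 R m (fun i => b i - 2 * k * m i).
Proof.
move=> M3; set A := (exists x, _); have [|nA] := pselect A; [by left|right].
have M3R : 3 <= (nrm m)%:R :> R by rewrite ler_nat.
(* A point of the slice inside the open cube, because the norm of [m] exceeds 2. *)
pose x0 i : R := 2 * Num.sg (m i)%:~R / (nrm m)%:R.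
have x01 i : `|x0 i| < 1.
  rewrite normrM normfV normrM normr_sg (ger0_norm (_ : 0 <= 2)); last lra.
  rewrite ger0_norm; last lra.
  by rewrite ltr_pdivrMr; [case: (_ != 0) => /=; lra|lra].
have x0m : \sum_i x0 i * (m i)%:~R = 2.
  have -> : 2 = 2 / (nrm m)%:R * (\sum_i Num.sg (m i)%:~R * (m i)%:~R) :> R.
    by rewrite sgn_dot divfK // lt0r_neq0 //; lra.
  by rewrite mulr_sumr; apply: eq_bigr => i _; rewrite /x0; ring.
pose t0 := \sum_i x0 i * (b i)%:~R.
pose k := Num.floor ((t0 + 2) / 4); exists k.
have k1 : 4 * k%:~R - 2 <= t0 by have := floor_le ((t0 + 2) / 4); rewrite -/k; lra.
have k2 : t0 < 4 * k%:~R + 2.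
  by have := floorD1_gt ((t0 + 2) / 4); rewrite -/k intrD; lra.
have {}k1 : 4 * k%:~R - 2 < t0.
  rewrite lt_neqAle k1 andbT; apply/eqP => e; apply: nA; exists x0, (k - 1).
  by split=> //; rewrite intrB -/t0 -e; lra.
move=> x x1 xm.
have -> : \sum_i x i * (b i - 2 * k * m i)%:~R =
    \sum_i x i * (b i)%:~R - 4 * k%:~R.
  have -> : 4 * k%:~R = 2 * k%:~R * \sum_i x i * (m i)%:~R by rewrite xm; ring.
  rewrite mulr_sumr -sumrB; apply: eq_bigr => i _.
  by rewrite intrB !intrM; ring.
set t := \sum_i _.
(* On the segment from the interior point x0 to x, every value of b strictly
   between t0 and t is attained inside the open cube. *)
have mid (c : R) : 0 <= c < 1 -> t0 + c * (t - t0) = 2 + 4 * k%:~R \/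
    t0 + c * (t - t0) = 2 + 4 * (k - 1)%:~R -> False.
  move=> /andP[c0 c1] hc; apply: nA.
  have hx l : t0 + c * (t - t0) = 2 + 4 * l%:~R -> exists (x : 'I_n -> R) (k : int),
      [/\ forall i, `|x i| < 1, \sum_i x i * (m i)%:~R = 2 &
      \sum_i x i * (b i)%:~R = 2 + 4 * k%:~R].
    have comb (g : 'I_n -> int) : \sum_i (x0 i + c * (x i - x0 i)) * (g i)%:~R =
        \sum_i x0 i * (g i)%:~R + c * (\sum_i x i * (g i)%:~R - \sum_i x0 i * (g i)%:~R).
      rewrite -sumrB mulr_sumr -big_split; apply: eq_bigr => i _ /=; ring.
    move=> hl; exists (fun i => x0 i + c * (x i - x0 i)), l; split.
    - move=> i; have -> : x0 i + c * (x i - x0 i) = (1 - c) * x0 i + c * x i by ring.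
      apply: le_lt_trans (ler_normD _ _) _; rewrite (normrM (1 - c)) (normrM c).
      rewrite (ger0_norm c0) ger0_norm; last lra.
      have : (1 - c) * `|x0 i| < 1 - c by rewrite gtr_pMr // subr_gt0.
      have : c * `|x i| <= c by rewrite ler_piMr.
      lra.
    - by rewrite comb x0m xm subrr mulr0 addr0.
    - by rewrite comb -/t -/t0.
  by case: hc => /hx.
rewrite ler_norml; apply/andP; split; rewrite leNgt; apply/negP => ht.
- apply: (mid ((t0 - (4 * k%:~R - 2)) / (t0 - t))).
    by rewrite divr_ge0 //= ?ltr_pdivrMr; lra.
  right; rewrite -[t - t0]opprB mulrN divfK ?intrB; [lra|apply: lt0r_neq0; lra].
- apply: (mid ((4 * k%:~R + 2 - t0) / (t - t0))).
    by rewrite divr_ge0 //= ?ltr_pdivrMr; lra.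
  left; rewrite divfK; [lra|apply: lt0r_neq0; lra].
Qed.

(** Let [M] and [B] be the norms of [m] and [b]. Duality turns the two bounds on [x.b] into
    multipliers with |b - l m| <= 2 - 2 l and |- b - u m| <= 2 - 2 u in the l^1-norm. Both are
    negative: by [M <= B], a nonnegative one would be 1 and force [b = m] or [b = - m]. Put
    [s = - l - u]. Eliminating [b] gives [s (M - 2) <= 4]; eliminating [m] gives
    [s (B - 2) <= 4 l u <= s^2], so [M - 2 <= s]. Hence [(M - 2)^2 <= 4]. *)
Lemma slice_nrm3 (R : realType) (n : nat) (m b : 'I_n -> int) :
  (3 <= nrm m)%N -> (nrm m <= nrm b)%N -> (exists i, b i != m i) ->
  (exists i, b i != - m i) -> slice_le2 R m b -> (nrm m <= 4)%N.
Proof.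
move=> M3 Mb [i0 bm] [i1 bNm] hs.
have M3R : 3 <= (nrm m)%:R :> R by rewrite ler_nat.
have MbR : (nrm m)%:R <= (nrm b)%:R :> R by rewrite ler_nat.
have key (g : 'I_n -> int) : (nrm g = nrm b) -> (exists i, g i != m i) ->
    (forall x : 'I_n -> R, (forall i, `|x i| <= 1) ->
      \sum_i x i * (m i)%:~R = 2 -> \sum_i x i * (g i)%:~R <= 2) ->
    exists2 l : R, l < 0 & \sum_i `|(g i)%:~R - l * (m i)%:~R| <= 2 - 2 * l.
  move=> gb [i gm] /weighted_sum_duality -/(_ _)[].
    by rewrite -nrmE; lra.
  move=> l hl; exists l => //; rewrite ltNge; apply/negP => l0.
  have l1 : l <= 1.
    have : 0 <= \sum_i `|(g i)%:~R - l * (m i)%:~R| by apply: sumr_ge0.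
    lra.
  have : (nrm g)%:R <= \sum_i `|(g i)%:~R - l * (m i)%:~R| + l * (nrm m)%:R.
    rewrite !nrmE mulr_sumr -big_split; apply: ler_sum => j _ /=.
    have -> : `|(g j)%:~R| = `|((g j)%:~R - l * (m j)%:~R) + l * (m j)%:~R| by rewrite subrK.
    by apply: le_trans (ler_normD _ _) _; rewrite normrM (ger0_norm l0).
  rewrite gb => h; have e1 : l = 1.
    apply/eqP; rewrite eq_le l1 /= leNgt; apply/negP => l1'.
    have : 0 < ((nrm m)%:R - 2) * (1 - l) by rewrite mulr_gt0; lra.
    lra.
  move: hl; rewrite e1 (bigD1 i) //=.
  have : 0 <= \sum_(j | j != i) `|(g j)%:~R - 1 * (m j)%:~R : R| by apply: sumr_ge0.
  have : 0 < `|(g i)%:~R - 1 * (m i)%:~R : R|.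
    by rewrite mul1r -intrB normr_gt0 intr_eq0 subr_eq0.
  lra.
have [|||l l0 hl] := key b; [by []|by exists i0|by move=> x h1 h2; have := hs x h1 h2; rewrite ler_norml => /andP[]|].
have [|||u u0 hu] := key (fun i => - b i).
- by apply: eq_bigr => i _; rewrite abszN.
- by exists i1; rewrite eqr_oppLR.
- move=> x h1 h2; have := hs x h1 h2; rewrite ler_norml => /andP[h _].
  have -> : \sum_i x i * (- b i)%:~R = - \sum_i x i * (b i)%:~R.
    by rewrite -sumrN; apply: eq_bigr => i _; rewrite intrN mulrN.
  lra.
have h1 : (- l - u) * (nrm m)%:R <= 4 - 2 * l - 2 * u.
  apply: le_trans (_ : \sum_i `|(b i)%:~R - l * (m i)%:~R| +
    \sum_i `|(- b i)%:~R - u * (m i)%:~R| <= _); last lra.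
  rewrite nrmE mulr_sumr -big_split; apply: ler_sum => j _ /=.
  rewrite -[X in X * _ <= _]ger0_norm; last lra.
  rewrite -normrM; apply: le_trans (ler_normD _ _); rewrite intrN le_eqVlt.
  by apply/orP; left; apply/eqP; congr `|_|; ring.
have h2 : (- l - u) * (nrm b)%:R <= - u * (2 - 2 * l) - l * (2 - 2 * u).
  apply: le_trans (_ : - u * (\sum_i `|(b i)%:~R - l * (m i)%:~R|) +
    - l * (\sum_i `|(- b i)%:~R - u * (m i)%:~R|) <= _); last first.
    apply: lerD; first by rewrite ler_pM2l //; lra.
    by rewrite -mulNr ler_pM2l //; lra.
  rewrite nrmE !mulr_sumr -big_split; apply: ler_sum => j _ /=.
  rewrite -[X in X * _ <= _]ger0_norm; last lra.
  rewrite -[X in _ <= X * _ + _]ger0_norm; last lra.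
  rewrite -[X in _ <= _ + X * _]ger0_norm; last lra.
  rewrite -!normrM -[X in _ <= _ + X]normrN; apply: le_trans (ler_normD _ _).
  rewrite intrN le_eqVlt; apply/orP; left; apply/eqP; congr `|_|; ring.
suff : (nrm m)%:R <= 4 :> R by rewrite (ler_nat _ _ 4).
clear -l0 u0 h1 h2 M3R MbR.
move: (nrm m)%:R (nrm b)%:R h1 h2 M3R MbR => M B h1 h2 M3 MB.
pose s := - l - u; have s0 : 0 < s by rewrite /s; lra.
have h3 : s * M <= s * B by rewrite ler_pM2l.
have h4 : 4 * (l * u) <= s * s.
  have := sqr_ge0 (l - u); rewrite expr2 /s; lra.
have h5 : s * (M - 2) <= s * s by rewrite /s in h3 h4 *; lra.
have h6 : M - 2 <= s by rewrite -(ler_pM2l s0).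
have h7 : s * (M - 2) <= 4 by rewrite /s; lra.
have h8 : (M - 2) * (M - 2) <= s * (M - 2) by rewrite ler_pM2r //; lra.
nra.
Qed.

Lemma plane_dichotomy (R : realType) (n : nat) (m0 b0 : 'I_n -> int) :
  odd (nrm m0) -> (exists i j, m0 i * b0 j != m0 j * b0 i) ->
  (forall f, span2 m0 b0 f -> nrm f != 1%N) ->
  (exists (y : 'I_n -> R) (e : R), [/\ 0 < e,
     forall i, 1 / 4 + e <= dist_int (y i) &
     forall f, span2 m0 b0 f -> \sum_i (f i)%:~R * y i \is a Num.int]) \/
  (exists m b, [/\ span2 m0 b0 m, span2 m0 b0 b, nrm m = 3%N, odd (nrm b) &
     (exists i j, m i * b j != m j * b i) /\ slice_le2 R m b]).
Proof.
move=> om0 indep no1.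
have span_m0 : span2 m0 b0 m0 by exists 1, 1, 0; split=> // k; ring.
have [m sm _] := shortest_odd_exists span_m0 om0.
have [Pm om hm] := sm; have M3 := shortest_odd_ge3 sm no1.
have [b [Pb ob indep' gen]] : exists b, [/\ span2 m0 b0 b, odd (nrm b),
    exists i j, m i * b j != m j * b i &
    forall f, span2 m0 b0 f -> exists q r, forall k, f k = q * m k + r * b k].
  have [b [Pb [i [j hij]] gen]] := span2_basis sm indep.
  have [ob|eb] := boolP (odd (nrm b)); first by exists b; split=> //; exists i, j.
  (* Adding the odd [m] makes an even [b] odd and keeps a basis; both generators then ask for a
     value that is 2 modulo 4. *)
  exists (fun i => b i + m i); split.
  - have := span2_sub (-1) Pb Pm; congr span2; apply/funext => k; ring.
  - by rewrite nrm_add_odd om (negbTE eb).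
  - exists i, j; rewrite -subr_eq0; move: hij; rewrite -subr_eq0.
    by congr (_ != _); ring.
  - move=> f /gen[q [r h]]; exists (q - r), r => k; rewrite h; ring.
have [[x [k [x1 xm xb]]]|[k hk]] := slice_dichotomy R b M3.
  left; pose y i := 1 / 2 + x i / 4.
  pose e := \big[Num.min/1]_i ((1 - `|x i|) / 4).
  have e0 : 0 < e.
    by apply/bigmin_gtP; split=> // i _; rewrite divr_gt0 // subr_gt0.
  exists y, e; split=> // [i|f Pf].
    apply: dist_int_half_add; rewrite normrM normfV (ger0_norm (_ : 0 <= 4)); last lra.
    have : e <= (1 - `|x i|) / 4 by exact: bigmin_le.
    lra.
  have [q [r hf]] := gen f Pf.
  have sumE (g : 'I_n -> int) : \sum_i (g i)%:~R * y i =
      \sum_i (g i)%:~R * (1 / 2) + (\sum_i x i * (g i)%:~R) / 4.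
    by rewrite mulr_suml -big_split; apply: eq_bigr => i _ /=; rewrite /y; ring.
  have -> : \sum_i (f i)%:~R * y i = q%:~R * (\sum_i (m i)%:~R * y i)
      + r%:~R * (\sum_i (b i)%:~R * y i).
    rewrite !mulr_sumr -big_split; apply: eq_bigr => i _ /=.
    by rewrite hf intrD !intrM; ring.
  rewrite !sumE xm xb; have [p ->] := half_sum_odd R om.
  have [p' ->] := half_sum_odd R ob.
  have -> : q%:~R * (p%:~R + 1 / 2 + 2 / 4)
      + r%:~R * (p'%:~R + 1 / 2 + (2 + 4 * k%:~R) / 4) =
      (q * (p + 1) + r * (p' + 1 + k))%:~R :> R.
    by rewrite !(intrD, intrM); field.
  exact: intr_int.
right; exists m, (fun i => b i - 2 * k * m i).
have Pb' : span2 m0 b0 (fun i => b i - 2 * k * m i) by exact: span2_sub.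
have ob' : odd (nrm (fun i => b i - 2 * k * m i)) by rewrite nrm_sub_mul_odd.
have [i [j hij]] := indep'.
have hij' : m i * (b j - 2 * k * m j) != m j * (b i - 2 * k * m i).
  by move: hij; rewrite -subr_eq0 -[in X in _ -> X]subr_eq0; congr (_ != _); ring.
have npar (s : int) : exists l, b l - 2 * k * m l != s * m l.
  apply: contrapT => h; move/eqP: hij'; apply.
  have e l : b l - 2 * k * m l = s * m l.
    by apply/eqP; apply: contrapT => /negP hl; apply: h; exists l.
  by rewrite !e; ring.
split=> //; last by split=> //; exists i, j.
(* The norm is odd and at least 3, so the bound 4 leaves only 3. *)
have M4 : (nrm m <= 4)%N.
  apply: (slice_nrm3 M3 _ _ _ hk); first exact: hm.
  - by have [l] := npar 1; rewrite mul1r; exists l.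
  - by have [l] := npar (-1); rewrite mulN1r; exists l.
lia.
Qed.

(** * The exceptional planes in dimension four *)

Definition lonely4 (R : realType) (a b c d : int) (x : R) : Prop :=
  exists t : R, [/\ x <= dist_int (t * a%:~R), x <= dist_int (t * b%:~R),
                    x <= dist_int (t * c%:~R) & x <= dist_int (t * d%:~R)].

Definition pm4 (a b c d w : int) : Prop :=
  (w = a \/ w = - a) \/ (w = b \/ w = - b) \/
  (w = c \/ w = - c) \/ (w = d \/ w = - d).

Lemma lonely4_mono (R : realType) (a b c d a' b' c' d' : int) (x : R) :
  pm4 a b c d a' /\ pm4 a b c d b' /\ pm4 a b c d c' /\ pm4 a b c d d' ->
  lonely4 a b c d x -> lonely4 a' b' c' d' x.
Proof.
move=> [ha [hb [hc hd]]] [t [ta tb tc td]]; exists t.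
have h w : pm4 a b c d w -> x <= dist_int (t * w%:~R).
  by case=> [|[|[|]]] [] ->; rewrite ?intrN ?mulrN ?dist_intN.
by split; apply: h.
Qed.

Definition ord4 (k : nat) (hk : (k < 4)%N) : 'I_4 := Ordinal hk.

Lemma sum4 (V : nmodType) (F : 'I_4 -> V) :
  \sum_i F i = F (@ord4 0 isT) + F (@ord4 1 isT) + F (@ord4 2 isT) + F (@ord4 3 isT).
Proof.
rewrite 4!big_ord_recr big_ord0 /= add0r.
by congr (F _ + F _ + F _ + F _); apply: val_inj.
Qed.

Lemma lonely4P (R : realType) (v : 'I_4 -> int) (x : R) :
  lonely v x <-> lonely4 (v (@ord4 0 isT)) (v (@ord4 1 isT)) (v (@ord4 2 isT)) (v (@ord4 3 isT)) x.
Proof.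
split=> -[t]; first by move=> h; exists t; split.
move=> [h0 h1 h2 h3]; exists t => -[[|[|[|[|//]]]] hk].
- by congr (_ <= dist_int (t * (v _)%:~R)): h0; apply: val_inj.
- by congr (_ <= dist_int (t * (v _)%:~R)): h1; apply: val_inj.
- by congr (_ <= dist_int (t * (v _)%:~R)): h2; apply: val_inj.
- by congr (_ <= dist_int (t * (v _)%:~R)): h3; apply: val_inj.
Qed.

(* Up to order and signs, which loneliness does not see, (a, b, c, d) lies in one
   of the planes {(p, 2p, 3p, q)} and {(p, u, u - p, u + p)}. *)
Definition special4 (R : realType) (a b c d : int) : Prop :=
  (exists p q : int, [/\ p != 0, q != 0 &
     forall x : R, lonely4 a b c d x <-> lonely4 p (2 * p) (3 * p) q x]) \/
  (exists p u : int, [/\ p != 0, u != 0, u - p != 0, u + p != 0 &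
     forall x : R, lonely4 a b c d x <-> lonely4 p u (u - p) (u + p) x]).

Lemma special4_mono (R : realType) (a b c d a' b' c' d' : int) :
  pm4 a b c d a' /\ pm4 a b c d b' /\ pm4 a b c d c' /\ pm4 a b c d d' ->
  pm4 a' b' c' d' a /\ pm4 a' b' c' d' b /\ pm4 a' b' c' d' c /\ pm4 a' b' c' d' d ->
  special4 R a' b' c' d' -> special4 R a b c d.
Proof.
move=> h1 h2; have e (x : R) : lonely4 a b c d x <-> lonely4 a' b' c' d' x.
  by split; apply: lonely4_mono.
case=> [[p [q [p0 q0 h]]]|[p [u [p0 u0 d0 s0 h]]]]; [left|right].
  by exists p, q; split=> // x; rewrite e.
by exists p, u; split=> // x; rewrite e.
Qed.

(** One coordinate of [m], [b] and [v] together: a permutation or a sign change of coordinates has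
    to act on all three at once. *)
Record column := Column { cm : int; cb : int; cv : int }.

Definition column_neg (s : column) := Column (- cm s) (- cb s) (- cv s).

(* The slice condition with x_i = e_i / 2. *)
Definition tight4 (s1 s2 s3 s4 : column) : Prop :=
  [/\ `|cm s1| + `|cm s2| + `|cm s3| + `|cm s4| = 3,
      exists k, cb s1 + cb s2 + cb s3 + cb s4 = 2 * k + 1,
      ((cm s1 * cb s2 != cm s2 * cb s1) || (cm s1 * cb s3 != cm s3 * cb s1) ||
       (cm s1 * cb s4 != cm s4 * cb s1) || (cm s2 * cb s3 != cm s3 * cb s2) ||
       (cm s2 * cb s4 != cm s4 * cb s2) || (cm s3 * cb s4 != cm s4 * cb s3)),
      (forall e1 e2 e3 e4 : int, `|e1| <= 2 -> `|e2| <= 2 -> `|e3| <= 2 -> `|e4| <= 2 ->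
        e1 * cm s1 + e2 * cm s2 + e3 * cm s3 + e4 * cm s4 = 4 ->
        `|e1 * cb s1 + e2 * cb s2 + e3 * cb s3 + e4 * cb s4| <= 4) &
      [/\ cm s1 * cv s1 + cm s2 * cv s2 + cm s3 * cv s3 + cm s4 * cv s4 = 0,
        cb s1 * cv s1 + cb s2 * cv s2 + cb s3 * cv s3 + cb s4 * cv s4 = 0 &
        [/\ cv s1 != 0, cv s2 != 0, cv s3 != 0 & cv s4 != 0]]].

Definition tight4_special (R : realType) (s1 s2 s3 s4 : column) : Prop :=
  tight4 s1 s2 s3 s4 -> special4 R (cv s1) (cv s2) (cv s3) (cv s4).

(** The adjacent transpositions and the sign change [tight4_neg1] generate all signed permutations
    of the coordinates. They reduce the classification to a sorted nonnegative [m]. *)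
Lemma tight4_swap12 (R : realType) s1 s2 s3 s4 :
  tight4_special R s2 s1 s3 s4 -> tight4_special R s1 s2 s3 s4.
Proof.
move=> h [h1 [k hk] h3 h4 [h5 h6 [v1 v2 v3 v4]]].
apply: special4_mono (h _); [by rewrite /pm4; intuition|by rewrite /pm4; intuition|].
split; [lia|exists k; lia|lia| |split=> //; lia].
move=> e1 e2 e3 e4 a1 a2 a3 a4 a5.
have := h4 e2 e1 e3 e4 a2 a1 a3 a4.
rewrite [e2 * _ + e1 * _]addrC => /(_ a5).
by rewrite [e2 * _ + e1 * _]addrC.
Qed.

Lemma tight4_swap23 (R : realType) s1 s2 s3 s4 :
  tight4_special R s1 s3 s2 s4 -> tight4_special R s1 s2 s3 s4.
Proof.
move=> h [h1 [k hk] h3 h4 [h5 h6 [v1 v2 v3 v4]]].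
apply: special4_mono (h _); [by rewrite /pm4; intuition|by rewrite /pm4; intuition|].
split; [lia|exists k; lia|lia| |split=> //; lia].
move=> e1 e2 e3 e4 a1 a2 a3 a4 a5.
have := h4 e1 e3 e2 e4 a1 a3 a2 a4.
rewrite [e1 * _ + e3 * _ + e2 * _]addrAC => /(_ a5).
by rewrite [e1 * _ + e3 * _ + e2 * _]addrAC.
Qed.

Lemma tight4_swap34 (R : realType) s1 s2 s3 s4 :
  tight4_special R s1 s2 s4 s3 -> tight4_special R s1 s2 s3 s4.
Proof.
move=> h [h1 [k hk] h3 h4 [h5 h6 [v1 v2 v3 v4]]].
apply: special4_mono (h _); [by rewrite /pm4; intuition|by rewrite /pm4; intuition|].
split; [lia|exists k; lia|lia| |split=> //; lia].
move=> e1 e2 e3 e4 a1 a2 a3 a4 a5.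
have := h4 e1 e2 e4 e3 a1 a2 a4 a3.
rewrite [_ + e4 * _ + e3 * _]addrAC => /(_ a5).
by rewrite [_ + e4 * _ + e3 * _]addrAC.
Qed.

Lemma tight4_neg1 (R : realType) s1 s2 s3 s4 :
  tight4_special R (column_neg s1) s2 s3 s4 -> tight4_special R s1 s2 s3 s4.
Proof.
move=> h [h1 [k hk] h3 h4 [h5 h6 [v1 v2 v3 v4]]].
apply: special4_mono (h _); rewrite /column_neg /=.
- by rewrite /pm4 ?opprK; intuition.
- by rewrite /pm4 ?opprK; intuition.
split=> /=; [by rewrite normrN|exists (k - cb s1); lia| |
  |by rewrite !mulrNN oppr_eq0; split].
  by rewrite !mulNr !mulrN !eqr_opp.
move=> e1 e2 e3 e4 a1 a2 a3 a4.
by rewrite !mulrN -!mulNr; apply: h4; rewrite // normrN.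
Qed.

Lemma sort4 (T : Type) (key : T -> int) (P : T -> T -> T -> T -> Prop) :
  (forall a b c d, P b a c d -> P a b c d) ->
  (forall a b c d, P a c b d -> P a b c d) ->
  (forall a b c d, P a b d c -> P a b c d) ->
  (forall a b c d, key d <= key c <= key b -> key b <= key a -> P a b c d) ->
  forall a b c d, P a b c d.
Proof.
move=> s12 s23 s34 hs.
have ins1 a b c d : key d <= key c <= key b -> P a b c d.
  move=> /andP[dc cb]; have [ba|ab] := lerP (key b) (key a).
    by apply: hs => //; rewrite dc.
  apply: s12; have [ca|ac] := lerP (key c) (key a).
    by apply: hs; [rewrite dc ca|exact: ltW].
  apply: s23; have [da|ad] := lerP (key d) (key a).
    by apply: hs; [rewrite da ltW|].
  by apply: s34; apply: hs; [rewrite ltW|].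
have ins2 a b c d : key d <= key c -> P a b c d.
  move=> dc; have [cb|bc] := lerP (key c) (key b).
    by apply: ins1; rewrite dc.
  apply: s23; have [db|bd] := lerP (key d) (key b).
    by apply: ins1; rewrite db ltW.
  by apply: s34; apply: ins1; rewrite ltW.
move=> a b c d; have [dc|cd] := lerP (key d) (key c); first exact: ins2.
by apply: s34; apply: ins2; exact: ltW.
Qed.

Ltac solve_pm4 :=
  first [ by left; left; lia | by left; right; lia
        | by right; left; left; lia | by right; left; right; lia
        | by right; right; left; left; lia | by right; right; left; right; lia
        | by right; right; right; left; lia | by right; right; right; right; lia ].

Ltac solve_special := first [ lia | by repeat split; solve_pm4 ].

Lemma special4_A (R : realType) (a b c d p q : int) :
  p != 0 -> q != 0 ->
  pm4 a b c d p /\ pm4 a b c d (2 * p) /\ pm4 a b c d (3 * p) /\ pm4 a b c d q ->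
  pm4 p (2 * p) (3 * p) q a /\ pm4 p (2 * p) (3 * p) q b /\
    pm4 p (2 * p) (3 * p) q c /\ pm4 p (2 * p) (3 * p) q d ->
  special4 R a b c d.
Proof.
by move=> p0 q0 h1 h2; left; exists p, q; split=> // x; split; apply: lonely4_mono.
Qed.

Lemma special4_B (R : realType) (a b c d p u : int) :
  p != 0 -> u != 0 -> u - p != 0 -> u + p != 0 ->
  pm4 a b c d p /\ pm4 a b c d u /\ pm4 a b c d (u - p) /\ pm4 a b c d (u + p) ->
  pm4 p u (u - p) (u + p) a /\ pm4 p u (u - p) (u + p) b /\
    pm4 p u (u - p) (u + p) c /\ pm4 p u (u - p) (u + p) d ->
  special4 R a b c d.
Proof.
by move=> p0 u0 h3 h4 h1 h2; right; exists p, u; split=> // x; split; apply: lonely4_mono.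
Qed.

(* The slice condition bounds the pairwise sums of b1, b2, b3 by 2 - |b4|,
   which leaves only the two exceptional planes. *)
Lemma tight4_111 (R : realType) (b1 b2 b3 b4 v1 v2 v3 v4 : int) :
  tight4_special R (Column 1 b1 v1) (Column 1 b2 v2) (Column 1 b3 v3) (Column 0 b4 v4).
Proof.
move=> [_ [k hk] /= ind hs [r1 r2 [n1 n2 n3 n4]]]; rewrite /= in hk r1 r2 n1 n2 n3 n4 *.
have c1 := hs 0 2 2 2 isT isT isT isT erefl; have c2 := hs 0 2 2 (-2) isT isT isT isT erefl.
have c3 := hs 2 0 2 2 isT isT isT isT erefl; have c4 := hs 2 0 2 (-2) isT isT isT isT erefl.
have c5 := hs 2 2 0 2 isT isT isT isT erefl; have c6 := hs 2 2 0 (-2) isT isT isT isT erefl.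
clear hs; rewrite /= in c1 c2 c3 c4 c5 c6.
have h12 : `|b1 + b2| + `|b4| <= 2 by clear -c5 c6; lia.
have h13 : `|b1 + b3| + `|b4| <= 2 by clear -c3 c4; lia.
have h23 : `|b2 + b3| + `|b4| <= 2 by clear -c1 c2; lia.
clear c1 c2 c3 c4 c5 c6.
have b12 : -2 <= b1 + b2 <= 2 by clear -h12; lia.
have b13 : -2 <= b1 + b3 <= 2 by clear -h13; lia.
have b23 : -2 <= b2 + b3 <= 2 by clear -h23; lia.
have : b4 = 0 \/ b4 = 1 \/ b4 = -1.
  (* If [|b4| = 2], the pairwise sums of the other entries vanish, so these entries are 0 and the
     coefficient sum is even, against [hk]. *)
  have [|h] : `|b4| <= 1 \/ `|b4| = 2 by clear -h12; lia.
    by clear; lia.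
  by clear -h h12 h13 h23 hk; lia.
case=> [e4|]; last first.
  move=> e4.
  have [[e1 [e2 e3]]|[[e1 [e2 e3]]|[e1 [e2 e3]]]] :
      b3 = 0 /\ b2 = - b1 /\ (b1 = 1 \/ b1 = -1) \/
      b2 = 0 /\ b3 = - b1 /\ (b1 = 1 \/ b1 = -1) \/
      b1 = 0 /\ b2 = - b3 /\ (b3 = 1 \/ b3 = -1).
    have a12 : -1 <= b1 + b2 <= 1 by clear -h12 e4; lia.
    have a13 : -1 <= b1 + b3 <= 1 by clear -h13 e4; lia.
    have a23 : -1 <= b2 + b3 <= 1 by clear -h23 e4; lia.
    have : ~ (b1 = 0 /\ b2 = 0 /\ b3 = 0).
      by move=> [z1 [z2 z3]]; clear -z1 z2 z3 e4 r2 n4; subst; case: e4 => ?; subst; lia.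
    by clear -a12 a13 a23 hk e4; lia.
  - apply: (@special4_B _ _ _ _ _ v2 v1); clear -e1 e2 e3 e4 r1 r2 n1 n2 n3 n4;
      case: e3 => e3; case: e4 => e4; subst; solve_special.
  - apply: (@special4_B _ _ _ _ _ v3 v1); clear -e1 e2 e3 e4 r1 r2 n1 n2 n3 n4;
      case: e3 => e3; case: e4 => e4; subst; solve_special.
  - apply: (@special4_B _ _ _ _ _ v2 v3); clear -e1 e2 e3 e4 r1 r2 n1 n2 n3 n4;
      case: e3 => e3; case: e4 => e4; subst; solve_special.
subst b4; clear h12 h13 h23.
(* With [b4 = 0] the other three entries are not all equal, by independence from [m]; two equal ones
   would make an entry of [v] vanish. *)
have ne : b1 != b2 \/ b1 != b3 by clear -ind; lia.
have d12 : b1 != b2.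
  apply/eqP => e; have : (b3 - b1) * v3 = 0.
    have -> : v3 = - v1 - v2 by clear -r1; lia.
    have := r2; have -> : v3 = - v1 - v2 by clear -r1; lia.
    by rewrite -e => <-; ring.
  by move/eqP; rewrite mulf_eq0 (negbTE n3) orbF subr_eq0; clear -e ne; lia.
have d13 : b1 != b3.
  apply/eqP => e; have : (b2 - b1) * v2 = 0.
    have -> : v2 = - v1 - v3 by clear -r1; lia.
    have := r2; have -> : v2 = - v1 - v3 by clear -r1; lia.
    by rewrite -e => <-; ring.
  by move/eqP; rewrite mulf_eq0 (negbTE n2) orbF subr_eq0; clear -e ne; lia.
have d23 : b2 != b3.
  apply/eqP => e; have : (b1 - b2) * v1 = 0.
    have -> : v1 = - v2 - v3 by clear -r1; lia.
    have := r2; have -> : v1 = - v2 - v3 by clear -r1; lia.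
    by rewrite -e => <-; ring.
  by move/eqP; rewrite mulf_eq0 (negbTE n1) orbF subr_eq0; clear -e ne; lia.
(* Distinct entries with odd sum and pairwise sums at most 2 in absolute value: up to order and a
   global sign, only (0, 2, -1). *)
have : [\/ [/\ b1 = 0, b2 = 2 & b3 = -1], [/\ b1 = 0, b2 = -2 & b3 = 1],
           [/\ b1 = 0, b2 = 1 & b3 = -2] | [/\ b1 = 0, b2 = -1 & b3 = 2]] \/
       [\/ [/\ b1 = 2, b2 = 0 & b3 = -1], [/\ b1 = -2, b2 = 0 & b3 = 1],
           [/\ b1 = 1, b2 = 0 & b3 = -2] | [/\ b1 = -1, b2 = 0 & b3 = 2]] \/
       [\/ [/\ b1 = 2, b2 = -1 & b3 = 0], [/\ b1 = -2, b2 = 1 & b3 = 0],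
           [/\ b1 = 1, b2 = -2 & b3 = 0] | [/\ b1 = -1, b2 = 2 & b3 = 0]].
  clear r1 r2 ind n1 n2 n3 n4.
  have [e|[e|e]] : b1 = 0 \/ b2 = 0 \/ b3 = 0 by lia.
  - have : b2 = 2 \/ b2 = -2 \/ b2 = 1 \/ b2 = -1 by lia.
    by case=> [f|[f|[f|f]]]; left;
      [apply: Or41|apply: Or42|apply: Or43|apply: Or44]; split; lia.
  - have : b1 = 2 \/ b1 = -2 \/ b1 = 1 \/ b1 = -1 by lia.
    by case=> [f|[f|[f|f]]]; right; left;
      [apply: Or41|apply: Or42|apply: Or43|apply: Or44]; split; lia.
  - have : b1 = 2 \/ b1 = -2 \/ b1 = 1 \/ b1 = -1 by lia.
    by case=> [f|[f|[f|f]]]; right; right;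
      [apply: Or41|apply: Or42|apply: Or43|apply: Or44]; split; lia.
clear hk b12 b13 b23 ind ne d12 d13 d23.
case=> [[]|[[]|[]]] [? ? ?]; subst;
  first [ by apply: (@special4_A _ _ _ _ _ v1 v4); solve_special
        | by apply: (@special4_A _ _ _ _ _ v2 v4); solve_special
        | by apply: (@special4_A _ _ _ _ _ v3 v4); solve_special ].
Qed.

(** The slice points with first coordinates (2, 0) and (1, 2) bound |b1| + |b3| + |b4| by 2 and |b1
    + 2 b2| + 2 |b3| + 2 |b4| by 4. Parity and independence leave, up to sign, (1, -1) on the first
    two coordinates and a single entry 1 or -1 on the last two. As [v2 = - 2 v1], the corresponding
    entry of [v] is 3 v1 up to sign, and the remaining one is free. *)
Lemma tight4_210 (R : realType) (b1 b2 b3 b4 v1 v2 v3 v4 : int) :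
  tight4_special R (Column 2 b1 v1) (Column 1 b2 v2) (Column 0 b3 v3) (Column 0 b4 v4).
Proof.
move=> [_ [k hk] /= ind hs [r1 r2 [n1 n2 n3 n4]]]; rewrite /= in hk r1 r2 n1 n2 n3 n4 *.
have c1 := hs 2 0 2 2 isT isT isT isT erefl; have c2 := hs 2 0 2 (-2) isT isT isT isT erefl.
have c3 := hs 2 0 (-2) 2 isT isT isT isT erefl.
have c4 := hs 2 0 (-2) (-2) isT isT isT isT erefl.
have c5 := hs 1 2 2 2 isT isT isT isT erefl; have c6 := hs 1 2 2 (-2) isT isT isT isT erefl.
have c7 := hs 1 2 (-2) 2 isT isT isT isT erefl.
have c8 := hs 1 2 (-2) (-2) isT isT isT isT erefl.
clear hs; rewrite /= in c1 c2 c3 c4 c5 c6 c7 c8.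
have h1 : `|b1| + `|b3| + `|b4| <= 2 by clear -c1 c2 c3 c4; lia.
have h2 : `|b1 + 2 * b2| + 2 * `|b3| + 2 * `|b4| <= 4 by clear -c5 c6 c7 c8; lia.
clear c1 c2 c3 c4 c5 c6 c7 c8.
have [[e3 e4]|[[e3 e4]|[[e3 e4]|h]]] : (b3 = 0 /\ b4 = 0) \/
    (b3 = 0 /\ (b4 = 1 \/ b4 = -1)) \/ (b4 = 0 /\ (b3 = 1 \/ b3 = -1)) \/
    `|b3| + `|b4| = 2 by clear -h1; lia.
- have e2 : v2 = - 2 * v1 by clear -r1; lia.
  subst; have : (b1 - 2 * b2) * v1 = 0 by rewrite -r2; ring.
  by move/eqP; rewrite mulf_eq0 (negbTE n1) orbF; clear -ind; lia.
- have [[? ?]|[[? ?]|[? ?]]] : (b1 = 0 /\ b2 = 0) \/ (b1 = 1 /\ b2 = -1) \/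
      (b1 = -1 /\ b2 = 1) by clear -h1 h2 hk e3 e4; lia.
  + by clear ind; case: e4 => ?; subst; lia.
  + by apply: (@special4_A _ _ _ _ _ v1 v3); case: e4 => ?; subst; clear -r1 r2 n1 n2 n3 n4; solve_special.
  + by apply: (@special4_A _ _ _ _ _ v1 v3); case: e4 => ?; subst; clear -r1 r2 n1 n2 n3 n4; solve_special.
- have [[? ?]|[[? ?]|[? ?]]] : (b1 = 0 /\ b2 = 0) \/ (b1 = 1 /\ b2 = -1) \/
      (b1 = -1 /\ b2 = 1) by clear -h1 h2 hk e3 e4; lia.
  + by clear ind; case: e4 => ?; subst; lia.
  + by apply: (@special4_A _ _ _ _ _ v1 v4); case: e4 => ?; subst; clear -r1 r2 n1 n2 n3 n4; solve_special.
  + by apply: (@special4_A _ _ _ _ _ v1 v4); case: e4 => ?; subst; clear -r1 r2 n1 n2 n3 n4; solve_special.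
- by clear -h h1 h2 hk; lia.
Qed.

(** A sorted nonnegative [m] of norm 3 is (1, 1, 1, 0), (2, 1, 0, 0) or (3, 0, 0, 0), and the last
    would make an entry of [v] vanish. *)
Lemma tight4_classification (R : realType) (s1 s2 s3 s4 : column) :
  tight4_special R s1 s2 s3 s4.
Proof.
have s12 := @tight4_swap12 R; have s23 := @tight4_swap23 R.
have s34 := @tight4_swap34 R; have neg1 := @tight4_neg1 R.
have neg2 t1 t2 t3 t4 : tight4_special R t1 (column_neg t2) t3 t4 ->
    tight4_special R t1 t2 t3 t4 by move=> h; apply/s12/neg1/s12.
have neg3 t1 t2 t3 t4 : tight4_special R t1 t2 (column_neg t3) t4 ->
    tight4_special R t1 t2 t3 t4 by move=> h; apply/s23/neg2/s23.
have neg4 t1 t2 t3 t4 : tight4_special R t1 t2 t3 (column_neg t4) ->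
    tight4_special R t1 t2 t3 t4 by move=> h; apply/s34/neg3/s34.
move: s1 s2 s3 s4; apply: (@sort4 _ (fun s => `|cm s|)) => // s1 s2 s3 s4.
wlog p1 : s1 / 0 <= cm s1.
  have [p1|p1] := lerP 0 (cm s1); first exact.
  by move=> wl h1 h2; apply: neg1; apply: wl; rewrite /= ?normrN //; lia.
wlog p2 : s2 / 0 <= cm s2.
  have [p2|p2] := lerP 0 (cm s2); first exact.
  by move=> wl h1 h2; apply: neg2; apply: wl; rewrite /= ?normrN //; lia.
wlog p3 : s3 / 0 <= cm s3.
  have [p3|p3] := lerP 0 (cm s3); first exact.
  by move=> wl h1 h2; apply: neg3; apply: wl; rewrite /= ?normrN //; lia.
wlog p4 : s4 / 0 <= cm s4.
  have [p4|p4] := lerP 0 (cm s4); first exact.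
  by move=> wl h1 h2; apply: neg4; apply: wl; rewrite /= ?normrN //; lia.
case: s1 s2 s3 s4 p1 p2 p3 p4 => [m1 b1 v1] [m2 b2 v2] [m3 b3 v3] [m4 b4 v4] /=.
move=> p1 p2 p3 p4 h1 h2 ht; have [h _ _ _ [h' _ [n1 _ _ _]]] := ht.
rewrite /= in h h' n1.
have [[? [? [? ?]]]|[[? [? [? ?]]]|[? [? [? ?]]]]] :
    (m1 = 1 /\ m2 = 1 /\ m3 = 1 /\ m4 = 0) \/ (m1 = 2 /\ m2 = 1 /\ m3 = 0 /\ m4 = 0) \/
    (m1 = 3 /\ m2 = 0 /\ m3 = 0 /\ m4 = 0) by clear ht h'; lia.
- by subst; exact: (@tight4_111 R _ _ _ _ _ _ _ _ ht).
- by subst; exact: (@tight4_210 R _ _ _ _ _ _ _ _ ht).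
- by subst; lia.
Qed.

Lemma slice_le2_special (R : realType) (m b v : 'I_4 -> int) :
  nrm m = 3%N -> odd (nrm b) -> (exists i j, m i * b j != m j * b i) ->
  slice_le2 R m b -> dot m v = 0 -> dot b v = 0 -> (forall k, v k != 0) ->
  special4 R (v (@ord4 0 isT)) (v (@ord4 1 isT)) (v (@ord4 2 isT)) (v (@ord4 3 isT)).
Proof.
move=> m3 ob [i [j hij]] hs mv bv v0.
pose s k := Column (m k) (b k) (v k).
apply: (@tight4_classification R (s (@ord4 0 isT)) (s (@ord4 1 isT))
          (s (@ord4 2 isT)) (s (@ord4 3 isT))).
rewrite /s; split => /=.
- by move: m3; rewrite /nrm sum4; lia.
- have [k] := sum_nrm b; rewrite sum4 => ->.
  by exists ((nrm b)./2%:Z + k); lia.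
- apply: contraT; rewrite !negb_or !negbK => /andP[/andP[/andP[/andP[/andP[]]]]].
  have eqo k (h h' : (k < 4)%N) : Ordinal h = ord4 h' by exact: val_inj.
  move=> /eqP e1 /eqP e2 /eqP e3 /eqP e4 /eqP e5 /eqP e6.
  move/eqP: hij; case; case: i => [[|[|[|[|//]]]] hi]; case: j => [[|[|[|[|//]]]] hj];
  rewrite !(eqo _ hi isT) !(eqo _ hj isT); clear -e1 e2 e3 e4 e5 e6; lia.
- move=> e1 e2 e3 e4 h1 h2 h3 h4 he.
  pose e (k : 'I_4) : int := nth 0 [:: e1; e2; e3; e4] k.
  have hsum (f : 'I_4 -> int) : \sum_k (e k)%:~R / 2 * (f k)%:~R =
      (e1 * f (@ord4 0 isT) + e2 * f (@ord4 1 isT) + e3 * f (@ord4 2 isT)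
       + e4 * f (@ord4 3 isT))%:~R / 2 :> R.
    by rewrite sum4 /e /= !intrD !intrM; field.
  have := hs (fun k => (e k)%:~R / 2); rewrite !hsum he => h.
  have : `|(e1 * b (@ord4 0 isT) + e2 * b (@ord4 1 isT) + e3 * b (@ord4 2 isT)
       + e4 * b (@ord4 3 isT))%:~R / 2 : R| <= 2.
    apply: h; last by lra.
    move=> k; rewrite normrM normfV (ger0_norm (_ : 0 <= 2)); last lra.
    rewrite ler_pdivrMr; last lra.
    rewrite mul1r -intr_norm -[2]/(2%:~R) ler_int.
    by case: k => [[|[|[|[|//]]]] hk].
  rewrite normrM normfV (ger0_norm (_ : 0 <= 2)); last lra.
  rewrite ler_pdivrMr; last lra.
  have -> : 2 * 2 = 4%:~R :> R by lra.
  by rewrite -intr_norm ler_int.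
- split; last by split; exact: v0.
  + by rewrite -mv /dot sum4.
  + by rewrite -bv /dot sum4.
Qed.

(** * Finiteness of the values off the exceptional planes *)

Lemma row_pair_free (F : fieldType) (n : nat) (u w : 'rV[F]_n) :
  (exists i j, u ord0 i * w ord0 j != u ord0 j * w ord0 i) ->
  \rank (col_mx u w) = 2.
Proof.
move=> [i [j hij]]; apply/eqP; rewrite -[_ == 2]/(row_free (col_mx u w)).
rewrite -kermx_eq0; apply/rowV0P => x /sub_kermxP.
rewrite -[x]hsubmxK mul_row_col [lsubmx x]mx11_scalar [rsubmx x]mx11_scalar.
rewrite !mul_scalar_mx; set a := lsubmx x 0 0; set b := rsubmx x 0 0 => /rowP h.
have hi := h i; have hj := h j; rewrite !mxE in hi hj.
have d0 : u ord0 i * w ord0 j - u ord0 j * w ord0 i != 0 by rewrite subr_eq0.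
have a0 : a = 0.
  apply: (mulIf d0); rewrite mul0r.
  have -> : a * (u ord0 i * w ord0 j - u ord0 j * w ord0 i) =
    w ord0 j * (a * u ord0 i + b * w ord0 i) - w ord0 i * (a * u ord0 j + b * w ord0 j) by ring.
  by rewrite hi hj !mulr0 subrr.
have b0 : b = 0.
  apply: (mulIf d0); rewrite mul0r.
  have -> : b * (u ord0 i * w ord0 j - u ord0 j * w ord0 i) =
    u ord0 i * (a * u ord0 j + b * w ord0 j) - u ord0 j * (a * u ord0 i + b * w ord0 i) by ring.
  by rewrite hi hj !mulr0 subrr.
by rewrite a0 b0 !raddf0 row_mx0.
Qed.

(** If [v] and [w] were not parallel, their orthogonal complement in Q^4 would have dimension 2,
    hence be spanned by [m0] and [b0], and it contains [g]. Clearing the denominators of the two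
    coefficients would put [g] into [span2]. *)
Lemma orthogonal_pair_parallel (m0 b0 g v w : 'I_4 -> int) :
  (exists i j, m0 i * b0 j != m0 j * b0 i) -> ~ span2 m0 b0 g ->
  dot m0 v = 0 -> dot b0 v = 0 -> dot g v = 0 ->
  dot m0 w = 0 -> dot b0 w = 0 -> dot g w = 0 ->
  forall i j, v i * w j = v j * w i.
Proof.
move=> [i0 [j0 h0]] ng m0v b0v gv m0w b0w gw i j.
apply/eqP; apply: contrapT => /negP hij; apply: ng.
pose row (f : 'I_4 -> int) : 'rV[rat]_4 := \row_k (f k)%:~R.
pose B := (col_mx (row v) (row w))^T.
have rank_pair (f h : 'I_4 -> int) p q : f p * h q != f q * h p ->
    \rank (col_mx (row f) (row h)) = 2.
  by move=> fh; apply: row_pair_free; exists p, q; rewrite !mxE -!intrM eqr_int.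
have rB : \rank B = 2 by rewrite mxrank_tr (rank_pair _ _ i j).
have ker f : dot f v = 0 -> dot f w = 0 -> (row f <= kermx B)%MS.
  move=> fv fw; apply/sub_kermxP; rewrite /B tr_col_mx mul_mx_row.
  have e (h : 'I_4 -> int) : dot f h = 0 -> row f *m (row h)^T = 0.
    move=> fh; apply/matrixP => a b; rewrite !mxE -[RHS](_ : (dot f h)%:~R = 0); last by rewrite fh.
    by rewrite /dot rmorph_sum; apply: eq_bigr => k _; rewrite !mxE /= intrM.
  by rewrite !e // row_mx0.
have sub : (col_mx (row m0) (row b0) <= kermx B)%MS by rewrite col_mx_sub !ker.
have eqK : (kermx B <= col_mx (row m0) (row b0))%MS.
  have := mxrank_leqif_sup sub; rewrite (rank_pair _ _ _ _ h0) mxrank_ker rB.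
  by move=> [_ <-].
have : (row g <= row m0 + row b0)%MS.
  by rewrite addsmxE; apply: submx_trans eqK; exact: ker.
move/sub_addsmxP => [[x y] /= gE].
rewrite [x]mx11_scalar [y]mx11_scalar !mul_scalar_mx in gE.
move: (x 0 0) (y 0 0) gE => {x y} x y /rowP gE.
exists (denq x * denq y), (numq x * denq y), (numq y * denq x); split.
  by rewrite mulf_neq0 ?denq_neq0.
move=> k; apply: (@intr_inj rat); have := gE k; rewrite !mxE => e.
by rewrite intrD !intrM e !numqE; ring.
Qed.

Lemma lonely_parallel (R : realType) (n : nat) (v w : 'I_n -> int) (c : R) :
  (forall k, v k != 0) -> (forall k, w k != 0) ->
  (forall i j, v i * w j = v j * w i) -> lonely v c -> lonely w c.
Proof.
case: n v w => [|n] v w v0 w0 vw [t ht]; first by exists 0 => -[].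
exists (t * (v ord0)%:~R / (w ord0)%:~R) => k.
have -> : t * (v ord0)%:~R / (w ord0)%:~R * (w k)%:~R = t * (v k)%:~R; last exact: ht.
have w00 : (w ord0)%:~R != 0 :> R by rewrite intr_eq0.
apply: (mulIf w00); rewrite mulrAC divfK // -!mulrA; congr (t * _).
by rewrite -!intrM vw.
Qed.

Lemma bounded_finite (n N : nat) :
  finite_set [set m : 'I_n -> int | forall i, (`|m i| <= N)%N].
Proof.
pose f (g : {ffun 'I_n -> 'I_(2 * N).+1}) (i : 'I_n) : int := (g i)%:Z - N%:Z.
apply: (@sub_finite_set _ _ (f @` [set: {ffun 'I_n -> 'I_(2 * N).+1}])); last exact/finite_image/finite_finset.
move=> m /= hm.
exists [ffun i => inord `|(m i + N%:Z)%R|%N] => //.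
apply/funext => i; rewrite /f ffunE inordK; have := hm i; lia.
Qed.

(** [ml] stands for maximal loneliness, the number M(v). The exceptional planes, which carry
    infinitely many values, are left out. *)
Definition ml_value (R : realType) (v : 'I_4 -> int) (x : R) : Prop :=
  [/\ forall k, v k != 0, forall c, lonely v c <-> c <= x, x < 1 / 4 &
    ~ special4 R (v (@ord4 0 isT)) (v (@ord4 1 isT)) (v (@ord4 2 isT)) (v (@ord4 3 isT))].

Lemma ml_value_not_lonely (R : realType) (v : 'I_4 -> int) (x : R) :
  ml_value v x -> ~ lonely v (1 / 4 : R).
Proof. by move=> [_ h x4 _] /h; rewrite leNgt x4. Qed.

(** The third target and its margin come from the plane alone, so one bound [N] serves every [v]
    orthogonal to it. Each of the finitely many [g] outside the plane then leaves at most one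
    direction, hence at most one value. *)
Lemma plane_values_finite (R : realType) (m0 b0 : 'I_4 -> int) :
  odd (nrm m0) -> (exists i j, m0 i * b0 j != m0 j * b0 i) ->
  finite_set [set x : R | exists v, [/\ ml_value v x, dot m0 v = 0 & dot b0 v = 0]].
Proof.
move=> om0 indep; have [no1|] := pselect (forall f, span2 m0 b0 f -> nrm f != 1%N);
  last first.
  move=> h; suff -> : [set x : R | exists v, [/\ ml_value v x, dot m0 v = 0 & dot b0 v = 0]] = set0.
    exact: finite_set0.
  rewrite -subset0 => x [v [[v0 _ _ _] m0v b0v]]; apply: h => f Pf.
  apply/eqP => f1; have [i vi] := nrm1_dot f1 (span2_dot m0v b0v Pf).
  by have := v0 i; rewrite vi.
have [[y [e [e0 hy Py]]]|[m [b [Pm Pb m3 ob [indep' hs]]]]] :=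
    plane_dichotomy R om0 indep no1; last first.
  suff -> : [set x : R | exists v, [/\ ml_value v x, dot m0 v = 0 & dot b0 v = 0]] = set0.
    exact: finite_set0.
  rewrite -subset0 => x [v [[v0 _ _ ns] m0v b0v]]; apply: ns.
  apply: (slice_le2_special m3 ob indep' hs) => //.
    exact: span2_dot Pm.
  exact: span2_dot Pb.
have [N hN] := @relation_of_target R 4 e e0.
pose G := [set g : 'I_4 -> int | forall i, (`|g i| <= N)%N] `&` [set g | ~ span2 m0 b0 g].
pose V g := [set x : R | exists v, [/\ ml_value v x, dot m0 v = 0, dot b0 v = 0 & dot g v = 0]].
apply: (@sub_finite_set _ _ (\bigcup_(g in G) V g)).
  move=> x [v [hv m0v b0v]].
  have [g [gN gv hg]] := hN v y (ml_value_not_lonely hv) hy.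
  by exists g; [split=> // Pg; exact/hg/Py|exists v].
apply: bigcup_finite; first exact/finite_setIl/bounded_finite.
move=> g [_ ng]; have [->|/set0P[x Vx]] := eqVneq (V g) set0; first exact: finite_set0.
apply: (sub_finite_set _ (finite_set1 x)) => x' Vx'; apply/esym.
move: Vx Vx' => [v [[v0 hv _ _] m0v b0v gv]] [w [[w0 hw _ _] m0w b0w gw]].
have vw := orthogonal_pair_parallel indep ng m0v b0v gv m0w b0w gw.
have wv := orthogonal_pair_parallel indep ng m0w b0w gw m0v b0v gv.
apply/eqP; rewrite eq_le; apply/andP; split.
  by apply/hw/(lonely_parallel v0 w0 vw)/hv.
by apply/hv/(lonely_parallel w0 v0 wv)/hw.
Qed.

Lemma nonspecial_values_finite (R : realType) :
  finite_set [set x : R | exists v, ml_value v x].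
Proof.
have [N hN] := @independent_relation R 4.
pose box := [set m : 'I_4 -> int | forall i, (`|m i| <= N)%N].
pose I := (box `*` box) `&`
  [set p | odd (nrm p.1) /\ exists i j, p.1 i * p.2 j != p.1 j * p.2 i].
pose V (p : ('I_4 -> int) * ('I_4 -> int)) :=
  [set x : R | exists v, [/\ ml_value v x, dot p.1 v = 0 & dot p.2 v = 0]].
apply: (@sub_finite_set _ _ (\bigcup_(p in I) V p)).
  move=> x [v hv]; have [v0 _ _ _] := hv.
  have [m [b [mN bN mv bv h]]] := hN v v0 (ml_value_not_lonely hv).
  by exists (m, b); [split|exists v].
apply: bigcup_finite.
  by apply/finite_setIl/finite_setX; exact: bounded_finite.
by move=> [m b] [_ [/= om indep]]; exact: plane_values_finite.
Qed.

(** * Exact values on the exceptional planes *)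

Lemma lonely4_le (R : realType) (a b c d : int) (x y : R) :
  x <= y -> lonely4 a b c d y -> lonely4 a b c d x.
Proof. by move=> xy [t [? ? ? ?]]; exists t; split; apply: le_trans xy _. Qed.

Lemma lonely4_scale (R : realType) (g a b c d : int) (x : R) : g != 0 ->
  lonely4 (g * a) (g * b) (g * c) (g * d) x <-> lonely4 a b c d x.
Proof.
move=> g0; have gR : g%:~R != 0 :> R by rewrite intr_eq0.
split=> -[t ht].
  by exists (t * g%:~R); move: ht; rewrite !intrM !mulrA.
by exists (t / g%:~R); rewrite !intrM !mulrA !(divfK gR).
Qed.

(** For coprime [p] and [u] the closed curve [t -> (t p, t u)] fills the whole subgroup [u x = p y]
    modulo 1; a Bezout relation tells by which integers to shift [x] and [y]. *)
Lemma circle_point (R : realType) (p u K : int) (x y : R) :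
  coprimez p u -> p != 0 -> u%:~R * x - p%:~R * y = K%:~R ->
  exists (t : R) (a b : int), t * p%:~R = x - a%:~R /\ t * u%:~R = y - b%:~R.
Proof.
move=> /coprimezP[[s w] /= sw] p0 hK; have pR : p%:~R != 0 :> R by rewrite intr_eq0.
exists ((x - (w * K)%:~R) / p%:~R), (w * K), (- (s * K)); split; first by rewrite divfK.
apply: (mulIf pR); rewrite mulrAC divfK //.
have sw' : s%:~R * p%:~R + w%:~R * u%:~R = 1 :> R by rewrite -!intrM -intrD sw.
rewrite intrN !intrM -hK; apply/eqP; rewrite -subr_eq0.
have -> : (x - w%:~R * (u%:~R * x - p%:~R * y)) * u%:~R -
  (y - - (s%:~R * (u%:~R * x - p%:~R * y))) * p%:~R =
  (u%:~R * x - p%:~R * y) * (1 - (s%:~R * p%:~R + w%:~R * u%:~R)) by ring.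
by rewrite sw' subrr mulr0.
Qed.

Lemma circle_point_lonely (R : realType) (p u K : int) (x y c : R) :
  coprimez p u -> p != 0 -> u%:~R * x - p%:~R * y = K%:~R ->
  c <= dist_int x -> c <= dist_int y -> c <= dist_int (y - x) ->
  c <= dist_int (y + x) -> lonely4 p u (u - p) (u + p) c.
Proof.
move=> pu p0 hK h1 h2 h3 h4.
have [t [a [b [ta tb]]]] := circle_point pu p0 hK.
exists t; rewrite intrB intrD mulrBr mulrDr ta tb; split.
- by rewrite -intrN dist_intD_int.
- by rewrite -intrN dist_intD_int.
- have -> : y - b%:~R - (x - a%:~R) = y - x + (a - b)%:~R by rewrite intrB; ring.
  by rewrite dist_intD_int.
- have -> : y - b%:~R + (x - a%:~R) = y + x + (- a - b)%:~R.
    by rewrite intrB intrN; ring.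
  by rewrite dist_intD_int.
Qed.

(* The point (1/4 - r, 1/2 + 2 r), a vertex of the region around (1/4, 1/2)
   where all four distances are at least 1/4 - r. *)
Lemma lonely4_vertex_low (R : realType) (p u e K : int) :
  coprimez p u -> p != 0 -> 0 < u + 2 * p -> 0 <= e <= u + 2 * p ->
  u - 2 * p - e = 4 * K ->
  lonely4 p u (u - p) (u + p) (1 / 4 - e%:~R / (4 * (u + 2 * p)%:~R) : R).
Proof.
move=> pu p0 W0 /andP[e0 eW] hK; set r := e%:~R / _.
have W0R : 0 < (u + 2 * p)%:~R :> R by rewrite ltr0z.
have rW : 4 * r * (u + 2 * p)%:~R = e%:~R.
  by move: W0R; rewrite /r; move: ((u + 2 * p)%:~R) => W W0R; field; rewrite gt_eqF.
have r0 : 0 <= r by rewrite divr_ge0 ?ler0z //; lra.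
have r4 : r <= 1 / 4.
  rewrite ler_pdivrMr; last lra.
  have : e%:~R <= (u + 2 * p)%:~R :> R by rewrite ler_int.
  lra.
apply: (@circle_point_lonely _ _ _ K (1 / 4 - r) (1 / 2 + 2 * r)) => //.
- have : (u - 2 * p - e)%:~R = (4 * K)%:~R :> R by rewrite hK.
  by move: rW; rewrite !(intrB, intrD, intrM) => rW; lra.
- apply: (@le_dist_int_between _ 0); lra.
- apply: (@le_dist_int_between _ 0); lra.
- apply: (@le_dist_int_between _ 0); lra.
- apply: (@le_dist_int_between _ 0); lra.
Qed.

(** The counterpart at (1/2, 1/4) is the vertex (1/2 - 2 r, 1/4 - r). There [u x - p y] equals
    [(2 u - p) (1/4 - r)], so the curve passes through it when [e = 4 r (2 u - p)] is congruent to
    [2 u - p] modulo 4. *)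
Lemma lonely4_vertex_high (R : realType) (p u e K : int) :
  coprimez p u -> p != 0 -> 0 < 2 * u - p -> 0 <= e <= 2 * u - p ->
  2 * u - p - e = 4 * K ->
  lonely4 p u (u - p) (u + p) (1 / 4 - e%:~R / (4 * (2 * u - p)%:~R) : R).
Proof.
move=> pu p0 W0 /andP[e0 eW] hK; set r := e%:~R / _.
have W0R : 0 < (2 * u - p)%:~R :> R by rewrite ltr0z.
have rW : 4 * r * (2 * u - p)%:~R = e%:~R.
  by move: W0R; rewrite /r; move: ((2 * u - p)%:~R) => W W0R; field; rewrite gt_eqF.
have r0 : 0 <= r by rewrite divr_ge0 ?ler0z //; lra.
have r4 : r <= 1 / 4.
  rewrite ler_pdivrMr; last lra.
  have : e%:~R <= (2 * u - p)%:~R :> R by rewrite ler_int.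
  lra.
apply: (@circle_point_lonely _ _ _ K (1 / 2 - 2 * r) (1 / 4 - r)) => //.
- have : (2 * u - p - e)%:~R = (4 * K)%:~R :> R by rewrite hK.
  by move: rW; rewrite !(intrB, intrD, intrM) => rW; lra.
- apply: (@le_dist_int_between _ 0); lra.
- apply: (@le_dist_int_between _ 0); lra.
- apply: (@le_dist_int_between _ (-1)); rewrite intrN; lra.
- apply: (@le_dist_int_between _ 0); lra.
Qed.

Lemma lonely4_swap (R : realType) (p u : int) (x : R) :
  lonely4 u p (p - u) (p + u) x -> lonely4 p u (u - p) (u + p) x.
Proof.
apply: lonely4_mono; rewrite /pm4.
by split; [|split; [|split]]; lia.
Qed.

(* With X, Y the distances of t p, t u to the integers, a value above
   1/4 - 1/(4 L) forces (X, Y) into a small triangle at (1/4, 1/2) or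
   (1/2, 1/4), on which u X -+ p Y takes no integer value. *)
Lemma lonely4_upper (R : realType) (p u L a1 a2 : int) (x : R) :
  0 < p < u -> 0 < L ->
  0 < a1 < 4 -> (exists K, 2 * p - u - a1 = 4 * K) ->
  0 < a2 < 4 -> (exists K, 2 * u - p - a2 = 4 * K) ->
  u <= L * a1 -> u + 2 * p <= L * (4 - a1) ->
  2 * u - p <= L * a2 -> p + 2 * u <= L * (4 - a2) ->
  lonely4 p u (u - p) (u + p) x -> x <= 1 / 4 - 1 / (4 * L%:~R).
Proof.
move=> /andP[p0 pu] L0 ha1 [K1 hK1] ha2 [K2 hK2] b1 b2 b3 b4 [t [t1 t2 t3 t4]].
rewrite leNgt; apply/negP => hx.
have L0R : 0 < L%:~R :> R by rewrite ltr0z.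
pose r : R := 1 / (4 * L%:~R).
have rL : 4 * (L%:~R * r) = 1 by rewrite /r; field; rewrite gt_eqF.
have L1R : 1 <= L%:~R :> R by rewrite ler1z.
have r0 : 0 < r by rewrite /r divr_gt0 //; lra.
have r4 : r <= 1 / 4 by rewrite /r ler_pdivrMr; lra.
have {}hx : 1 / 4 - r < x by [].
have [k [k2 tk]] := dist_intP (t * p%:~R); have [l [l2 tl]] := dist_intP (t * u%:~R).
rewrite tk in t1; rewrite tl in t2.
have d3 s : x <= `|(t * u%:~R - l%:~R) - (t * p%:~R - k%:~R) - s%:~R|.
  apply: le_trans t3 _; apply: le_trans (dist_int_le _ (l - k + s)) _.
  rewrite le_eqVlt; apply/orP; left; apply/eqP; congr `|_|.
  by rewrite !(intrD, intrB); ring.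
have d4 s : x <= `|(t * u%:~R - l%:~R) + (t * p%:~R - k%:~R) - s%:~R|.
  apply: le_trans t4 _; apply: le_trans (dist_int_le _ (l + k + s)) _.
  rewrite le_eqVlt; apply/orP; left; apply/eqP; congr `|_|.
  by rewrite !(intrD, intrB); ring.
have F : u%:~R * (t * p%:~R - k%:~R) - p%:~R * (t * u%:~R - l%:~R) =
  (p * l - u * k)%:~R by rewrite intrB !intrM; ring.
move: (t * p%:~R - k%:~R) (t * u%:~R - l%:~R) (p * l - u * k) t1 t2 k2 l2 d3 d4 F.
move=> X' Y' j t1 t2 k2 l2 d3 d4 F.
have [X [Y [[X2 Y2] [hX hY hYX hXY] [i hF]]]] : exists X Y : R,
    [/\ X <= 1 / 2 /\ Y <= 1 / 2,
      [/\ x <= X, x <= Y, x <= `|Y - X| & x <= 1 - (X + Y)] &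
      exists i : int, u%:~R * X - p%:~R * Y = i%:~R \/ u%:~R * X + p%:~R * Y = i%:~R].
  exists `|X'|, `|Y'|; have m0 := d3 0; have m1 := d3 1; have m2 := d3 (-1).
  have q0 := d4 0; have q1 := d4 1; have q2 := d4 (-1).
  rewrite ?intrN ?subr0 ?opprK in m0 m1 m2 q0 q1 q2.
  split=> //; first split=> //.
  - move: m0 q0; clear; case: (ger0P X'); case: (ger0P Y') => h h' m q //.
    + by rewrite (_ : - Y' - X' = - (Y' + X')) ?normrN //; ring.
    + by rewrite (_ : Y' - - X' = Y' + X') //; ring.
    + by rewrite (_ : - Y' - - X' = - (Y' - X')) ?normrN //; ring.
  - move: k2 l2 m1 m2 q1 q2; clear; case: (ger0P X'); case: (ger0P Y') => h h' k2 l2 m1 m2 q1 q2.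
    + by move: q1; rewrite ler0_norm; lra.
    + by move: m2; rewrite ger0_norm; lra.
    + by move: m1; rewrite ler0_norm; lra.
    + by move: q2; rewrite ger0_norm; lra.
  - move: F; clear; case: (ger0P X'); case: (ger0P Y') => h h' F.
    + by exists j; left.
    + by exists j; right; rewrite -F; ring.
    + by exists (- j); right; rewrite intrN -F; ring.
    + by exists (- j); left; rewrite intrN -F; ring.
have p0R : 0 < p%:~R :> R by rewrite ltr0z.
have puR : p%:~R < u%:~R :> R by rewrite ltr_int.
have bound (e A B : int) : - (4 * r) * A%:~R < e%:~R -> e%:~R < 4 * r * B%:~R :> R ->
    - A < L * e < B.
  move=> e1 e2; apply/andP; split; rewrite -(ltr_int R) ?intrN intrM.
    have -> : - A%:~R = L%:~R * (- (4 * r) * A%:~R) :> R.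
      by rewrite mulrA mulrN [L%:~R * (4 * r)]mulrCA rL mulN1r.
    by rewrite ltr_pM2l.
  have -> : B%:~R = L%:~R * (4 * r * B%:~R) :> R.
    by rewrite mulrA [L%:~R * (4 * r)]mulrCA rL mul1r.
  by rewrite ltr_pM2l.
(* Being congruent to [a] modulo 4, [e] is at least [a] or at most [a - 4]; the lower bounds on [L]
   exclude both. *)
have gap (e a A B : int) : 0 < a < 4 -> (exists K, e - a = 4 * K) ->
    B <= L * a -> A <= L * (4 - a) -> - A < L * e < B -> False.
  move=> /andP[a0 a4] [K he] hB hA /andP[e1 e2].
  have [ea|ea] : a <= e \/ e <= a - 4 by clear -a0 a4 he; lia.
    have h : L * a <= L * e by rewrite ler_pM2l.
    by move: (lt_le_trans e2 (le_trans hB h)); rewrite ltxx.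
  have h : L * e <= L * (a - 4) by rewrite ler_pM2l.
  have h' : L * (a - 4) <= - A by rewrite -[a - 4]opprB mulrN lerN2.
  by move: (lt_le_trans e1 (le_trans h h')); rewrite ltxx.
have q1 : 0 < 3 / 4 + r - X - Y by clear -hXY hx; lra.
have qX : 0 < X - 1 / 4 + r by clear -hX hx; lra.
have qY : 0 < Y - 1 / 4 + r by clear -hY hx; lra.
have s1 : 0 < u%:~R - p%:~R :> R by rewrite subr_gt0.
have s2 : 0 < u%:~R + p%:~R :> R by rewrite addr_gt0 // (lt_trans p0R).
have u0R : 0 < u%:~R :> R by exact: lt_trans puR.
have [XY|XY] := ltrP X Y.
  move: hYX; rewrite ger0_norm ?subr_ge0 ?(ltW XY) // => hYX.
  have q2 : 0 < Y - X - 1 / 4 + r by clear -hYX hx; lra.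
  have g1 := mulr_gt0 s1 q1; have g2 := mulr_gt0 s2 q2.
  have g3 := mulr_gt0 p0R q1; have g4 := mulr_gt0 s2 qX.
  have g5 := mulr_gt0 s2 q1; have g6 := mulr_gt0 s1 q2.
  have g7 := mulr_gt0 p0R q2.
  case: hF => hF.
    (* This [e] is four times the excess of [u X - p Y] over its value at (1/4, 1/2); on the
       triangle it lies between [- 4 r (u + 2 p)] and [4 r u]. *)
    apply: (@gap (4 * i - u + 2 * p) a1 (u + 2 * p) u) => //.
      by exists (i + K1); clear -hK1; lia.
    by apply: bound; rewrite !(intrD, intrB, intrM) -hF; clear -g1 g2 g3 g4; lra.
  apply: (@gap (4 * i - u - 2 * p) a1 (u + 2 * p) u) => //.
    by exists (i + K1 - p); clear -hK1; lia.
  by apply: bound; rewrite !(intrD, intrB, intrM) -hF; clear -g4 g5 g6 g7; lra.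
move: hYX; rewrite ler0_norm ?subr_le0 // => hYX.
have q2 : 0 < X - Y - 1 / 4 + r by clear -hYX hx; lra.
have g1 := mulr_gt0 u0R q1; have g2 := mulr_gt0 s2 qY.
have g3 := mulr_gt0 u0R q2; have g4 := mulr_gt0 s1 qY.
case: hF => hF.
  apply: (@gap (- 4 * i - p + 2 * u) a2 (p + 2 * u) (2 * u - p)) => //.
    by exists (K2 - i); clear -hK2; lia.
  by apply: bound; rewrite !(intrD, intrB, intrM, intrN) -hF; clear -g1 g2 g3 g4; lra.
apply: (@gap (4 * i - p - 2 * u) a2 (p + 2 * u) (2 * u - p)) => //.
  by exists (i + K2 - u); clear -hK2; lia.
by apply: bound; rewrite !(intrD, intrB, intrM) -hF; clear -g1 g2 g3 g4; lra.
Qed.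

(** [a1] and [a2] are the residues of [2 p - u] and [2 u - p] modulo 4. The inequalities keep the
    curve out of the open triangles with [r = 1 / (4 L)]; an equality among the three alternatives
    makes it pass through a vertex of one of them. *)
Lemma lonely4_exact (R : realType) (p u L a1 a2 : int) (x : R) :
  coprimez p u -> 0 < p < u -> 0 < L ->
  0 < a1 < 4 -> (exists K, 2 * p - u - a1 = 4 * K) ->
  0 < a2 < 4 -> (exists K, 2 * u - p - a2 = 4 * K) ->
  u <= L * a1 -> u + 2 * p <= L * (4 - a1) ->
  2 * u - p <= L * a2 -> p + 2 * u <= L * (4 - a2) ->
  [\/ u + 2 * p = L * (4 - a1), p + 2 * u = L * (4 - a2) | 2 * u - p = L * a2] ->
  lonely4 p u (u - p) (u + p) x <-> x <= 1 / 4 - 1 / (4 * L%:~R).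
Proof.
move=> pu p0u L0 ha1 [K1 hK1] ha2 [K2 hK2] b1 b2 b3 b4 hL; split.
  by apply: (@lonely4_upper _ _ _ _ a1 a2) => //; [exists K1|exists K2].
move=> hx; apply: lonely4_le hx _.
have [p0 u0] : p != 0 /\ u != 0 by clear -p0u; lia.
have L0R : L%:~R != 0 :> R by rewrite intr_eq0; clear -L0; lia.
have val (W e : int) : W = L * e -> 0 < e ->
    1 / 4 - 1 / (4 * L%:~R) = 1 / 4 - e%:~R / (4 * W%:~R) :> R.
  move=> -> e0; have e0R : e%:~R != 0 :> R by rewrite intr_eq0; clear -e0; lia.
  by rewrite intrM; field; rewrite L0R e0R.
have le_mulL (e : int) : 0 <= e -> e <= L * e.
  by move=> e0; rewrite ler_peMl // gtz0_ge1.
case: hL => hL.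
- rewrite (val _ _ hL); last by clear -ha1; lia.
  apply: (@lonely4_vertex_low _ _ _ _ (- K1 - 1)) => //; first by clear -p0u; lia.
    apply/andP; split; first by clear -ha1; lia.
    by rewrite hL; apply: le_mulL; clear -ha1; lia.
  by clear -hK1; lia.
- rewrite (val _ _ hL); last by clear -ha2; lia.
  apply: lonely4_swap.
  apply: (@lonely4_vertex_low _ _ _ _ (- K2 - 1)) => //.
  + by rewrite coprimez_sym.
  + by clear -p0u; lia.
  + apply/andP; split; first by clear -ha2; lia.
    by rewrite hL; apply: le_mulL; clear -ha2; lia.
  + by clear -hK2; lia.
- rewrite (val _ _ hL); last by clear -ha2; lia.
  apply: (@lonely4_vertex_high _ _ _ _ K2) => //; first by clear -p0u; lia.
    apply/andP; split; first by clear -ha2; lia.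
    by rewrite hL; apply: le_mulL; clear -ha2; lia.
Qed.

Lemma lonely4_quarter (R : realType) (p u K : int) :
  coprimez p u -> p != 0 -> 0 < u + 2 * p -> u - 2 * p = 4 * K ->
  lonely4 p u (u - p) (u + p) (1 / 4 : R).
Proof.
move=> pu p0 W0 hK.
have -> : 1 / 4 = 1 / 4 - 0%:~R / (4 * (u + 2 * p)%:~R) :> R.
  by rewrite mul0r subr0.
by apply: (@lonely4_vertex_low _ _ _ _ K); rewrite // ?subr0 // lexx ltW.
Qed.

Definition odd_ml (R : realType) (a b c d : int) : Prop :=
  exists K : int, 0 <= K /\ forall x : R,
    lonely4 a b c d x <-> x <= 1 / 4 - 1 / (4 * (2 * K + 1)%:~R).

Lemma odd_ml_iff (R : realType) (a b c d a' b' c' d' : int) :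
  (forall x : R, lonely4 a b c d x <-> lonely4 a' b' c' d' x) ->
  odd_ml R a' b' c' d' -> odd_ml R a b c d.
Proof. by move=> h [K [K0 hK]]; exists K; split=> // x; rewrite h. Qed.

Lemma odd_mlI (R : realType) (p u L a1 a2 : int) :
  coprimez p u -> 0 < p < u -> (exists K, 0 <= K /\ L = 2 * K + 1) ->
  0 < a1 < 4 -> (exists K, 2 * p - u - a1 = 4 * K) ->
  0 < a2 < 4 -> (exists K, 2 * u - p - a2 = 4 * K) ->
  u <= L * a1 -> u + 2 * p <= L * (4 - a1) ->
  2 * u - p <= L * a2 -> p + 2 * u <= L * (4 - a2) ->
  [\/ u + 2 * p = L * (4 - a1), p + 2 * u = L * (4 - a2) | 2 * u - p = L * a2] ->
  odd_ml R p u (u - p) (u + p).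
Proof.
move=> pu p0u [K [K0 LK]] ha1 hK1 ha2 hK2 b1 b2 b3 b4 hL; exists K; split=> // x.
have L0 : 0 < L by rewrite LK; clear -K0; lia.
by rewrite (lonely4_exact x pu p0u L0 ha1 hK1 ha2 hK2 b1 b2 b3 b4 hL) LK.
Qed.

(** A case distinction modulo 4. Coprimality excludes two even numbers; [u = 2 p] or [p = 2 u]
    modulo 4 would put (1/4, 1/2) or (1/2, 1/4) on the curve. In the eight remaining classes [L] is
    the largest of the four ratios that [lonely4_exact] compares it with, and it comes out odd each
    time. *)
Lemma odd_ml_B_coprime (R : realType) (p u : int) :
  coprimez p u -> 0 < p < u -> ~ lonely4 p u (u - p) (u + p) (1 / 4 : R) ->
  odd_ml R p u (u - p) (u + p).
Proof.
move=> pu p0u nl.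
have [p0 u0] : p != 0 /\ u != 0 by lia.
have neven : ~ ((exists k, p = 2 * k) /\ exists k, u = 2 * k).
  move=> [[k hk] [l hl]]; have : (2 %| gcdz p u)%Z.
    by rewrite dvdz_gcd hk hl !dvdz_mulr.
  by move: pu; rewrite /coprimez => /eqP ->.
have nu2 K : u != 4 * K + 2 * p.
  apply/eqP => h; apply: nl.
  by apply: (@lonely4_quarter _ _ _ K) => //; lia.
have np2 K : p != 4 * K + 2 * u.
  apply/eqP => h; apply: nl; apply: lonely4_swap.
  have up : coprimez u p by rewrite coprimez_sym.
  by apply: (@lonely4_quarter _ _ _ K) => //; lia.
clear nl p0 u0.
pose P := (p %/ 4)%Z; pose U := (u %/ 4)%Z.
have hP : p = 4 * P \/ p = 4 * P + 1 \/ p = 4 * P + 2 \/ p = 4 * P + 3.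
  by clear; rewrite /P; lia.
have hU : u = 4 * U \/ u = 4 * U + 1 \/ u = 4 * U + 2 \/ u = 4 * U + 3.
  by clear; rewrite /U; lia.
move: P U hP hU => P U hP hU.
case: hP => [hP|[hP|[hP|hP]]].
- have {}hU : u = 4 * U + 1 \/ u = 4 * U + 3.
    case: hU => [h|[h|[h|h]]]; [|by left| |by right]; case: neven; split.
    + by exists (2 * P); rewrite hP; ring.
    + by exists (2 * U); rewrite h; ring.
    + by exists (2 * P); rewrite hP; ring.
    + by exists (2 * U + 1); rewrite h; ring.
  clear neven nu2 np2; case: hU => hU.
  + apply: (@odd_mlI _ _ _ (u + 2 * p) 3 2 pu p0u) => //; clear pu; try lia.
    * by exists (2 * U + 4 * P); lia.
    * by exists (2 * P - U - 1); lia.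
    * by exists (2 * U - P); lia.
    * by apply: Or31; lia.
  + apply: (@odd_mlI _ _ _ (u + 2 * P) 1 2 pu p0u) => //; clear pu; try lia.
    * by exists (2 * U + P + 1); lia.
    * by exists (2 * P - U - 1); lia.
    * by exists (2 * U - P + 1); lia.
    * by apply: Or32; lia.
- clear neven np2; case: hU => [hU|[hU|[hU|hU]]].
  + apply: (@odd_mlI _ _ _ (p + 2 * u) 2 3 pu p0u) => //; clear pu nu2; try lia.
    * by exists (2 * P + 4 * U); lia.
    * by exists (2 * P - U); lia.
    * by exists (2 * U - P - 1); lia.
    * by apply: Or32; lia.
  + apply: (@odd_mlI _ _ _ (2 * u - p) 1 1 pu p0u) => //; clear pu nu2; try lia.
    * by exists (4 * U - 2 * P); lia.
    * by exists (2 * P - U); lia.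
    * by exists (2 * U - P); lia.
    * by apply: Or33; lia.
  + by case/eqP: (nu2 (U - 2 * P)); lia.
  (* Here [a1 = 3] and [a2 = 1], and either of these two numbers can be the larger. *)
  + clear nu2; have [h|h] := lerP (u + 2 * p) (2 * u - p).
      apply: (@odd_mlI _ _ _ (2 * u - p) 3 1 pu p0u) => //; clear pu; try lia.
      * by exists (4 * U - 2 * P + 2); lia.
      * by exists (2 * P - U - 1); lia.
      * by exists (2 * U - P + 1); lia.
      * by apply: Or33; lia.
    apply: (@odd_mlI _ _ _ (u + 2 * p) 3 1 pu p0u) => //; clear pu; try lia.
    * by exists (2 * U + 4 * P + 2); lia.
    * by exists (2 * P - U - 1); lia.
    * by exists (2 * U - P + 1); lia.
    * by apply: Or31; lia.
- have {}hU : u = 4 * U + 1 \/ u = 4 * U + 3.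
    case: hU => [h|[h|[h|h]]]; [|by left| |by right]; case: neven; split.
    + by exists (2 * P + 1); rewrite hP; ring.
    + by exists (2 * U); rewrite h; ring.
    + by exists (2 * P + 1); rewrite hP; ring.
    + by exists (2 * U + 1); rewrite h; ring.
  case: hU => hU; first by case/eqP: (np2 (P - 2 * U)); lia.
  by case/eqP: (np2 (P - 2 * U - 1)); lia.
- clear neven np2; case: hU => [hU|[hU|[hU|hU]]].
  + clear nu2; have [h|h] := lerP (2 * U + p) (2 * u - p).
      apply: (@odd_mlI _ _ _ (2 * u - p) 2 1 pu p0u) => //; clear pu; try lia.
      * by exists (4 * U - 2 * P - 2); lia.
      * by exists (2 * P - U + 1); lia.
      * by exists (2 * U - P - 1); lia.
      * by apply: Or33; lia.
    apply: (@odd_mlI _ _ _ (2 * U + p) 2 1 pu p0u) => //; clear pu; try lia.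
    * by exists (U + 2 * P + 1); lia.
    * by exists (2 * P - U + 1); lia.
    * by exists (2 * U - P - 1); lia.
    * by apply: Or31; lia.
  + apply: (@odd_mlI _ _ _ (p + 2 * u) 1 3 pu p0u) => //; clear pu nu2; try lia.
    * by exists (4 * U + 2 * P + 2); lia.
    * by exists (2 * P - U + 1); lia.
    * by exists (2 * U - P - 1); lia.
    * by apply: Or32; lia.
  + by case/eqP: (nu2 (U - 2 * P - 1)); lia.
  + apply: (@odd_mlI _ _ _ (p + 2 * u) 3 3 pu p0u) => //; clear pu nu2; try lia.
    * by exists (4 * U + 2 * P + 4); lia.
    * by exists (2 * P - U); lia.
    * by exists (2 * U - P); lia.
    * by apply: Or32; lia.
Qed.

Lemma gcd_split (p u : int) : p != 0 ->
  exists g p1 u1, [/\ 0 < g, p = g * p1, u = g * u1 & coprimez p1 u1].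
Proof.
move=> p0; pose g := gcdz p u.
have g0 : 0 < g by rewrite lt_def gcdz_eq0 (negbTE p0).
exists g, (p %/ g)%Z, (u %/ g)%Z; split=> //.
- by rewrite mulrC divzK // dvdz_gcdl.
- by rewrite mulrC divzK // dvdz_gcdr.
have gg : g * gcdz (p %/ g)%Z (u %/ g)%Z = g * 1.
  rewrite mulr1 -{1}(gtr0_norm g0) mulz_gcdr.
  by rewrite ![g * _]mulrC !divzK ?dvdz_gcdl ?dvdz_gcdr.
by rewrite /coprimez; apply/eqP/(mulfI _ gg); rewrite gt_eqF.
Qed.

(** Signs and order of [p] and [u] only permute and negate the four entries, and a common factor is
    absorbed by [t]. That [u - p] and [u + p] are nonzero makes [|p|] and [|u|] distinct. *)
Lemma odd_ml_B (R : realType) (p u : int) :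
  p != 0 -> u != 0 -> u - p != 0 -> u + p != 0 ->
  ~ lonely4 p u (u - p) (u + p) (1 / 4 : R) -> odd_ml R p u (u - p) (u + p).
Proof.
move=> p0 u0 d0 s0 nl.
have [a [b [ab h]]] : exists a b, 0 < a < b /\ forall x : R,
    lonely4 p u (u - p) (u + p) x <-> lonely4 a b (b - a) (b + a) x.
  exists (Num.min `|p| `|u|), (Num.max `|p| `|u|); split.
    by have [h|h] := lerP `|p| `|u|; lia.
  move=> x; have [h|h] := lerP `|p| `|u|;
    case: (ger0P p) h => hp; case: (ger0P u) => hu h;
    by split; apply: lonely4_mono; clear -p0; solve_special.
have a0 : a != 0 by clear -ab; lia.
have [g [a1 [b1 [g0 ea eb cop]]]] := gcd_split b a0.
have g_neq0 : g != 0 by rewrite gt_eqF.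
have h' x : lonely4 p u (u - p) (u + p) x <-> lonely4 a1 b1 (b1 - a1) (b1 + a1) (x : R).
  by rewrite h ea eb -mulrBr -mulrDr; exact: lonely4_scale.
apply: (odd_ml_iff h'); apply: odd_ml_B_coprime => //; last by rewrite -h'.
by move: ab; rewrite ea eb pmulr_rgt0 // ltr_pM2l.
Qed.

(** The value is [M = k / (4 k + 1)], attained at [t = M], where [4 k t = k - M]. Conversely let [y]
    be the distance of [t] to the integers. For [y > 1/3] the entries 2 and 3 give [x <= 1/5 <= M].
    Otherwise [x > M] would put [y] strictly between [M] and [(1 - M) / 3], where [4 k y] is within
    [M] of [k]. *)
Lemma lonely4_123 (R : realType) (k : int) (x : R) : 0 < k ->
  lonely4 1 2 3 (4 * k) x <-> x <= 1 / 4 - 1 / (4 * (4 * k + 1)%:~R).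
Proof.
move=> k0; have k1 : 1 <= k%:~R :> R by rewrite ler1z.
pose M : R := k%:~R / (4 * k%:~R + 1).
have hM : M * (4 * k%:~R + 1) = k%:~R by rewrite /M divfK // gt_eqF //; lra.
have -> : 1 / 4 - 1 / (4 * (4 * k + 1)%:~R) = M.
  rewrite intrD intrM /M; field; rewrite gt_eqF //; lra.
have M5 : 1 / 5 <= M by rewrite /M ler_pdivlMr; lra.
have M4 : M < 1 / 4 by rewrite /M ltr_pdivrMr; lra.
clearbody M; split; last first.
  move=> hx; apply: lonely4_le hx _; exists M; split.
  - apply: (@le_dist_int_between _ 0); lra.
  - apply: (@le_dist_int_between _ 0); lra.
  - apply: (@le_dist_int_between _ 0); lra.
  - apply: (@le_dist_int_between _ (k - 1)); rewrite intrB intrM; lra.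
move=> [t [t1 t2 t3 t4]]; rewrite leNgt; apply/negP => hx.
have [m [m2 tm]] := dist_intP t.
have [y [y2 xy y1 y3 y4]] : exists y : R, [/\ y <= 1 / 2, x <= y,
    x <= 1 - 2 * y, x <= `|3 * y - 1| & x <= `|4 * k%:~R * y - k%:~R|].
  exists `|t - m%:~R|; split=> //.
  - by rewrite -tm; move: t1; rewrite mulr1.
  - have d := le_trans t2 (dist_int_le _ (2 * m + 1)).
    have e := le_trans t2 (dist_int_le _ (2 * m - 1)).
    move: m2 d e; rewrite !(intrB, intrD, intrM); case: (ger0P (t - m%:~R)) => h m2 d e.
      by move: d; rewrite ler0_norm; lra.
    by move: e; rewrite ger0_norm; lra.
  - case: (ger0P (t - m%:~R)) => h.
      apply: le_trans t3 _; apply: le_trans (dist_int_le _ (3 * m + 1)) _.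
      have -> : (3 * m + 1)%:~R = 3 * m%:~R + 1 :> R by rewrite intrD intrM.
      by rewrite le_eqVlt; apply/orP; left; apply/eqP; congr `|_|; ring.
    apply: le_trans t3 _; apply: le_trans (dist_int_le _ (3 * m - 1)) _.
    have -> : (3 * m - 1)%:~R = 3 * m%:~R - 1 :> R by rewrite intrB intrM.
    by rewrite -normrN le_eqVlt; apply/orP; left; apply/eqP; congr `|_|; ring.
  - case: (ger0P (t - m%:~R)) => h.
      apply: le_trans t4 _; apply: le_trans (dist_int_le _ (4 * k * m + k)) _.
      have -> : (4 * k * m + k)%:~R = 4 * k%:~R * m%:~R + k%:~R :> R.
        by rewrite intrD !intrM.
      by rewrite intrM le_eqVlt; apply/orP; left; apply/eqP; congr `|_|; ring.
    apply: le_trans t4 _; apply: le_trans (dist_int_le _ (4 * k * m - k)) _.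
    have -> : (4 * k * m - k)%:~R = 4 * k%:~R * m%:~R - k%:~R :> R.
      by rewrite intrB !intrM.
    by rewrite intrM -normrN le_eqVlt; apply/orP; left; apply/eqP; congr `|_|; ring.
have kM : k%:~R * (1 - 4 * M) = M by lra.
have [h|h] := lerP (3 * y) 1; last first.
  move: y3; rewrite ger0_norm; lra.
rewrite ler0_norm in y3; last lra.
have kR : 0 < k%:~R :> R by rewrite ltr0z.
have d1 : 0 < y - M by clear -xy hx; lra.
have d2 : 0 < 1 - M - 3 * y by clear -y3 hx; lra.
have g1 := mulr_gt0 kR d1; have g2 := mulr_gt0 kR d2.
have : `|4 * k%:~R * y - k%:~R| < M by rewrite ltr_norml; clear -g1 g2 kM M5; lra.
by clear -y4 hx; lra.
Qed.

Lemma lonely4_123_quarter (R : realType) (c : int) :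
  ~~ (4 %| c)%Z -> lonely4 1 2 3 c (1 / 4 : R).
Proof.
move=> hc; exists (1 / 4); split.
- apply: (@le_dist_int_between _ 0); lra.
- apply: (@le_dist_int_between _ 0); lra.
- apply: (@le_dist_int_between _ 0); lra.
pose q := (c %/ 4)%Z; pose r := (c %% 4)%Z.
have cE : c = 4 * q + r by rewrite [LHS](divz_eq c 4) mulrC.
have r1 : 1 <= r <= 3 by move: hc; rewrite /r; lia.
have cR : c%:~R = 4 * q%:~R + r%:~R :> R by rewrite cE intrD intrM.
have [rl ru] : 1 <= r%:~R :> R /\ r%:~R <= 3 :> R.
  by case/andP: r1 => r1 r3; rewrite ler1z -[3]/(3%:~R) ler_int.
apply: (@le_dist_int_between _ q); lra.
Qed.

(** The times [(4 k + 1) / (4 a)] put the first three entries at 1/4, 1/2 and 3/4. As [c] is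
    invertible modulo [a], a suitable [k] puts the last at [(c + 4 j) / (4 a)] modulo 1 for any
    chosen [j]. Rounding [(a - c) / 4] up gives [a <= c + 4 j <= a + 3], and [a + 3 <= 3 a] because
    [a >= 2]. *)
Lemma lonely4_multiples_quarter (R : realType) (a c : int) :
  1 < a -> coprimez a c -> lonely4 a (2 * a) (3 * a) c (1 / 4 : R).
Proof.
move=> a1 /coprimezP[[s w] /= sw].
pose j := ((a - c + 3) %/ 4)%Z.
have [j1 j2] : a - c <= 4 * j /\ 4 * j <= a - c + 3 by rewrite /j; lia.
have aR : 2 <= a%:~R :> R by rewrite -[2]/(2%:~R) ler_int; lia.
pose k := w * j.
exists ((4 * k%:~R + 1) / (4 * a%:~R)).
have ta : (4 * k%:~R + 1) / (4 * a%:~R) * a%:~R = k%:~R + 1 / 4 :> R.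
  by field; rewrite gt_eqF //; lra.
split.
- by rewrite ta; apply: (@le_dist_int_between _ k); lra.
- by rewrite intrM mulrCA ta; apply: (@le_dist_int_between _ (2 * k)); rewrite intrM; lra.
- by rewrite intrM mulrCA ta; apply: (@le_dist_int_between _ (3 * k)); rewrite intrM; lra.
have -> : (4 * k%:~R + 1) / (4 * a%:~R) * c%:~R =
    (- (s * j))%:~R + (c + 4 * j)%:~R / (4 * a%:~R) :> R.
  have kc : k * c = j - s * j * a.
    have -> : k * c = j * (s * a + w * c) - s * j * a by rewrite /k; ring.
    by rewrite sw mulr1.
  have kcR : k%:~R * c%:~R = j%:~R - s%:~R * j%:~R * a%:~R :> R.
    by rewrite -!intrM kc intrB !intrM.
  apply: (@mulIf _ (4 * a%:~R)); first by rewrite gt_eqF //; lra.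
  have aD : 4 * a%:~R != 0 :> R by rewrite gt_eqF //; lra.
  rewrite [LHS]mulrAC divfK // [RHS]mulrDl divfK //.
  have -> : (- (s * j))%:~R = - (s%:~R * j%:~R) :> R by rewrite intrN intrM.
  have -> : (c + 4 * j)%:~R = c%:~R + 4 * j%:~R :> R by rewrite intrD intrM.
  by clear -kcR; lra.
have h1 : a%:~R <= (c + 4 * j)%:~R :> R by rewrite ler_int; lia.
have h2 : (c + 4 * j)%:~R <= 3 * a%:~R :> R.
  by have -> : 3 * a%:~R = (3 * a)%:~R :> R; [rewrite intrM|rewrite ler_int; lia].
have h3 : 1 / 4 <= (c + 4 * j)%:~R / (4 * a%:~R) :> R by rewrite ler_pdivlMr; lra.
have h4 : (c + 4 * j)%:~R / (4 * a%:~R) <= 3 / 4 :> R by rewrite ler_pdivrMr; lra.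
apply: (@le_dist_int_between _ (- (s * j))); lra.
Qed.

Lemma odd_ml_A (R : realType) (p q : int) : p != 0 -> q != 0 ->
  ~ lonely4 p (2 * p) (3 * p) q (1 / 4 : R) -> odd_ml R p (2 * p) (3 * p) q.
Proof.
move=> p0 q0.
have e (x : R) : lonely4 p (2 * p) (3 * p) q x <->
    lonely4 `|p| (2 * `|p|) (3 * `|p|) `|q| x.
  by case: (ger0P p) => hp; case: (ger0P q) => hq;
    split; apply: lonely4_mono; clear -p0; solve_special.
rewrite e => nl; apply: (odd_ml_iff e); move: nl.
have a0 : `|p| != 0 by rewrite normr_eq0.
have [g [a [c [g0 pE qE cop]]]] := gcd_split `|q| a0.
have g_neq0 : g != 0 by rewrite gt_eqF.
have a1 : 0 < a by rewrite -(pmulr_rgt0 _ g0) -pE normr_gt0.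
have c1 : 0 < c by rewrite -(pmulr_rgt0 _ g0) -qE normr_gt0.
rewrite pE qE; have e' (x : R) : lonely4 (g * a) (2 * (g * a)) (3 * (g * a)) (g * c) x <->
    lonely4 a (2 * a) (3 * a) c x.
  by rewrite [2 * (g * a)]mulrCA [3 * (g * a)]mulrCA; exact: lonely4_scale.
rewrite e' => nl; apply: (odd_ml_iff e').
have {}a1 : a = 1.
  apply/eqP; apply: contrapT => /negP an1; apply: nl.
  by apply: lonely4_multiples_quarter => //; clear -a1 an1; lia.
have /dvdzP[k ck] : (4 %| c)%Z.
  by apply: contrapT => /negP h; apply: nl; rewrite a1 !mulr1; exact: lonely4_123_quarter.
have k0 : 0 < k by clear -ck c1; lia.
rewrite a1 !mulr1 ck [k * 4]mulrC; exists (2 * k); split; first by clear -k0; lia.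
move=> x; rewrite lonely4_123 //.
by have -> : 2 * (2 * k) + 1 = 4 * k + 1 by ring.
Qed.

(** * Comparison of the spectrum with the progression *)

Lemma special4_value (R : realType) (v : 'I_4 -> int) (x : R) :
  (forall k, v k != 0) -> (forall c, lonely v c <-> c <= x) -> x < 1 / 4 ->
  special4 R (v (@ord4 0 isT)) (v (@ord4 1 isT)) (v (@ord4 2 isT)) (v (@ord4 3 isT)) ->
  exists s : nat, x = 1 / 4 - 1 / (4 * (2 * s%:R + 1)).
Proof.
move=> v0 hv x4 sp.
have nl : ~ lonely4 (v (@ord4 0 isT)) (v (@ord4 1 isT)) (v (@ord4 2 isT)) (v (@ord4 3 isT)) (1 / 4 : R).
  by move/lonely4P/hv; rewrite leNgt x4.
have [K [K0 hK]] : odd_ml R (v (@ord4 0 isT)) (v (@ord4 1 isT)) (v (@ord4 2 isT)) (v (@ord4 3 isT)).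
  case: sp => [[p [q [p0 q0 h]]]|[p [u [p0 u0 d0 s0 h]]]]; apply: (odd_ml_iff h).
    by apply: odd_ml_A => //; rewrite -h.
  by apply: odd_ml_B => //; rewrite -h.
case: K K0 hK => // s _ hK; exists s.
have -> : 2 * s%:R + 1 = (2 * s%:Z + 1)%:~R :> R by rewrite intrD intrM.
apply/eqP; rewrite eq_le; apply/andP; split.
  by apply/hK/lonely4P/hv.
by apply/hv/lonely4P/hK.
Qed.

(** Put [L = 2 s + 3]; odd [s] gives [L = 1] modulo 4 and the vector (1, 2, 3, L - 1). For [p]
    divisible by 4 and [u = 3] modulo 4 the exact value has [L = u + p / 2], so 8 is the least [p]
    that yields [L = 3] modulo 4. For even [s], the condition [8 < u = 2 s - 1] means [s >= 6]. *)
Lemma odd_ml_attained (R : realType) (s : nat) : (6 <= s)%N ->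
  exists v : 'I_4 -> int, (forall k, v k != 0) /\
    forall c : R, lonely v c <-> c <= 1 / 4 - 1 / (4 * (2 * s%:R + 3)).
Proof.
move=> s6.
pose vec (a b c d : int) (k : 'I_4) : int := nth 0 [:: a; b; c; d] k.
have [[k sk]|[k sk]] : (exists k, s = 2 * k + 1)%N \/ (exists k, s = 2 * k)%N.
  by case: (boolP (odd s)) => h; [left|right]; exists s./2; lia.
  exists (vec 1 2 3 (4 * (k + 1)%:Z)); split.
    by case=> [[|[|[|[|//]]]] hk]; rewrite /vec /=; lia.
  move=> c; rewrite lonely4P /vec /= lonely4_123; last by lia.
  have -> : (4 * (k + 1)%:Z + 1)%:~R = 2 * s%:R + 3 :> R.
    have -> : 2 * s%:R + 3 = (2 * s%:Z + 3)%:~R :> R by rewrite intrD intrM.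
    by congr (_%:~R); rewrite sk; lia.
  by [].
pose u : int := 2 * s%:Z - 1.
exists (vec 8 u (u - 8) (u + 8)); split.
  by case=> [[|[|[|[|//]]]] hk]; rewrite /vec /u /=; lia.
move=> c; rewrite lonely4P /vec /=.
rewrite (@lonely4_exact R 8 u (u + 4) 1 2 c) //; try (rewrite /u; lia).
- have -> : (u + 4)%:~R = 2 * s%:R + 3 :> R; last by [].
  have -> : 2 * s%:R + 3 = (2 * s%:Z + 3)%:~R :> R by rewrite intrD intrM.
  by congr (_%:~R); rewrite /u; lia.
(* The odd number [u] is its own inverse modulo 8. *)
- apply/coprimezP; exists (- (2 * k%:Z ^+ 2 - k%:Z), u) => /=.
  by rewrite /u sk PoszM; ring.
- by exists (4 - k%:Z); rewrite /u; lia.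
- by exists (2 * k%:Z - 3); rewrite /u; lia.
- by apply: Or32; rewrite /u; lia.
Qed.

Theorem theorem1p3 (R : realType) :
  finite_set ((spectrum R 1 4 `&` `]1 / 4, 1 / 2]) `+`
              [set 1 / 4 + 1 / p | p in Prog (8 : R) 12]) /\
  [set 1 / 4 + 1 / p | p in Prog (8 : R) 12] =
  [set 1 / 4 + 1 / (4 * p) | p in Prog (2 : R) 3].
Proof.
have eqP4 (s : nat) : 8 * s%:R + 12 = 4 * (2 * s%:R + 3) :> R by ring.
split; last first.
  rewrite eqEsubset; split=> _ [_ [s _ <-] <-].
    by exists (2 * s%:R + 3); [exists s|rewrite eqP4].
  by exists (8 * s%:R + 12); [exists s|rewrite eqP4].
rewrite /setY finite_setU; split.
  apply: (@sub_finite_set _ _ ([set 1 / 2 - x | x in [set x : R | exists v, ml_value v x]]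
                                `|` [set 1 / 2])).
    move=> D [[/(spectrum1P _ (isT : (0 < 4)%N))[v [v0 hv]]]].
    rewrite /= in_itv /= => /andP[D4 D2] hB.
    have [sp|nsp] := pselect (special4 R (v (@ord4 0 isT)) (v (@ord4 1 isT))
                                         (v (@ord4 2 isT)) (v (@ord4 3 isT))); last first.
      left; exists (1 / 2 - D); last by rewrite subKr.
      by exists v; split=> //; lra.
    have [|[|s] Ds] := special4_value v0 hv _ sp; first lra.
      (* Here [L = 1] and [D = 1/2], the only odd [L] that the progression, starting at [L = 3],
         does not contain. *)
      by right; move: Ds; rewrite mulr0 add0r mulr1 => Ds /=; lra.
    case: hB; exists (8 * s%:R + 12); first by exists s.
    have e : 2 * s.+1%:R + 1 = 2 * s%:R + 3 :> R by rewrite -(natr1 s); ring.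
    by move: Ds; rewrite eqP4 e; lra.
  rewrite finite_setU; split; last exact: finite_set1.
  exact/finite_image/nonspecial_values_finite.
(* Only the six terms outside the range of [odd_ml_attained] can be missing from the spectrum. *)
apply: (@sub_finite_set _ _ [set 1 / 4 + 1 / (8 * s%:R + 12) | s in `I_6]).
  move=> _ [[_ [s _ <-] <-] hA]; exists s => //=.
  rewrite ltnNge; apply/negP => s6; apply: hA.
  have [v [v0 hv]] := odd_ml_attained R s6.
  have s0 : 0 <= s%:R :> R by [].
  split.
    apply/spectrum1P => //; exists v; split=> // c; rewrite hv eqP4.
    by have -> : 1 / 2 - (1 / 4 + 1 / (4 * (2 * s%:R + 3))) =
      1 / 4 - 1 / (4 * (2 * s%:R + 3)) :> R by lra.
  have h : 0 < 8 * s%:R + 12 :> R by lra.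
  rewrite /= in_itv /=; apply/andP; split; first by rewrite ltrDl divr_gt0.
  have : 1 / (8 * s%:R + 12) <= 1 / 4 :> R by rewrite ler_pdivrMr //; lra.
  lra.
exact/finite_image/finite_II.
Qed.
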